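(* Let $\mathbb{D}_Q\subset\mathbb{M}^d$ be a nc operator ball, let $(\mathcal{A},\tau)$ be either $A(\mathbb{D}_Q)$ with the norm topology or $H^\infty(\mathbb{D}_Q)$ with the bounded-pointwise topology, and let $\mathcal{J}\triangleleft\mathcal{A}$ be a $\tau$-closed homogeneous ideal. Then the map $\overline{R}:\mathcal{A}/\mathcal{J}\to\mathcal{A}(V(\mathcal{J}))$ given by $\overline{R}(\overline{F})=F|_{V(\mathcal{J})}$ for all $\overline{F}\in\mathcal{A}/\mathcal{J}$ (the class of $F\in\mathcal{A}$) is a completely isometric isomorphism of algebras.
   Context: $M_n^d$ is the set of $d$-tuples of complex $n\times n$ matrices ($M_n=M_n^1$); $\mathbb{M}^d=\sqcup_{n\ge1}M_n^d$; for $\Omega\subseteq\mathbb{M}^d$, $\Omega(n)=\Omega\cap M_n^d$. A nc function $f:\Omega\to\mathbb{M}^1$ on a set $\Omega$ closed under direct sums is a graded map ($X\in\Omega(n)\Rightarrow f(X)\in M_n$) with $f(X\oplus Y)=f(X)\oplus f(Y)$ and $f(S^{-1}XS)=S^{-1}f(X)S$ whenever $S\in GL_n$ and $X,S^{-1}XS\in\Omega(n)$. NC operator ball: given Hilbert spaces $\mathcal{R},\mathcal{S}$ and linearly independent $Q_1,\dots,Q_d\in\mathcal{L}(\mathcal{R},\mathcal{S})$, put $Q(X)=\sum_jQ_j\otimes X_j$ for $X\in\mathbb{M}^d$ and $\mathbb{D}_Q=\{X\in\mathbb{M}^d:\|Q(X)\|<1\}$. For a nc set $\mathfrak{X}\subseteq\mathbb{D}_Q$,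 $H^\infty(\mathfrak{X})$ is the algebra of bounded nc functions $\mathfrak{X}\to\mathbb{M}^1$ with norm $\|f\|=\sup_{X\in\mathfrak{X}}\|f(X)\|$ and matrix norms $\|[f_{jk}]\|=\sup_{X\in\mathfrak{X}}\|[f_{jk}(X)]\|$; $A(\mathfrak{X})$ is the norm closure in $H^\infty(\mathfrak{X})$ of the restrictions of free nc polynomials. $\mathcal{A}(\mathfrak{X})$ denotes $A(\mathfrak{X})$ if $\mathcal{A}=A(\mathbb{D}_Q)$ and $H^\infty(\mathfrak{X})$ if $\mathcal{A}=H^\infty(\mathbb{D}_Q)$. The bounded-pointwise topology on $H^\infty(\mathbb{D}_Q)$ is the weakest topology in which a bounded net $F^{(\kappa)}$ converges to $F$ if and only if $F^{(\kappa)}(X)\to F(X)$ in norm for every $X\in\mathbb{D}_Q$. Every $F\in H^\infty(\mathbb{D}_Q)$ has a power series $F(X)=\sum_{\alpha\in\mathbb{F}_d^+}c_\alpha X^\alpha$ on $\mathbb{D}_Q$ ($\mathbb{F}_d^+$ the free monoid on $d$ letters); its $k$-th homogeneous part is $F_k=\sum_{|\alpha|=k}c_\alpha Z^\alpha$. A (two-sided) ideal $\mathcal{J}$ is homogeneous if $F\in\mathcal{J}$ implies $F_k\in\mathcal{J}$ for all $k\ge0$. $V(\mathcal{J})=\{X\in\mathbb{D}_Q:F(X)=0\ \forall F\in\mathcal{J}\}$. The quotient $\mathcal{A}/\mathcal{J}$ carries the quotient matrix norms from $M_n(\mathcal{A})/M_n(\mathcal{J})$. *)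

(* Defs.v *)
From HB Require Import structures.
From mathcomp Require Import all_boot all_order all_algebra complex.
From mathcomp Require Import sesquilinear generic_quotient ring_quotient.
From mathcomp Require Import boolp classical_sets functions reals topology.
From mathcomp Require Import normedtype ring.

Set Implicit Arguments.
Unset Strict Implicit.
Unset Printing Implicit Defensive.

Import Order.TTheory GRing.Theory Num.Theory numFieldNormedType.Exports.

Local Open Scope classical_set_scope.
Local Open Scope complex_scope.
Local Open Scope ring_scope.

(** ** Hilbert spaces and operator norms *)

(* A Hilbert space is a complete normed space over [R[i]] whose norm comes from
   an inner product. *)
Definition is_hilbert (R : realType) (H : completeNormedModType R[i]) : Prop :=
  exists ip : {dot H for (@Num.conj R[i])}, forall u : H, `|u| ^+ 2 = ip u u.

(* Norm of the Hilbert sum of [n] copies of [E], that is, of [E (x) C^n]; norms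
   over [R[i]] are complex numbers with zero imaginary part, whence the [Re]. *)
Definition l2norm (R : realType) (E : normedZmodType R[i]) n
    (v : 'I_n -> E) : R :=
  Num.sqrt (\sum_i (complex.Re `|v i|) ^+ 2).

Definition opnorm (R : realType) (E F : normedZmodType R[i]) m n
    (T : ('I_m -> E) -> ('I_n -> F)) : R :=
  sup [set l2norm (T v) | v in [set v | l2norm v <= 1]].

Definition mxapp (R : realType) m n (A : 'M[R[i]]_(m, n))
    (v : 'I_n -> R[i]) : 'I_m -> R[i] :=
  fun i => \sum_k A i k * v k.

(* Not the norm [`|A|] of the library, which is the maximum of the entries. *)
Definition mxopnorm (R : realType) m n (A : 'M[R[i]]_(m, n)) : R :=
  opnorm (mxapp A).

(** ** Tuples of matrices and nc operator balls *)

(* The disjoint union over [n] of the d-tuples of matrices of size [n.+1]; the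
   tag of a point is the predecessor of its size. *)
Definition mxuniv (R : realType) (d : nat) : Type :=
  {n : nat & 'I_d -> 'M[R[i]]_n.+1}.

Definition lvl (R : realType) d (X : mxuniv R d) : nat := (tag X).+1.

Definition coord (R : realType) d (X : mxuniv R d) (j : 'I_d) :
    'M[R[i]]_(lvl X) :=
  tagged X j.

Definition mkpt (R : realType) d n (X : 'I_d -> 'M[R[i]]_n.+1) : mxuniv R d :=
  Tagged (fun n => 'I_d -> 'M[R[i]]_n.+1) X.

(* [(tag X).+1 + (tag Y).+1] is convertible to [(tag X + (tag Y).+1).+1]. *)
Definition dsum (R : realType) d (X Y : mxuniv R d) : mxuniv R d :=
  @mkpt R d (tag X + (tag Y).+1)
    (fun j => block_mx (tagged X j) 0 0 (tagged Y j)).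

Definition simpt (R : realType) d (X : mxuniv R d) (S : 'M[R[i]]_(lvl X)) :
    mxuniv R d :=
  @mkpt R d (tag X) (fun j => invmx S *m tagged X j *m S).

(* With [H (x) C^n] identified with ['I_n -> H], the operator [Q(X) =
   \sum_j Q_j (x) X_j]. *)
Definition ncop (R : realType) d (H K : normedModType R[i])
    (Q : 'I_d -> {linear H -> K}) (X : mxuniv R d) (v : 'I_(lvl X) -> H) :
    'I_(lvl X) -> K :=
  fun i => \sum_j \sum_k coord X j i k *: Q j (v k).

Definition opball (R : realType) d (H K : normedModType R[i])
    (Q : 'I_d -> {linear H -> K}) : set (mxuniv R d) :=
  [set X | opnorm (@ncop R d H K Q X) < 1].

Definition lin_indep (R : realType) d (H K : normedModType R[i])
    (Q : 'I_d -> {linear H -> K}) : Prop :=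
  forall c : 'I_d -> R[i],
    (forall v, \sum_j c j *: Q j v = 0) -> forall j, c j = 0.

(** ** Graded functions *)

Section GradedFunctions.
Context (R : realType) (d : nat) (D : set (mxuniv R d)).

Definition gfun : Type := forall X : mxuniv R d, D X -> 'M[R[i]]_(lvl X).

Implicit Types f g h : gfun.

HB.instance Definition _ := gen_eqMixin gfun.
HB.instance Definition _ := gen_choiceMixin gfun.

Definition gadd f g : gfun := fun X hX => f X hX + g X hX.
Definition gopp f : gfun := fun X hX => - f X hX.
Definition gzero : gfun := fun X hX => 0.
Definition gmul f g : gfun := fun X hX => f X hX *m g X hX.
Definition gone : gfun := fun X hX => 1%:M.
Definition gscale (c : R[i]) f : gfun := fun X hX => c *: f X hX.

Lemma gfunP f g : (forall X hX, f X hX = g X hX) -> f = g.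
Proof.
move=> fg; apply: functional_extensionality_dep => X.
by apply: functional_extensionality_dep => hX; exact: fg.
Qed.

Let gaddA : associative gadd.
Proof. by move=> f g h; apply: gfunP => X hX; exact: addrA. Qed.
Let gaddC : commutative gadd.
Proof. by move=> f g; apply: gfunP => X hX; exact: addrC. Qed.
Let gadd0 : left_id gzero gadd.
Proof. by move=> f; apply: gfunP => X hX; exact: add0r. Qed.
Let gaddN : left_inverse gzero gopp gadd.
Proof. by move=> f; apply: gfunP => X hX; exact: addNr. Qed.

HB.instance Definition _ := GRing.isZmodule.Build gfun gaddA gaddC gadd0 gaddN.

Let gmulA : associative gmul.
Proof. by move=> f g h; apply: gfunP => X hX; exact: mulmxA. Qed.
Let gmul1l : left_id gone gmul.
Proof. by move=> f; apply: gfunP => X hX; exact: mul1mx. Qed.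
Let gmul1r : right_id gone gmul.
Proof. by move=> f; apply: gfunP => X hX; exact: mulmx1. Qed.
Let gmulDl : left_distributive gmul +%R.
Proof. by move=> f g h; apply: gfunP => X hX; exact: mulmxDl. Qed.
Let gmulDr : right_distributive gmul +%R.
Proof. by move=> f g h; apply: gfunP => X hX; exact: mulmxDr. Qed.

HB.instance Definition _ := GRing.Zmodule_isPzRing.Build gfun
  gmulA gmul1l gmul1r gmulDl gmulDr.

Let gscaleA a b f : gscale a (gscale b f) = gscale (a * b) f.
Proof. by apply: gfunP => X hX; exact: scalerA. Qed.
Let gscale1 : left_id 1 gscale.
Proof. by move=> f; apply: gfunP => X hX; exact: scale1r. Qed.
Let gscaleDr : right_distributive gscale +%R.
Proof. by move=> a f g; apply: gfunP => X hX; exact: scalerDr. Qed.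
Let gscaleDl f : {morph gscale^~ f : a b / a + b}.
Proof. by move=> a b; apply: gfunP => X hX; exact: scalerDl. Qed.

HB.instance Definition _ := GRing.Zmodule_isLmodule.Build R[i] gfun
  gscaleA gscale1 gscaleDr gscaleDl.

End GradedFunctions.

Definition gres (R : realType) d (B D : set (mxuniv R d)) (sBD : B `<=` D)
    (f : gfun D) : gfun B :=
  fun X hX => f X (sBD X hX).

(** ** The algebras [H^oo] and [A] *)

Definition is_ncfun (R : realType) d (D : set (mxuniv R d)) (f : gfun D) :
    Prop :=
  (forall X Y (hX : D X) (hY : D Y) (hXY : D (dsum X Y)),
      f (dsum X Y) hXY = block_mx (f X hX) 0 0 (f Y hY)) /\
  (forall X (S : 'M[R[i]]_(lvl X)) (hX : D X) (hS : D (simpt S)),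
      S \in unitmx -> f (simpt S) hS = invmx S *m f X hX *m S).

Definition is_bdd (R : realType) d (D : set (mxuniv R d)) (f : gfun D) :
    Prop :=
  exists M : R, forall X hX, mxopnorm (f X hX) <= M.

Definition ncmon (R : realType) d (X : mxuniv R d) (w : seq 'I_d) :
    'M[R[i]]_(lvl X) :=
  \prod_(j <- w) coord X j.

(* A free nc polynomial is a finite list of terms (coefficient, word). *)
Definition is_ncpoly (R : realType) d (D : set (mxuniv R d)) (p : gfun D) :
    Prop :=
  exists s : seq (R[i] * seq 'I_d),
    forall X hX, p X hX = \sum_(t <- s) t.1 *: ncmon X t.2.

(* [ncalg D NormClosed] will be A(D) and [ncalg D Bounded] will be H^oo(D). *)
Inductive algkind := NormClosed | Bounded.

Definition in_hinf (R : realType) d (D : set (mxuniv R d)) (f : gfun D) :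
    Prop :=
  is_ncfun f /\ is_bdd f.

(* The norm closure of the polynomials in [H^oo(D)]; the polynomials at finite
   distance from a bounded function are themselves bounded. *)
Definition in_acl (R : realType) d (D : set (mxuniv R d)) (f : gfun D) :
    Prop :=
  in_hinf f /\
  forall e : R, 0 < e -> exists p : gfun D,
    is_ncpoly p /\ forall X hX, mxopnorm (f X hX - p X hX) <= e.

Definition in_ncalg (k : algkind) (R : realType) d (D : set (mxuniv R d))
    (f : gfun D) : Prop :=
  match k with NormClosed => in_acl f | Bounded => in_hinf f end.

Section OpnormTheory.
Context (R : realType).
Local Notation C := R[i].

Let nm (z : C) : R := complex.Re `|z|.

Let nmE (z : C) : (nm z)%:C = `|z|.
Proof.
rewrite /nm; have /ger0_real/complex_realP[x ->] // := normr_ge0 z.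
Qed.

Let nm_ge0 z : 0 <= nm z.
Proof. by rewrite -ler0c nmE. Qed.

Let nmD z w : nm (z + w) <= nm z + nm w.
Proof. by rewrite -lecR rmorphD /= !nmE ler_normD. Qed.

Let nmM z w : nm (z * w) = nm z * nm w.
Proof. by apply: (fmorph_inj (real_complex R)); rewrite rmorphM /= !nmE normrM. Qed.

Let nmN z : nm (- z) = nm z.
Proof. by rewrite /nm normrN. Qed.

Let nm0 : nm 0 = 0.
Proof. by rewrite /nm normr0. Qed.

Let nm_eq0 z : nm z = 0 -> z = 0.
Proof. by move=> z0; apply/eqP; rewrite -normr_eq0 -nmE z0. Qed.

Let nm_sum I (r : seq I) (F : I -> C) :
  nm (\sum_(i <- r) F i) <= \sum_(i <- r) nm (F i).
Proof.
elim/big_ind2: _ => //; first by rewrite nm0.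
by move=> a b c e ab ce; apply: le_trans (nmD _ _) _; exact: lerD.
Qed.

Let l2 n (v : 'I_n -> C) : R := l2norm v.

Let l2E n (v : 'I_n -> C) : l2 v = Num.sqrt (\sum_i nm (v i) ^+ 2).
Proof. by []. Qed.

Let l2_ge0 n (v : 'I_n -> C) : 0 <= l2 v.
Proof. exact: sqrtr_ge0. Qed.

Let ss_ge0 n (v : 'I_n -> C) : 0 <= \sum_i nm (v i) ^+ 2.
Proof. by apply: sumr_ge0 => i _; exact: sqr_ge0. Qed.

Let l2_sqr n (v : 'I_n -> C) : l2 v ^+ 2 = \sum_i nm (v i) ^+ 2.
Proof. by rewrite l2E sqr_sqrtr. Qed.

Let l2_le_sqr n (v : 'I_n -> C) (c : R) : 0 <= c ->
  \sum_i nm (v i) ^+ 2 <= c ^+ 2 -> l2 v <= c.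
Proof. by move=> c0 h; rewrite l2E -(ger0_norm c0) -sqrtr_sqr ler_wsqrtr. Qed.

Let nm_le_l2 n (v : 'I_n -> C) i : nm (v i) <= l2 v.
Proof.
rewrite -(@ler_pXn2r _ 2) ?nnegrE // l2_sqr (bigD1 i) //= lerDl.
by apply: sumr_ge0 => j _; exact: sqr_ge0.
Qed.

Let l2_eq0 n (v : 'I_n -> C) : l2 v = 0 -> forall i, v i = 0.
Proof.
by move=> v0 i; apply: nm_eq0; apply/le_anti; rewrite nm_ge0 -v0 nm_le_l2.
Qed.

Let l2Z n (c : C) (v : 'I_n -> C) : l2 (fun i => c * v i) = nm c * l2 v.
Proof.
rewrite !l2E -[X in X * _]ger0_norm // -sqrtr_sqr -sqrtrM ?sqr_ge0 //.
by congr Num.sqrt; rewrite mulr_sumr; apply: eq_bigr => i _; rewrite nmM exprMn.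
Qed.

Let l2CS n (u v : 'I_n -> C) : \sum_i nm (u i) * nm (v i) <= l2 u * l2 v.
Proof.
have [u0|u0] := eqVneq (l2 u) 0.
  by rewrite u0 mul0r big1 // => i _; rewrite (l2_eq0 u0) nm0 mul0r.
have [v0|v0] := eqVneq (l2 v) 0.
  by rewrite v0 mulr0 big1 // => i _; rewrite (l2_eq0 v0) nm0 mulr0.
have up : 0 < l2 u by rewrite lt_def u0 l2_ge0.
have vp : 0 < l2 v by rewrite lt_def v0 l2_ge0.
have h i : nm (u i) * nm (v i) <=
    (l2 v / l2 u) / 2 * nm (u i) ^+ 2 + (l2 u / l2 v) / 2 * nm (v i) ^+ 2.
  rewrite -subr_ge0.
  have -> : l2 v / l2 u / 2 * nm (u i) ^+ 2 + l2 u / l2 v / 2 * nm (v i) ^+ 2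
      - nm (u i) * nm (v i)
    = (l2 v * nm (u i) - l2 u * nm (v i)) ^+ 2 / (2 * (l2 u * l2 v)) by field; apply/andP.
  by rewrite divr_ge0 ?sqr_ge0 // !mulr_ge0.
apply: le_trans (ler_sum _ (fun i _ => h i)) _.
rewrite big_split /= -!mulr_sumr -!l2_sqr le_eqVlt; apply/orP; left.
by apply/eqP; field; apply/andP.
Qed.

Let l2D n (u v : 'I_n -> C) : l2 (fun i => u i + v i) <= l2 u + l2 v.
Proof.
apply: l2_le_sqr; first exact: addr_ge0.
apply: (@le_trans _ _ (\sum_i (nm (u i) + nm (v i)) ^+ 2)).
  by apply: ler_sum => i _; rewrite ler_pXn2r ?nnegrE ?addr_ge0.
under eq_bigr do rewrite sqrrD.
rewrite !big_split /= -!l2_sqr sqrrD lerD2r lerD2l.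
by rewrite mulr2n lerD ?l2CS.
Qed.

Section Mx.
Context (m n : nat).
Implicit Types A B : 'M[C]_(m, n).

Let app_bdd A : exists2 M, 0 <= M & forall v, l2 (mxapp A v) <= M * l2 v.
Proof.
pose r i := \sum_k nm (A i k).
have r0 i : 0 <= r i by apply: sumr_ge0.
exists (Num.sqrt (\sum_i r i ^+ 2)); first exact: sqrtr_ge0.
move=> v; apply: l2_le_sqr; first by rewrite mulr_ge0 ?sqrtr_ge0.
rewrite exprMn sqr_sqrtr ?sumr_ge0 // => [|i _]; last exact: sqr_ge0.
rewrite mulr_suml; apply: ler_sum => i _.
rewrite -exprMn ler_pXn2r ?nnegrE ?mulr_ge0 //.
apply: le_trans (nm_sum _ _) _; rewrite mulr_suml.
by apply: ler_sum => k _; rewrite nmM ler_wpM2l // nm_le_l2.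
Qed.

Let img A := [set l2norm (mxapp A v) | v in [set v : 'I_n -> C | l2norm v <= 1]].

Let l20 k : l2 (fun _ : 'I_k => 0) = 0.
Proof. by rewrite l2E big1 ?sqrtr0 // => i _; rewrite nm0 expr0n. Qed.

Let img_sup A : has_sup (img A).
Proof.
split; first by exists (l2 (mxapp A (fun=> 0))), (fun=> 0) => //=; rewrite -/(l2 _) l20.
have [M M0 hM] := app_bdd A; exists M => _ [v /= v1 <-].
by apply: le_trans (hM v) _; rewrite ler_piMr.
Qed.

Lemma mxopnorm_ge0 A : 0 <= mxopnorm A.
Proof.
have [[x Ax] ub] := img_sup A; apply: (le_trans _ (sup_upper_bound (img_sup A) Ax)).
by case: Ax => v _ <-; exact: l2_ge0.
Qed.

Lemma mxopnormP A (v : 'I_n -> C) : l2norm (mxapp A v) <= mxopnorm A * l2norm v.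
Proof.
have [v0|v0] := eqVneq (l2 v) 0.
  have [M M0 hM] := app_bdd A; have := hM v.
  by rewrite v0 mulr0 -/(l2 v) v0 mulr0.
have vp : 0 < l2 v by rewrite lt_def v0 l2_ge0.
pose c : C := ((l2 v)^-1)%:C.
have nc : nm c = (l2 v)^-1.
  by rewrite /nm /c ger0_norm ?ler0c ?invr_ge0 ?l2_ge0.
have /(sup_upper_bound (img_sup A)) : img A (l2 (mxapp A (fun i => c * v i))).
  by exists (fun i => c * v i) => //=; rewrite -/(l2 _) l2Z nc mulVf.
have -> : l2 (mxapp A (fun i => c * v i)) = (l2 v)^-1 * l2 (mxapp A v).
  rewrite -nc -l2Z; congr l2; apply: functional_extensionality_dep => i.
  by rewrite /mxapp mulr_sumr; apply: eq_bigr => k _; rewrite mulrCA.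
by rewrite mulrC ler_pdivrMr.
Qed.

Lemma mxopnorm_le A (c : R) :
  0 <= c -> (forall v, l2norm (mxapp A v) <= c * l2norm v) -> mxopnorm A <= c.
Proof.
move=> c0 h; apply: ge_sup; first by case: (img_sup A).
by move=> _ [v /= v1 <-]; apply: le_trans (h v) _; rewrite ler_piMr.
Qed.

Lemma mxopnormD A B : mxopnorm (A + B) <= mxopnorm A + mxopnorm B.
Proof.
apply: mxopnorm_le => [|v]; first by rewrite addr_ge0 ?mxopnorm_ge0.
have -> : mxapp (A + B) v = (fun i => mxapp A v i + mxapp B v i).
  apply: functional_extensionality_dep => i.
  by rewrite /mxapp -big_split; apply: eq_bigr => k _; rewrite mxE mulrDl.
by apply: le_trans (l2D _ _) _; rewrite mulrDl lerD ?mxopnormP.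
Qed.

Lemma mxopnormZ_le (c : C) A :
  mxopnorm (c *: A) <= complex.Re `|c| * mxopnorm A.
Proof.
apply: mxopnorm_le => [|v]; first by rewrite mulr_ge0 ?mxopnorm_ge0 ?nm_ge0.
have -> : mxapp (c *: A) v = (fun i => c * mxapp A v i).
  apply: functional_extensionality_dep => i.
  by rewrite /mxapp mulr_sumr; apply: eq_bigr => k _; rewrite mxE mulrA.
by rewrite -/(l2 _) l2Z -mulrA ler_wpM2l ?mxopnormP ?nm_ge0.
Qed.

Lemma mxopnormN A : mxopnorm (- A) = mxopnorm A.
Proof.
have h B : mxopnorm (- B) <= mxopnorm B.
  by have := mxopnormZ_le (-1) B; rewrite normrN normr1 mul1r scaleN1r.
by apply/le_anti; rewrite h -{1}[A]opprK h.
Qed.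

Lemma mxopnorm0 : mxopnorm (0 : 'M[C]_(m, n)) = 0.
Proof.
by apply/le_anti; rewrite mxopnorm_ge0 andbT -(scale0r 0); apply: le_trans (mxopnormZ_le _ _) _;
  rewrite normr0 mul0r.
Qed.

End Mx.

Lemma mxopnormM m n p (A : 'M[C]_(m, n)) (B : 'M[C]_(n, p)) :
  mxopnorm (A *m B) <= mxopnorm A * mxopnorm B.
Proof.
apply: mxopnorm_le => [|v]; first by rewrite mulr_ge0 ?mxopnorm_ge0.
have -> : mxapp (A *m B) v = mxapp A (mxapp B v).
  apply: functional_extensionality_dep => i; rewrite /mxapp.
  under eq_bigr do rewrite mxE mulr_suml.
  rewrite exchange_big; apply: eq_bigr => k _ /=.
  by rewrite mulr_sumr; apply: eq_bigr => l _; rewrite mulrA.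
apply: le_trans (mxopnormP _ _) _.
by rewrite -mulrA ler_wpM2l ?mxopnorm_ge0 ?mxopnormP.
Qed.

Lemma mxopnorm1_le n : mxopnorm (1%:M : 'M[C]_n) <= 1.
Proof.
apply: mxopnorm_le => // v; rewrite mul1r.
suff -> : mxapp 1%:M v = v by [].
apply: functional_extensionality_dep => i; rewrite /mxapp (bigD1 i) //= mxE eqxx mul1r.
by rewrite big1 ?addr0 // => k ki; rewrite mxE eq_sym (negPf ki) mul0r.
Qed.

End OpnormTheory.

Section Closure.
Context (R : realType) (d : nat) (D : set (mxuniv R d)).
Implicit Types f g p q : gfun D.

Let nc0 : is_ncfun (0 : gfun D).
Proof.
split=> [X Y hX hY hXY|X S hX hS uS]; last by rewrite mulmx0 mul0mx.
by rewrite -[RHS]/(block_mx 0 0 0 0) block_mx0.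
Qed.

Let nc1 : is_ncfun (1 : gfun D).
Proof.
split=> [X Y hX hY hXY|X S hX hS uS]; first exact: (@scalar_mx_block _ (lvl X) (lvl Y) 1).
by rewrite mulmx1 mulVmx.
Qed.

Let ncD f g : is_ncfun f -> is_ncfun g -> is_ncfun (f + g).
Proof.
move=> [fd fs] [gd gs]; split=> [X Y hX hY hXY|X S hX hS uS].
  have := add_block_mx (f X hX) 0 0 (f Y hY) (g X hX) 0 0 (g Y hY).
  by rewrite !addr0 => <-; rewrite -fd -gd.
by rewrite -[LHS]/(f _ hS + g _ hS) fs // gs // -mulmxDl -mulmxDr.
Qed.

Let ncM f g : is_ncfun f -> is_ncfun g -> is_ncfun (f * g).
Proof.
move=> [fd fs] [gd gs]; split=> [X Y hX hY hXY|X S hX hS uS].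
  have := mulmx_block (f X hX) 0 0 (f Y hY) (g X hX) 0 0 (g Y hY).
  by rewrite !mulmx0 !mul0mx !addr0 !add0r => <-; rewrite -fd -gd.
rewrite -[LHS]/(f _ hS *m g _ hS) fs // gs // -[(f * g) X hX]/(f X hX *m g X hX).
by rewrite !mulmxA mulmxK.
Qed.

Let ncZ (c : R[i]) f : is_ncfun f -> is_ncfun (c *: f).
Proof.
move=> [fd fs]; split=> [X Y hX hY hXY|X S hX hS uS].
  have := scale_block_mx c (f X hX) 0 0 (f Y hY).
  by rewrite !scaler0 => <-; rewrite -fd.
by rewrite -[LHS]/(c *: f _ hS) fs // scalemxAl scalemxAr.
Qed.

Let bddP f : is_bdd f -> exists2 M, 0 <= M & forall X hX, mxopnorm (f X hX) <= M.
Proof.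
move=> [M hM]; exists (Num.max 0 M) => [|X hX]; first by rewrite le_max lexx.
by apply: le_trans (hM _ _) _; rewrite le_max lexx orbT.
Qed.

Let bdd0 : is_bdd (0 : gfun D).
Proof. by exists 0 => X hX; rewrite [X in mxopnorm X](_ : _ = 0) ?mxopnorm0. Qed.

Let bdd1 : is_bdd (1 : gfun D).
Proof. by exists 1 => X hX; exact: mxopnorm1_le. Qed.

Let bddD f g : is_bdd f -> is_bdd g -> is_bdd (f + g).
Proof.
move=> [M hM] [N hN]; exists (M + N) => X hX.
by apply: le_trans (mxopnormD _ _) _; exact: lerD.
Qed.

Let bddM f g : is_bdd f -> is_bdd g -> is_bdd (f * g).
Proof.
move=> /bddP[M M0 hM] /bddP[N N0 hN]; exists (M * N) => X hX.
by apply: le_trans (mxopnormM _ _) _; rewrite ler_pM ?mxopnorm_ge0.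
Qed.

Let Re_norm_ge0 (c : R[i]) : 0 <= complex.Re `|c|.
Proof. by have := normr_ge0 c; rewrite lecE => /andP[]. Qed.

Let bddZ (c : R[i]) f : is_bdd f -> is_bdd (c *: f).
Proof.
move=> [M hM]; exists (complex.Re `|c| * M) => X hX.
by apply: le_trans (mxopnormZ_le _ _) _; rewrite ler_wpM2l.
Qed.

Let polyD p q : is_ncpoly p -> is_ncpoly q -> is_ncpoly (p + q).
Proof.
by move=> [s hs] [t ht]; exists (s ++ t) => X hX; rewrite big_cat /= -hs -ht.
Qed.

Let polyZ (c : R[i]) p : is_ncpoly p -> is_ncpoly (c *: p).
Proof.
move=> [s hs]; exists [seq (c * t.1, t.2) | t <- s] => X hX.
rewrite big_map -[LHS]/(c *: p X hX) hs scaler_sumr.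
by apply: eq_bigr => t _; rewrite scalerA.
Qed.

Let poly1 : is_ncpoly (1 : gfun D).
Proof.
by exists [:: (1, [::])] => X hX; rewrite big_seq1 scale1r /ncmon big_nil.
Qed.

Let polyM p q : is_ncpoly p -> is_ncpoly q -> is_ncpoly (p * q).
Proof.
move=> [s hs] [t ht].
exists [seq (x.1 * y.1, x.2 ++ y.2) | x <- s, y <- t] => X hX.
rewrite big_allpairs_dep -[LHS]/(p X hX *m q X hX) hs ht mulmx_suml.
apply: eq_bigr => x _; rewrite mulmx_sumr; apply: eq_bigr => y _ /=.
by rewrite -scalemxAl -scalemxAr scalerA /ncmon big_cat.
Qed.

Let poly_bdd f p : is_bdd f -> (exists e : R, forall X hX, mxopnorm (f X hX - p X hX) <= e) ->
  is_bdd p.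
Proof.
move=> [M hM] [e he]; exists (M + e) => X hX.
rewrite -[p X hX](subKr (f X hX)).
by apply: le_trans (mxopnormD _ _) _; rewrite mxopnormN lerD.
Qed.

Let ncalgE k f : in_ncalg k f <->
  [/\ is_ncfun f, is_bdd f &
     match k with
     | NormClosed => forall e : R, 0 < e -> exists p : gfun D,
         is_ncpoly p /\ forall X hX, mxopnorm (f X hX - p X hX) <= e
     | Bounded => True
     end].
Proof.
by case: k; split=> [[]|[nf bf af]] //; case.
Qed.

Let algD k f g : in_ncalg k f -> in_ncalg k g -> in_ncalg k (f + g).
Proof.
move=> /ncalgE[nf bf af] /ncalgE[ng bg ag]; apply/ncalgE; split; [exact: ncD|exact: bddD|].
case: k af ag => // af ag e e0.
have e2 : 0 < e / 2 by rewrite divr_gt0.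
have [p [pp hp]] := af _ e2; have [q [pq hq]] := ag _ e2.
exists (p + q); split=> [|X hX]; first exact: polyD.
rewrite [X in mxopnorm X](_ : _ = (f X hX - p X hX) + (g X hX - q X hX)).
  by apply: le_trans (mxopnormD _ _) _; rewrite [leRHS]splitr lerD.
by rewrite opprD addrACA.
Qed.

Let algZ k (c : R[i]) f : in_ncalg k f -> in_ncalg k (c *: f).
Proof.
move=> /ncalgE[nf bf af]; apply/ncalgE; split; [exact: ncZ|exact: bddZ|].
case: k af => // af e e0.
have c0 := Re_norm_ge0 c; set a := complex.Re `|c| in c0.
have a1 : 0 < a + 1 by rewrite ltr_wpDl.
have [p [pp hp]] := af _ (divr_gt0 e0 a1).
exists (c *: p); split=> [|X hX]; first exact: polyZ.
rewrite [X in mxopnorm X](_ : _ = c *: (f X hX - p X hX)); last first.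
  by rewrite scalerBr.
apply: le_trans (mxopnormZ_le _ _) _; rewrite -/a.
apply: (@le_trans _ _ (a * (e / (a + 1)))); first by rewrite ler_wpM2l.
by rewrite mulrCA ler_piMr ?(ltW e0) // ler_pdivrMr // mul1r lerDl.
Qed.

Let algM k f g : in_ncalg k f -> in_ncalg k g -> in_ncalg k (f * g).
Proof.
move=> /ncalgE[nf bf af] /ncalgE[ng bg ag]; apply/ncalgE; split; [exact: ncM|exact: bddM|].
case: k af ag => // af ag e e0.
have [M M0 hM] := bddP bf.
have M1 : 0 < M + 1 by rewrite ltr_wpDl.
have e2 : 0 < e / 2 by rewrite divr_gt0.
have [q [pq hq]] := ag _ (divr_gt0 e2 M1).
have /bddP[N N0 hN] : is_bdd q.
  by apply: poly_bdd bg _; exists (e / 2 / (M + 1)).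
have N1 : 0 < N + 1 by rewrite ltr_wpDl.
have [p [pp hp]] := af _ (divr_gt0 e2 N1).
exists (p * q); split=> [|X hX]; first exact: polyM.
rewrite [X in mxopnorm X](_ : _ =
   f X hX *m (g X hX - q X hX) + (f X hX - p X hX) *m q X hX); last first.
  by rewrite mulmxBr mulmxBl addrA subrK.
have bnd (x y a : R) : 0 <= x -> 0 <= y -> x <= a ->
    y <= e / 2 / (a + 1) -> x * y <= e / 2.
  move=> x0 y0 xa ya; have a0 : 0 <= a by exact: le_trans xa.
  have a1 : 0 < a + 1 by rewrite ltr_wpDl.
  apply: (@le_trans _ _ (a * (e / 2 / (a + 1)))); first exact: ler_pM.
  by rewrite mulrCA ler_piMr ?(ltW e2) // ler_pdivrMr // mul1r lerDl.
apply: le_trans (mxopnormD _ _) _; rewrite [leRHS]splitr lerD //.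
  apply: le_trans (mxopnormM _ _) _.
  by apply: (bnd _ _ M); rewrite ?mxopnorm_ge0.
apply: le_trans (mxopnormM _ _) _; rewrite mulrC.
by apply: (bnd _ _ N); rewrite ?mxopnorm_ge0.
Qed.

Let alg1 k : in_ncalg k (1 : gfun D).
Proof.
apply/ncalgE; split; [exact: nc1|exact: bdd1|]; case: k => // e e0.
by exists 1; split=> [|X hX]; [exact: poly1|rewrite subrr mxopnorm0 ltW].
Qed.

Definition ncalg_pred (k : algkind) : {pred gfun D} :=
  fun f => `[< in_ncalg k f >].

Let algN k f : in_ncalg k f -> in_ncalg k (- f).
Proof. by rewrite -scaleN1r; exact: algZ. Qed.

Lemma ncalg_subring k : subring_closed (ncalg_pred k).
Proof.
split; first exact/asboolP/alg1.
  by move=> f g /asboolP hf /asboolP hg; apply/asboolP/algD/algN.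
by move=> f g /asboolP hf /asboolP hg; apply/asboolP/algM.
Qed.

Lemma ncalg_scaler k : scaler_closed (ncalg_pred k).
Proof. by move=> c f /asboolP hf; apply/asboolP/algZ. Qed.

HB.instance Definition _ k :=
  GRing.isSubringClosed.Build (gfun D) (ncalg_pred k) (ncalg_subring k).
HB.instance Definition _ k :=
  GRing.isScaleClosed.Build R[i] (gfun D) (ncalg_pred k) (@ncalg_scaler k).

Record ncalg (k : algkind) : Type :=
  NCAlg { ncval :> gfun D; _ : ncval \in ncalg_pred k }.

Section Instances.
Variable k : algkind.
HB.instance Definition _ := [isSub for @ncval k].
HB.instance Definition _ := [Choice of ncalg k by <:].
HB.instance Definition _ :=
  GRing.SubChoice_isSubPzRing.Build _ _ (ncalg k) (GRing.subringClosedP _).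
HB.instance Definition _ := [SubZmodule_isSubLmodule of ncalg k by <:].
End Instances.

End Closure.

Arguments ncval {R d D k} _ _ _.

(** ** Norms *)

(* [sup] and [inf] are applied to sets bounded on the relevant side; the
   supremum over an empty domain is [0]. *)
Definition ncnorm (R : realType) d (D : set (mxuniv R d)) k (f : ncalg D k) :
    R :=
  sup [set r | exists X (hX : D X), r = mxopnorm (ncval f X hX)].

Definition ncmxnorm (R : realType) d (D : set (mxuniv R d)) k N
    (F : 'M[ncalg D k]_N) : R :=
  sup [set r | exists X (hX : D X),
    r = mxopnorm (\mxblock_(i < N, j < N) ncval (F i j) X hX)].

(** ** Two-sided ideals and quotients *)

HB.mixin Record isTwoSided (A : pzRingType) (J : A -> bool) := {
  idealMl : forall a, {in J, forall u, a * u \in J};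
  idealMr : forall a, {in J, forall u, u * a \in J}
}.

#[short(type="ideal")]
HB.structure Definition Ideal (A : pzRingType) :=
  {J of GRing.ZmodClosed A J & isTwoSided A J}.

Section Quotient.
Local Open Scope quotient_scope.

(* The library quotients rings only when they are commutative and nonzero. *)
Definition quotalg (A : pzRingType) (J : ideal A) : Type := Quotient.quot J.

Section Ring.
Context (A : pzRingType) (J : ideal A).
Local Notation Q := (quotalg J).

HB.instance Definition _ := GRing.Zmodule.copy Q (Quotient.quot J).
HB.instance Definition _ := EqQuotient.copy Q (Quotient.quot J).

Lemma quotalgP (x y : A) : reflect (\pi_Q x = \pi_Q y) (x - y \in J).
Proof. by rewrite (@Quotient.idealrBE A J); exact: eqP. Qed.

Definition qone : Q := \pi_Q 1.
Definition qmul := lift_op2 Q *%R.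

Lemma pi_qmul (x y : A) : \pi_Q (x * y) = qmul (\pi_Q x) (\pi_Q y).
Proof.
unlock qmul; apply/quotalgP; rewrite -(subrK (x * repr (\pi_Q y)) (x * y)) -mulrBr -addrA.
rewrite -mulrBl rpredD //.
  by apply: idealMl; apply/quotalgP; rewrite reprK.
by apply: idealMr; apply/quotalgP; rewrite reprK.
Qed.

Lemma pi_qadd (x y : A) : \pi_Q (x + y) = \pi_Q x + \pi_Q y.
Proof. exact: (@Quotient.pi_add A J). Qed.

Let qmulA : associative qmul.
Proof.
by move=> x y z; rewrite -[x]reprK -[y]reprK -[z]reprK -!pi_qmul mulrA.
Qed.
Let qmul1l : left_id qone qmul.
Proof. by move=> x; rewrite -[x]reprK -pi_qmul mul1r. Qed.
Let qmul1r : right_id qone qmul.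
Proof. by move=> x; rewrite -[x]reprK -pi_qmul mulr1. Qed.
Let qmulDl : left_distributive qmul +%R.
Proof.
move=> x y z; rewrite -[x]reprK -[y]reprK -[z]reprK.
by rewrite -pi_qadd -!pi_qmul -pi_qadd mulrDl.
Qed.
Let qmulDr : right_distributive qmul +%R.
Proof.
move=> x y z; rewrite -[x]reprK -[y]reprK -[z]reprK.
by rewrite -pi_qadd -!pi_qmul -pi_qadd mulrDr.
Qed.

HB.instance Definition _ := GRing.Zmodule_isPzRing.Build Q
  qmulA qmul1l qmul1r qmulDl qmulDr.
End Ring.

Section Scale.
Context (R : realType) (d : nat) (D : set (mxuniv R d)) (k : algkind).
Context (J : ideal (ncalg D k)).
Local Notation Q := (quotalg J).
Implicit Types (a b : R[i]) (x y : Q).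

Definition qscale a := lift_op1 Q ( *:%R a).

Lemma ideal_scale a (u : ncalg D k) : u \in J -> a *: u \in J.
Proof.
suff -> : a *: u = (a *: (1 : ncalg D k) : ncalg D k) * u by exact: idealMl.
by apply/val_inj/gfunP => X hX; rewrite /= -[RHS]scalemxAl mul1mx.
Qed.

Lemma pi_qscale a (u : ncalg D k) : \pi_Q (a *: u) = qscale a (\pi_Q u).
Proof.
unlock qscale; apply/quotalgP; rewrite -scalerBr.
by apply/ideal_scale/quotalgP; rewrite reprK.
Qed.

Let qscaleA a b x : qscale a (qscale b x) = qscale (a * b) x.
Proof. by rewrite -[x]reprK -!pi_qscale scalerA. Qed.
Let qscale1 : left_id 1 qscale.
Proof. by move=> x; rewrite -[x]reprK -pi_qscale scale1r. Qed.
Let qscaleDr : right_distributive qscale +%R.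
Proof.
move=> a x y; rewrite -[x]reprK -[y]reprK.
by rewrite -pi_qadd -!pi_qscale -pi_qadd scalerDr.
Qed.
Let qscaleDl x : {morph qscale^~ x : a b / a + b}.
Proof.
by move=> a b; rewrite -[x]reprK -!pi_qscale -pi_qadd scalerDl.
Qed.

HB.instance Definition _ := GRing.Zmodule_isLmodule.Build R[i] Q
  qscaleA qscale1 qscaleDr qscaleDl.

(* The preimages of [q] form a coset of M_N(J) in M_N(A). *)
Definition quotmxnorm N (q : 'M[Q]_N) : R :=
  inf [set ncmxnorm F | F in [set F : 'M[ncalg D k]_N | map_mx \pi_Q F = q]].

Definition completely_isometric (E : set (mxuniv R d)) l
    (phi : Q -> ncalg E l) : Prop :=
  forall N (q : 'M[Q]_N), ncmxnorm (map_mx phi q) = quotmxnorm q.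
End Scale.
End Quotient.

(** ** The vanishing locus *)

Definition vanset (R : realType) d (D : set (mxuniv R d)) k
    (J : ideal (ncalg D k)) : set (mxuniv R d) :=
  [set X | D X /\ forall F : ncalg D k, F \in J -> forall hX, ncval F X hX = 0].

Lemma vanset_sub (R : realType) d (D : set (mxuniv R d)) k
  (J : ideal (ncalg D k)) : vanset J `<=` D.
Proof. by move=> X []. Qed.

(** ** Homogeneous ideals *)

Definition hompart (R : realType) d (c : seq 'I_d -> R[i]) (n : nat)
    (X : mxuniv R d) : 'M[R[i]]_(lvl X) :=
  \sum_(w : n.-tuple 'I_d) c w *: ncmon X w.

Definition power_series (R : realType) d (D : set (mxuniv R d))
    (c : seq 'I_d -> R[i]) (f : gfun D) : Prop :=
  forall X hX,
    (fun m => mxopnorm (f X hX - \sum_(n < m) hompart c n X)) @ \oo --> (0 : R).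

Definition homogeneous (R : realType) d (D : set (mxuniv R d)) k
    (J : ideal (ncalg D k)) : Prop :=
  forall F, F \in J -> exists2 c, power_series c F &
    forall n, exists2 G : ncalg D k, G \in J & forall X hX, ncval G X hX = hompart c n X.

(** ** Topologies, given by their open sets *)

Definition is_topology T (op : set (set T)) : Prop :=
  [/\ op setT,
      forall U V, op U -> op V -> op (U `&` V) &
      forall (I : Type) (f : I -> set T),
        (forall i, op (f i)) -> op (\bigcup_i f i)].

Definition norm_open (R : realType) d (D : set (mxuniv R d)) k :
    set (set (ncalg D k)) :=
  [set U | forall F, U F ->
    exists2 e : R, 0 < e & forall G, ncnorm (G - F) < e -> U G].

Definition directed I (le : I -> I -> Prop) : Prop :=
  [/\ exists i : I, True, forall i, le i i,
      forall i j l, le i j -> le j l -> le i l &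
      forall i j, exists2 l, le i l & le j l].

Definition net_cvg T (op : set (set T)) I (le : I -> I -> Prop) (x : I -> T)
    (a : T) : Prop :=
  forall U, op U -> U a -> exists i, forall j, le i j -> U (x j).

Definition net_cvg_pointwise (R : realType) d (D : set (mxuniv R d)) k
    I (le : I -> I -> Prop) (F : I -> ncalg D k) (G : ncalg D k) : Prop :=
  forall X hX (e : R), 0 < e ->
    exists i, forall j, le i j -> mxopnorm (ncval (F j) X hX - ncval G X hX) < e.

(* The property of convergence of bounded nets that characterizes the
   bounded-pointwise topology.  It does not single out one topology, and the
   literally coarsest topology with this property is degenerate: its closed sets
   are the whole space and the pointwise closed sets that are bounded in norm,
   so that its only closed proper ideal is zero.  For this reason minimality is
   not required, and the statements quantify over all the topologies that have
   the property; the finest one is [bdd_pointwise_open], whose closed sets are the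
   sets closed under bounded pointwise convergence of nets. *)
Definition bdd_pointwise (R : realType) d (D : set (mxuniv R d)) k
    (op : set (set (ncalg D k))) : Prop :=
  is_topology op /\
  forall I (le : I -> I -> Prop) (F : I -> ncalg D k) (G : ncalg D k),
    directed le -> (exists M : R, forall i, ncnorm (F i) <= M) ->
    net_cvg op le F G <-> net_cvg_pointwise le F G.

Definition bdd_pointwise_open (R : realType) d (D : set (mxuniv R d)) k :
    set (set (ncalg D k)) :=
  [set U | forall I (le : I -> I -> Prop) (F : I -> ncalg D k) (G : ncalg D k),
    directed le -> (exists M : R, forall i, ncnorm (F i) <= M) ->
    net_cvg_pointwise le F G -> U G -> exists i, forall j, le i j -> U (F j)].

Lemma bdd_pointwise_openP (R : realType) d (D : set (mxuniv R d)) k :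
  bdd_pointwise (@bdd_pointwise_open R d D k).
Proof.
split.
  split=> [I le F G [[i _] _ _ _] _ _ _|U V oU oV I le F G dir bF FG [UG VG]|
      A U oU I le F G dir bF FG [a _ UaG]]; first by exists i.
    have [i hi] := oU _ _ _ _ dir bF FG UG.
    have [j hj] := oV _ _ _ _ dir bF FG VG.
    case: dir => _ _ tr /(_ i j)[l il jl]; exists l => n ln.
    by split; [apply: hi; apply: tr ln|apply: hj; apply: tr ln].
  have [i hi] := oU a _ _ _ _ dir bF FG UaG.
  by exists i => j ij; exists a => //; exact: hi.
move=> I le F G dir bF; split=> [FG X hX e e0|FG U oU UG]; last first.
  exact: oU dir bF FG UG.
pose U : set (ncalg D k) :=
  [set f | mxopnorm (ncval f X hX - ncval G X hX) < e].
apply: (FG U); last by rewrite /U /= subrr mxopnorm0.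
move=> I' le' F' G' dir' bF' /(_ X hX) cvg' UG'.
have /cvg'[i hi] : 0 < e - mxopnorm (ncval G' X hX - ncval G X hX).
  by rewrite subr_gt0.
exists i => j /hi; rewrite ltrBrDr; apply: le_lt_trans.
rewrite -(subrKA (ncval G' X hX)).
exact: mxopnormD.
Qed.

Lemma bdd_pointwise_finest (R : realType) d (D : set (mxuniv R d)) k
    (op : set (set (ncalg D k))) :
  bdd_pointwise op -> op `<=` @bdd_pointwise_open R d D k.
Proof.
move=> [_ opP] U oU I le F G dir bF /(opP _ _ _ _ dir bF) FG UG.
exact: FG.
Qed.

Definition alg_topology (R : realType) d (D : set (mxuniv R d)) k
    (op : set (set (ncalg D k))) : Prop :=
  match k with
  | NormClosed => op = @norm_open R d D k
  | Bounded => bdd_pointwise op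
  end.

Definition topo_closed (R : realType) d (D : set (mxuniv R d)) k
    (op : set (set (ncalg D k))) (J : ideal (ncalg D k)) : Prop :=
  op (~` [set F : ncalg D k | F \in J]).

(* Main.v *)
(* Let V be the zero set of the homogeneous ideal J, and T the nilpotent shift
   of C^(m+1).  The compression of F(T (x) X) to (1, ..., 1) / sqrt(m+1) is the
   m-th Fejer mean of F at X; it does not exceed F in norm, converges to F at
   every point, uniformly so for polynomials, and only involves F at nilpotent
   points, on which F is a polynomial.  V is stable under X |-> T (x) X because J
   is homogeneous.

   Nilpotent points of V are controlled by one point Y, the coordinates acting
   on the k-tuples of polynomials modulo J and modulo degrees above m: it has
   generating vectors e_i, and every nilpotent point killed by J is intertwined
   with it.  Hence a k x k matrix f over V with norm at most M becomes a
   tangential Pick problem q(Y) e = f(Y) e for polynomials q.  The bound on f at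
   all the points of the ball similar to Y yields, by separation from a convex
   cone, a positivity certificate, and from it the lurking contraction argument
   builds a realization of a solution q bounded by M + eps at the nilpotent points
   of the ball.  The Fejer means of q are then bounded on the whole ball and
   coincide on V with those of f.  Taking a limit along an ultrafilter, or
   correcting the error of the Fejer means of a polynomial and summing a
   telescoping series, one extends f to the ball; thus restriction to V is onto
   and induces the quotient norms.

   For F vanishing on V, the same model shows that the Fejer means of F are
   polynomials in J, whence F belongs to the closed ideal J. *)

Require Import Defs.
From HB Require Import structures.
From mathcomp Require Import all_boot all_order all_algebra complex.
From mathcomp Require Import sesquilinear generic_quotient ring_quotient.
From mathcomp Require Import boolp classical_sets functions reals topology.
From mathcomp Require Import normedtype.
From mathcomp Require Import spectral mxtens filter.
From mathcomp Require Import ring lra.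

Set Implicit Arguments.
Unset Strict Implicit.
Unset Printing Implicit Defensive.

Import Order.TTheory GRing.Theory Num.Theory numFieldNormedType.Exports.

Local Open Scope classical_set_scope.
Local Open Scope complex_scope.
Local Open Scope quotient_scope.
Local Open Scope ring_scope.

Local Notation coord := Defs.coord.

(** * Sums of squared norms and inner products *)

(** A bounded nc function on V comes with no power series, so the convergence of its Fejer means at
    X cannot be read off coefficients. Instead the shift T is coupled to one more coordinate, with a
    weight c so small that the point obtained from X stays in the ball for every m: T sits in the
    larger matrix as an invariant block, while the vector (c, ..., c, 1) is fixed by it.
    Intertwining along both subspaces compares f(X) with its mean at the rate 1/sqrt(m+1).

    All interpolation takes place at nilpotent points for three reasons: the model modulo J is
    finite dimensional; a nilpotent tuple is always similar to a point of the ball, by a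
    geometrically weighted sum of Gram forms of its words; and the state equation of a realization
    is solved there by finitely many iterations, so that the solution is a polynomial.

    H and K may be infinite dimensional, and the cone is not shown to be closed. The estimates
    therefore keep a slack eps, which disappears in a limit or in the infimum defining the quotient
    norm. *)

Section SquaredNorm.
Context (R : realType).
Local Notation C := R[i].

(* Locked, so that [rmorphM] does not see a product in it. *)
Definition nsq (E : normedZmodType C) (v : E) : R :=
  locked (complex.Re `|v| ^+ 2).

Lemma nsqE (E : normedZmodType C) (v : E) : (nsq v)%:C = `|v| ^+ 2.
Proof.
rewrite /nsq -lock rmorphXn /=; congr (_ ^+ 2).
by have /ger0_real/complex_realP[x ->] := normr_ge0 v.
Qed.

Lemma nsq_ge0 (E : normedZmodType C) (v : E) : 0 <= nsq v.
Proof. rewrite /nsq -lock; exact: sqr_ge0. Qed.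

Lemma nsq0 (E : normedZmodType C) : nsq (0 : E) = 0.
Proof. by rewrite /nsq -lock normr0 expr0n. Qed.

Lemma nsq_eq0 (E : normedZmodType C) (v : E) : nsq v = 0 -> v = 0.
Proof.
move=> v0; apply/eqP; rewrite -normr_eq0.
by have /esym/eqP := nsqE v; rewrite v0 sqrf_eq0.
Qed.

Lemma nsqZ (E : normedModType C) (a : C) (v : E) : nsq (a *: v) = nsq a * nsq v.
Proof. by apply: complexI; rewrite rmorphM /= !nsqE normrZ exprMn. Qed.

Lemma nsqM (a b : C) : nsq (a * b) = nsq a * nsq b.
Proof. by apply: complexI; rewrite rmorphM /= !nsqE normrM exprMn. Qed.

Lemma nsqC (z : C) : (nsq z)%:C = z * Num.conj z.
Proof. by rewrite nsqE normCK. Qed.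

Lemma nsqR (x : R) : nsq x%:C = x ^+ 2.
Proof.
apply: complexI; rewrite nsqC rmorphXn /= expr2; congr (_ * _).
by apply/CrealP/complex_realP; exists x.
Qed.

Definition sqn (E : normedZmodType C) n (v : 'I_n -> E) : R := \sum_i nsq (v i).

Lemma sqn_ge0 (E : normedZmodType C) n (v : 'I_n -> E) : 0 <= sqn v.
Proof. by apply: sumr_ge0 => i _; exact: nsq_ge0. Qed.

Lemma sqnE (E : normedZmodType C) n (v : 'I_n -> E) : l2norm v ^+ 2 = sqn v.
Proof.
rewrite /sqn /nsq; under eq_bigr do rewrite -lock.
by rewrite sqr_sqrtr // sumr_ge0 // => i _; exact: sqr_ge0. Qed.

Lemma l2norm_ge0 (E : normedZmodType C) n (v : 'I_n -> E) : 0 <= l2norm v.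
Proof. exact: sqrtr_ge0. Qed.

Lemma l2norm_leP (E F : normedZmodType C) m n (v : 'I_m -> E) (w : 'I_n -> F) c :
  0 <= c -> (l2norm v <= c * l2norm w) = (sqn v <= c ^+ 2 * sqn w).
Proof.
move=> c0; rewrite -!sqnE -exprMn ler_pXn2r // nnegrE ?mulr_ge0 ?l2norm_ge0 //.
Qed.

Definition csq n (v : 'cV[C]_n) : R := \sum_i nsq (v i 0).

Lemma csq_ge0 n (v : 'cV[C]_n) : 0 <= csq v.
Proof. by apply: sumr_ge0 => i _; exact: nsq_ge0. Qed.

Lemma csq_eq0 n (v : 'cV[C]_n) : csq v = 0 -> v = 0.
Proof.
move=> /eqP; rewrite psumr_eq0 => [/allP h|i _]; last exact: nsq_ge0.
apply/colP => i; rewrite mxE; apply: nsq_eq0; apply/eqP.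
by apply: h; rewrite mem_index_enum.
Qed.

Lemma csqZ n a (v : 'cV[C]_n) : csq (a *: v) = nsq a * csq v.
Proof. by rewrite /csq mulr_sumr; apply: eq_bigr => i _; rewrite mxE nsqM. Qed.

Lemma mxopnorm_leP m n (A : 'M[C]_(m, n)) (c : R) : 0 <= c ->
  (mxopnorm A <= c <-> forall v : 'cV_n, csq (A *m v) <= c ^+ 2 * csq v).
Proof.
move=> c0; split=> [Ac v|h].
  have := mxopnormP A (fun i => v i 0); rewrite l2norm_leP ?mxopnorm_ge0 // => h.
  have -> : csq (A *m v) = sqn (mxapp A (fun i => v i 0)).
    by apply: eq_bigr => i _; rewrite mxE.
  apply: (le_trans h); rewrite ler_wpM2r ?sqn_ge0 //.
  by rewrite ler_pXn2r ?nnegrE ?mxopnorm_ge0.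
apply: mxopnorm_le => // v; rewrite l2norm_leP //.
have -> : sqn v = csq (\col_i v i) by apply: eq_bigr => i _; rewrite mxE.
apply: le_trans (h _); rewrite le_eqVlt; apply/orP; left; apply/eqP.
by apply: eq_bigr => i _; rewrite mxE; under [in RHS]eq_bigr do rewrite mxE.
Qed.

Lemma csq_mulmx m n (A : 'M[C]_(m, n)) v : csq (A *m v) <= mxopnorm A ^+ 2 * csq v.
Proof. exact: (mxopnorm_leP A (mxopnorm_ge0 A)).1. Qed.

End SquaredNorm.

Section InnerProduct.
Context (R : realType).
Local Notation C := R[i].

Definition inner (E : lmodType C) (ip : E -> E -> C) : Prop :=
  [/\ forall a u v w, ip (a *: u + v) w = a * ip u w + ip v w,
      forall u v, ip v u = Num.conj (ip u v) &
      forall u, 0 <= ip u u].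

Section Theory.
Context (E : lmodType C) (ip : E -> E -> C) (ipP : inner ip).

Lemma ipDl u v w : ip (u + v) w = ip u w + ip v w.
Proof. by case: ipP => h _ _; rewrite -[u in LHS]scale1r h mul1r. Qed.

Lemma ip0l u : ip 0 u = 0.
Proof. by apply: (addrI (ip 0 u)); rewrite -ipDl !addr0. Qed.

Lemma ipZl a u v : ip (a *: u) v = a * ip u v.
Proof. by case: ipP => h _ _; rewrite -[a *: u]addr0 h ip0l addr0. Qed.

Lemma ipC u v : ip v u = Num.conj (ip u v).
Proof. by case: ipP. Qed.

Lemma ip_ge0 u : 0 <= ip u u.
Proof. by case: ipP. Qed.

Lemma ipDr u v w : ip w (u + v) = ip w u + ip w v.
Proof. by rewrite ipC ipDl rmorphD /= -!ipC. Qed.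

Lemma ip0r u : ip u 0 = 0.
Proof. by rewrite ipC ip0l rmorph0. Qed.

Lemma ipZr a u v : ip v (a *: u) = Num.conj a * ip v u.
Proof. by rewrite ipC ipZl rmorphM /= -ipC. Qed.

Lemma ip_suml I (r : seq I) (P : pred I) (F : I -> E) w :
  ip (\sum_(i <- r | P i) F i) w = \sum_(i <- r | P i) ip (F i) w.
Proof. by apply: (big_morph (ip^~ w)) => [u v|]; rewrite ?ipDl ?ip0l. Qed.

Lemma ip_sumr I (r : seq I) (P : pred I) (F : I -> E) w :
  ip w (\sum_(i <- r | P i) F i) = \sum_(i <- r | P i) ip w (F i).
Proof. by apply: (big_morph (ip w)) => [u v|]; rewrite ?ipDr ?ip0r. Qed.

Definition ipq u : R := complex.Re (ip u u).

Lemma ipqE u : (ipq u)%:C = ip u u.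
Proof. by rewrite /ipq RRe_real // ger0_real // ip_ge0. Qed.

Lemma ipq_ge0 u : 0 <= ipq u.
Proof. by rewrite -ler0c ipqE ip_ge0. Qed.

Lemma ipq_comb n (c : 'I_n -> C) (u : 'I_n -> E) :
  (ipq (\sum_a c a *: u a))%:C =
  \sum_a \sum_b c a * Num.conj (c b) * ip (u a) (u b).
Proof.
rewrite ipqE ip_suml; apply: eq_bigr => a _; rewrite ip_sumr.
by apply: eq_bigr => b _; rewrite ipZl ipZr mulrA.
Qed.

(** The [g a x] are the coefficients of the orthogonal projection of x onto the span of the [u a],
    found from the normal equations; the lower bound makes the Gram matrix invertible. A contraction
    on the span thereby extends to all of E without any completeness. *)
Lemma dual_basis n (u : 'I_n -> E) (e : R) : 0 < e ->
  (forall c : 'I_n -> C, e * sqn c <= ipq (\sum_a c a *: u a)) ->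
  exists g : 'I_n -> E -> C,
    [/\ forall i a x y, g i (a *: x + y) = a * g i x + g i y,
        forall a b, g a (u b) = (a == b)%:R &
        forall x, ipq (\sum_a g a x *: u a) <= ipq x].
Proof.
move=> e0 hu; pose M := \matrix_(a, b) ip (u a) (u b).
have uM : M \in unitmx.
  rewrite -row_free_unit; apply: inj_row_free => v vM.
  have : ipq (\sum_a v 0 a *: u a) = 0.
    apply: complexI; rewrite ipq_comb exchange_big /= big1 // => b _.
    rewrite (eq_bigr (fun a => Num.conj (v 0 b) * (v 0 a * M a b))) => [|a _].
      by rewrite -mulr_sumr; move/rowP: vM => /(_ b); rewrite !mxE => ->; rewrite mulr0.
    by rewrite mxE mulrA [_ * v 0 a]mulrC.
  have := hu (v 0) => /[swap] -> h.
  have s0 : sqn (v 0) = 0.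
    by apply/le_anti; rewrite sqn_ge0 andbT -(ler_pM2l e0) mulr0.
  apply/rowP => a; rewrite mxE; apply: nsq_eq0; apply/eqP; move/eqP: s0.
  rewrite psumr_eq0 => [/allP|? _]; last exact: nsq_ge0.
  by apply; rewrite mem_index_enum.
pose r x : 'rV_n := \row_b ip x (u b).
pose g a x := (r x *m invmx M) 0 a.
have rl a x y : r (a *: x + y) = a *: r x + r y.
  by apply/rowP => b; rewrite !mxE ipDl ipZl.
have gM x b : \sum_a g a x * M a b = ip x (u b).
  have /rowP/(_ b) : r x *m invmx M *m M = r x by rewrite mulmxKV.
  by rewrite mxE [in RHS]mxE.
exists g; split=> [i a x y|a b|x].
- by rewrite /g rl mulmxDl -scalemxAl 2!mxE.
- have -> : g a (u b) = (row b M *m invmx M) 0 a.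
    by congr ((_ *m _) 0 a); apply/rowP => j; rewrite !mxE.
  by rewrite -row_mul mulmxV // !mxE eq_sym.
set p := \sum_a _; have pu b : ip p (u b) = ip x (u b).
  by rewrite ip_suml -gM; apply: eq_bigr => a _; rewrite ipZl mxE.
have pp y : (forall b, ip y (u b) = 0) -> ip y p = 0.
  by move=> h; rewrite ip_sumr big1 // => a _; rewrite ipZr h mulr0.
have xp : ip (x - p) p = 0.
  by apply: pp => b; rewrite -scaleN1r ipDl ipZl pu mulN1r subrr.
have -> : ipq x = ipq (x - p) + ipq p.
  move: (x - p) (subrK p x) xp => y <- yp.
  apply: complexI; rewrite rmorphD /= !ipqE ipDl !ipDr yp.
  by rewrite (ipC y p) yp rmorph0 addr0 add0r.
by rewrite lerDr ipq_ge0.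
Qed.

(** The form is only semidefinite, so a null vector v has to be shown orthogonal to everything. *)
Lemma cauchy_schwarz u v : nsq (ip u v) <= ipq u * ipq v.
Proof.
have [v0|v0] := eqVneq (ip v v) 0; last first.
  pose a := ip u v / ip v v.
  have h := ip_ge0 (u - a *: v).
  have vr : Num.conj (ip v v) = ip v v by rewrite -ipC.
  have e : ip (u - a *: v) (u - a *: v) = ip u u - (nsq (ip u v))%:C / ip v v.
    rewrite -scaleNr ipDl !ipDr !ipZl !ipZr rmorphN /= /a rmorphM /= fmorphV /= vr.
    by rewrite (ipC u v) nsqC; field.
  have vp : 0 < ip v v by rewrite lt_def v0 ip_ge0.
  by move: h; rewrite e subr_ge0 ler_pdivrMr // -lecR rmorphM /= !ipqE.
suff -> : ip u v = 0 by rewrite nsq0 mulr_ge0 ?ipq_ge0.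
apply: nsq_eq0; set z := ip u v; apply/eqP; rewrite eq_le nsq_ge0 andbT leNgt.
apply/negP => z0.
(* This t turns the quadratic expression below into [- ipq u - 2], which is negative. *)
pose t : R := (ipq u + 1) / nsq z.
have := ip_ge0 (u - (t%:C * z) *: v).
have tr : Num.conj t%:C = t%:C by apply/CrealP/complex_realP; exists t.
rewrite -scaleNr ipDl !ipDr !ipZl !ipZr v0 !mulr0 addr0 rmorphN /= rmorphM /= tr.
rewrite (ipC u v) -/z -ipqE.
have -> : (ipq u)%:C + - (t%:C * Num.conj z) * z + - (t%:C * z) * Num.conj z =
    (ipq u - 2 * t * nsq z)%:C.
  by rewrite rmorphB /= !rmorphM /= nsqC [2%:C]rmorphMn /=; ring.
rewrite ler0c /t -!mulrA mulVf ?gt_eqF // mulr1.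
have := ipq_ge0 u; lra.
Qed.

End Theory.

Lemma hilbert_ip (H : completeNormedModType C) : is_hilbert H ->
  exists ip : H -> H -> C, inner ip /\ forall u, ipq ip u = nsq u.
Proof.
move=> [ip hip]; exists (fun u v => ip u v); split.
  split=> [a u v w|u v|u].
  - by rewrite linearPl.
  - by have := @hermC _ _ _ _ ip v u; rewrite expr0 mul1r.
  - exact: dnorm_ge0.
by move=> u; apply: complexI; rewrite nsqE hip /ipq RRe_real // ger0_real // dnorm_ge0.
Qed.

End InnerProduct.

(** * Points of the operator ball *)

Section OperatorBall.
Context (R : realType).
Local Notation C := R[i].

Definition nm (E : normedZmodType C) (v : E) : R := locked (complex.Re `|v|).

Lemma nmE (E : normedZmodType C) (v : E) : (nm v)%:C = `|v|.
Proof.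
by rewrite /nm -lock; have /ger0_real/complex_realP[x ->] := normr_ge0 v.
Qed.

Lemma nm_ge0 (E : normedZmodType C) (v : E) : 0 <= nm v.
Proof. by rewrite -ler0c nmE. Qed.

Lemma nsq_nm (E : normedZmodType C) (v : E) : nsq v = nm v ^+ 2.
Proof. by rewrite /nsq /nm -!lock. Qed.

Lemma nm_sum (E : normedZmodType C) I (r : seq I) (F : I -> E) :
  nm (\sum_(i <- r) F i) <= \sum_(i <- r) nm (F i).
Proof.
rewrite -lecR nmE rmorph_sum /= [leRHS](eq_bigr _ (fun i _ => nmE (F i))).
exact: ler_norm_sum.
Qed.

Lemma nmZ (E : normedModType C) (a : C) (v : E) : nm (a *: v) = nm a * nm v.
Proof. by apply: complexI; rewrite [RHS]rmorphM /= !nmE normrZ. Qed.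

Lemma nm_le_l2 (E : normedZmodType C) n (v : 'I_n -> E) i : nm (v i) <= l2norm v.
Proof.
rewrite -(@ler_pXn2r _ 2) ?nnegrE ?nm_ge0 ?l2norm_ge0 // sqnE -nsq_nm.
by rewrite /sqn (bigD1 i) //= lerDl sumr_ge0 // => j _; exact: nsq_ge0.
Qed.

Lemma l2norm_sqn0 (E : normedZmodType C) n (v : 'I_n -> E) :
  sqn v = 0 -> l2norm v = 0.
Proof. by move=> v0; apply/eqP; rewrite -sqrf_eq0 sqnE v0. Qed.

Lemma sqnZ (E : normedModType C) n (c : C) (v : 'I_n -> E) :
  sqn (fun i => c *: v i) = nsq c * sqn v.
Proof. by rewrite /sqn mulr_sumr; apply: eq_bigr => i _; rewrite nsqZ. Qed.

Context (d : nat) (H K : completeNormedModType C) (Q : 'I_d -> {linear H -> K}).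

(** The operator [ncop] on a bare tuple of any size, since sums and products of sizes arise below
    that are not literally successors. *)
Definition qop n (X : 'I_d -> 'M[C]_n) (v : 'I_n -> H) : 'I_n -> K :=
  fun i => \sum_j \sum_k X j i k *: Q j (v k).

(** Membership with an explicit contraction constant instead of a supremum; direct sums and tensor
    products act on this constant. *)
Definition inball n (X : 'I_d -> 'M[C]_n) : Prop :=
  exists rho : R, [/\ 0 <= rho, rho < 1 &
    forall v, sqn (qop X v) <= rho ^+ 2 * sqn v].

Lemma qopZ n (X : 'I_d -> 'M[C]_n) (c : C) (u : 'I_n -> H) i :
  qop X (fun k => c *: u k) i = c *: qop X u i.
Proof.
rewrite /qop scaler_sumr; apply: eq_bigr => j _ /=.
rewrite scaler_sumr; apply: eq_bigr => k _ /=.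
by rewrite linearZ !scalerA mulrC.
Qed.

Hypothesis Qcont : forall j, continuous (Q j).

Lemma Q_bounded j : exists2 M : R, 0 <= M & forall v, nm (Q j v) <= M * nm v.
Proof.
have /linear_bounded_continuous/linear_boundedP/pinfty_ex_gt0[M M0 hM] := Qcont (j := j).
have Mr : (complex.Re M)%:C = M by rewrite RRe_real // gtr0_real.
exists (complex.Re M) => [|v]; first by rewrite -ler0c Mr ltW.
by rewrite -lecR rmorphM /= Mr !nmE.
Qed.

Lemma qop_bounded n (X : 'I_d -> 'M[C]_n) :
  exists2 M : R, 0 <= M & forall v, sqn (qop X v) <= M * sqn v.
Proof.
have [q q0 hq] : exists2 q : 'I_d -> R, (forall j, 0 <= q j) &
    forall j v, nm (Q j v) <= q j * nm v.
  have /choice[q hq] : forall j, exists M : R, 0 <= M /\ forall v, nm (Q j v) <= M * nm v.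
    by move=> j; have [M M0 hM] := Q_bounded j; exists M.
  by exists q => j; case: (hq j).
pose c i := \sum_j \sum_k nm (X j i k) * q j.
have c0 i : 0 <= c i by do 2!apply: sumr_ge0 => ? _; rewrite mulr_ge0 ?nm_ge0.
exists (\sum_i c i ^+ 2) => [|v]; first by apply: sumr_ge0 => i _; exact: sqr_ge0.
rewrite mulr_suml; apply: ler_sum => i _.
rewrite nsq_nm -sqnE -exprMn ler_pXn2r ?nnegrE ?mulr_ge0 ?nm_ge0 ?l2norm_ge0 //.
apply: le_trans (nm_sum _ _) _; rewrite mulr_suml; apply: ler_sum => j _.
apply: le_trans (nm_sum _ _) _; rewrite mulr_suml; apply: ler_sum => k _.
rewrite nmZ -mulrA ler_wpM2l ?nm_ge0 //; apply: le_trans (hq _ _) _.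
by rewrite ler_wpM2l // nm_le_l2.
Qed.

Lemma qop_sqn0 n (X : 'I_d -> 'M[C]_n) v : sqn v = 0 -> sqn (qop X v) = 0.
Proof.
have [M _ hM] := qop_bounded X => v0; apply/le_anti; rewrite sqn_ge0 andbT.
by have := hM v; rewrite v0 mulr0.
Qed.

(** The supremum of an unbounded set is 0 by default and would put the point in the ball, so the
    boundedness of [qop] comes first. *)
Lemma opballP (X : mxuniv R d) : opball Q X <-> inball (coord X).
Proof.
rewrite /opball /opnorm /=.
set A := [set l2norm _ | _ in _].
have A0 : A 0.
  have z0 : sqn (fun=> 0 : H) = 0 :> R by move=> n; rewrite /sqn big1 // => i _; rewrite nsq0.
  exists (fun=> 0) => /=; first by rewrite l2norm_sqn0.
  exact/l2norm_sqn0/qop_sqn0.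
split=> [A1|[rho [rho0 rho1 hrho]]]; last first.
  apply: le_lt_trans rho1; apply: ge_sup; first by exists 0.
  move=> _ [v /= v1 <-]; apply: (@le_trans _ _ (rho * l2norm v)).
    by rewrite l2norm_leP //; exact: hrho.
  by rewrite ler_piMr.
have supA : has_sup A.
  split; first by exists 0.
  have [M M0 hM] := qop_bounded (coord X); exists (M + 1) => _ [v /= v1 <-].
  rewrite -(@ler_pXn2r _ 2) ?nnegrE ?addr_ge0 ?l2norm_ge0 // sqnE.
  apply: le_trans (hM v) _; apply: (@le_trans _ _ M).
    by rewrite ler_piMr // -sqnE exprn_ile1 ?l2norm_ge0.
  rewrite sqrrD expr1n mulr1; have := sqr_ge0 M; lra.
exists (sup A); split => //; first exact: sup_upper_bound A0.
move=> v; have [v0|v0] := eqVneq (sqn v) 0; first by rewrite qop_sqn0 ?v0 ?mulr0.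
have vp : 0 < sqn v by rewrite lt_def v0 sqn_ge0.
have lp : 0 < l2norm v by rewrite lt_def l2norm_ge0 andbT -sqrf_eq0 sqnE.
pose c : C := (l2norm v)^-1%:C.
have nc : nsq c = (sqn v)^-1 by rewrite nsqR exprVn sqnE.
have : A (l2norm (qop (coord X) (fun k => c *: v k))).
  exists (fun k => c *: v k) => //=; rewrite -(@ler_pXn2r _ 2) ?nnegrE ?l2norm_ge0 //.
  by rewrite sqnE sqnZ nc mulVf // expr1n.
move/(sup_upper_bound supA); rewrite -(@ler_pXn2r _ 2) ?nnegrE ?l2norm_ge0 //; last first.
  exact: sup_upper_bound A0.
have -> : qop (coord X) (fun k => c *: v k) = (fun i => c *: qop (coord X) v i).
  by apply: funext => i; rewrite qopZ.
by rewrite sqnE sqnZ nc ler_pdivrMl // mulrC.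
Qed.

End OperatorBall.

Section Span.
Context (F : fieldType) (n : nat).

(** A matrix of maximal rank with rows in S works, since a missing vector of S could be added as a
    row; [S 0] provides a first matrix. *)
Lemma spanning_matrix (S : set 'rV[F]_n) : S 0 ->
  exists m (M : 'M[F]_(m, n)),
    (forall i, S (row i M)) /\ forall s, S s -> (s <= M)%MS.
Proof.
move=> S0.
pose P r := `[< exists m (M : 'M[F]_(m, n)), (forall i, S (row i M)) /\ \rank M = r >].
have exP : exists r, P r.
  exists 0; apply/asboolP; exists 1, 0; split=> [i|]; last exact: mxrank0.
  by rewrite row0.
have ubP r : P r -> (r <= n)%N by move=> /asboolP[m [M [_ <-]]]; exact: rank_leq_col.
case: (ex_maxnP exP ubP) => r /asboolP[m [M [SM Mr]]] maxr.
exists m, M; split=> // s Ss; apply: contrapT => /negP sM.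
suff /maxr : P (\rank (col_mx M s)).
  rewrite -Mr leqNgt => /negP; apply.
  have : (M < col_mx M s)%MS.
    rewrite ltmxE col_mx_sub (negPf sM) andbF andbT.
    by apply: submx_trans (addsmxSl M s) _; rewrite addsmxE.
  by rewrite ltmxErank => /andP[].
apply/asboolP; exists _, (col_mx M s); split=> // i.
have [k ->|k ->] := split_ordP i; first by rewrite rowKu.
rewrite rowKd (_ : row k s = s) //.
by apply/rowP => j; rewrite mxE ord1.
Qed.

End Span.

(** * Free polynomials *)

Section Polynomials.
Context (R : realType) (d : nat).
Local Notation C := R[i].
Local Notation word := (seq 'I_d).
Local Notation poly := (seq (C * word)).

(** Unlike [ncmon] it needs no ring of matrices, hence no successor as size. *)
Definition mon n (X : 'I_d -> 'M[C]_n) (w : word) : 'M[C]_n :=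
  foldr (fun j M => X j *m M) 1%:M w.

Lemma ncmonE (X : mxuniv R d) w : ncmon X w = mon (coord X) w.
Proof. by elim: w => [|j w IH]; rewrite /ncmon (big_nil, big_cons) // -/(ncmon X w) IH. Qed.

Lemma mon_cat n (X : 'I_d -> 'M[C]_n) u v : mon X (u ++ v) = mon X u *m mon X v.
Proof. by elim: u => [|j u IH] /=; rewrite ?mul1mx // IH mulmxA. Qed.

Definition peval n (X : 'I_d -> 'M[C]_n) (s : poly) : 'M[C]_n :=
  \sum_(t <- s) t.1 *: mon X t.2.

Lemma peval_cat n (X : 'I_d -> 'M[C]_n) s t : peval X (s ++ t) = peval X s + peval X t.
Proof. exact: big_cat. Qed.

Definition pscale (a : C) (s : poly) : poly := [seq (a * t.1, t.2) | t <- s].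

Lemma peval_scale n (X : 'I_d -> 'M[C]_n) a s : peval X (pscale a s) = a *: peval X s.
Proof.
by rewrite /peval big_map scaler_sumr; apply: eq_bigr => t _; rewrite scalerA.
Qed.

Definition plmul j (s : poly) : poly := [seq (t.1, j :: t.2) | t <- s].

Lemma peval_lmul n (X : 'I_d -> 'M[C]_n) j s : peval X (plmul j s) = X j *m peval X s.
Proof.
by rewrite /peval big_map mulmx_sumr; apply: eq_bigr => t _; rewrite scalemxAr.
Qed.

Definition prmul (w : word) (s : poly) : poly := [seq (t.1, t.2 ++ w) | t <- s].

Lemma peval_rmul n (X : 'I_d -> 'M[C]_n) w s : peval X (prmul w s) = peval X s *m mon X w.
Proof.
rewrite /peval big_map mulmx_suml; apply: eq_bigr => t _.
by rewrite mon_cat scalemxAl.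
Qed.

Definition psum (I : finType) (F : I -> poly) : poly := flatten [seq F i | i <- enum I].

Lemma peval_sum (I : finType) n (X : 'I_d -> 'M[C]_n) (F : I -> poly) :
  peval X (psum F) = \sum_i peval X (F i).
Proof. by rewrite /peval /psum big_flatten big_map big_enum. Qed.

Definition pconst (c : C) : poly := [:: (c, [::])].

Lemma peval_const n (X : 'I_d -> 'M[C]_n) c : peval X (pconst c) = c%:M.
Proof. by rewrite /peval big_seq1 /= scalemx1. Qed.

(** A multiplier on degrees; Fejer means, truncation and the extraction of one homogeneous part are
    all of this form. *)
Definition pmask (phi : nat -> C) (s : poly) : poly :=
  [seq (phi (size t.2) * t.1, t.2) | t <- s].

Lemma mon_intertwine p q (Y : 'I_d -> 'M[C]_p) (X : 'I_d -> 'M[C]_q) (L : 'M[C]_(p, q)) :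
  (forall j, Y j *m L = L *m X j) -> forall w, mon Y w *m L = L *m mon X w.
Proof.
move=> YL; elim=> [|j w IH] /=; first by rewrite mul1mx mulmx1.
by rewrite -mulmxA IH mulmxA YL mulmxA.
Qed.

Lemma peval_intertwine p q (Y : 'I_d -> 'M[C]_p) (X : 'I_d -> 'M[C]_q) (L : 'M[C]_(p, q)) :
  (forall j, Y j *m L = L *m X j) -> forall s, peval Y s *m L = L *m peval X s.
Proof.
move=> YL s; rewrite /peval mulmx_suml mulmx_sumr; apply: eq_bigr => t _.
by rewrite -scalemxAl (mon_intertwine YL) scalemxAr.
Qed.

Definition mxpow m (T : 'M[C]_m) k : 'M[C]_m := iter k (mulmx T) 1%:M.

Lemma tens11 m n : (1%:M : 'M[C]_m) *t (1%:M : 'M[C]_n) = 1%:M.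
Proof.
apply/matrixP => a b; case: (mxtens_indexP a) => i k; case: (mxtens_indexP b) => j l.
rewrite tensmxE !mxE (can_eq (@mxtens_indexK m n)) xpair_eqE.
by case: (i == j); case: (k == l); rewrite ?mulr1 ?mul0r ?mulr0.
Qed.

Lemma tensmxM m1 m2 m3 n1 n2 n3 (A : 'M[C]_(m1, m2)) (B : 'M[C]_(n1, n2))
    (A' : 'M[C]_(m2, m3)) (B' : 'M[C]_(n2, n3)) :
  (A *t B) *m (A' *t B') = (A *m A') *t (B *m B').
Proof. by rewrite tensmx_mul. Qed.

Definition tpt m n (T : 'M[C]_m) (X : 'I_d -> 'M[C]_n) : 'I_d -> 'M[C]_(m * n) :=
  fun j => T *t X j.

(** The factor T only records the length of the word, so compressing it acts on polynomials as a
    degree multiplier. *)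
Lemma mon_tens m n (T : 'M[C]_m) (X : 'I_d -> 'M[C]_n) w :
  mon (tpt T X) w = mxpow T (size w) *t mon X w.
Proof.
elim: w => [|j w IH] /=; last by rewrite IH tensmxM.
by rewrite tens11.
Qed.

Definition tnilp n (X : 'I_d -> 'M[C]_n) m := forall w, (m <= size w)%N -> mon X w = 0.

End Polynomials.

(** * Boundedness of the coordinates on the ball *)

Section CoordinateBound.
Context (R : realType) (d : nat).
Local Notation C := R[i].
Context (H K : completeNormedModType C) (Q : 'I_d -> {linear H -> K}).
Hypothesis hilbK : is_hilbert K.
Hypothesis Qindep : lin_indep Q.

(** By linear independence the vectors [ip (Q j h) k], indexed by j, span C^d as h and k vary, so
    finitely many pairs (h, k) suffice. For each pair the corresponding combination of the X_j is a
    compression of Q(X), hence bounded; inverting the linear system bounds each X_j. *)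
Lemma inball_coord_bounded : exists2 B : R, 0 <= B &
  forall n (X : 'I_d -> 'M[C]_n), inball Q X -> forall j, mxopnorm (X j) <= B.
Proof.
have [ip [ipP ipq_nsq]] := hilbert_ip hilbK.
pose fv (z : H * K) : 'rV[C]_d := \row_j ip (Q j z.1) z.2.
have fv0 : [set fv z | z in setT] 0.
  by exists (0, 0) => //; apply/rowP => j; rewrite !mxE linear0 ip0l.
have [m [M [hM sM]]] := spanning_matrix fv0.
have fullM : row_full M.
  rewrite /row_full -mxrank_tr -/(row_free M^T).
  apply: inj_row_free => v vM.
  have h0 z : ip (\sum_j v 0 j *: Q j z.1) z.2 = 0.
    have : v *m (fv z)^T = 0.
      have /submxP[D ->] := sM _ (ex_intro2 _ _ z I erefl).
      by rewrite trmx_mul mulmxA vM mul0mx.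
    move/rowP/(_ 0); rewrite !mxE => vz; rewrite -[RHS]vz (ip_suml ipP).
    by apply: eq_bigr => j _; rewrite (ipZl ipP) !mxE.
  apply/rowP => j; rewrite mxE; apply: (Qindep (c := v 0)) => h.
  by apply/nsq_eq0; rewrite -ipq_nsq /ipq (h0 (h, _)).
have /row_fullP[D DM] := fullM.
have /choice[z hz] : forall i, exists z, fv z = row i M.
  by move=> i; have [z _ <-] := hM i; exists z.
have bndZ n (X : 'I_d -> 'M[C]_n) : inball Q X -> forall t,
    mxopnorm (\sum_i M t i *: X i) <= Num.sqrt (nsq (z t).1 * nsq (z t).2).
  move=> [rho [r0 r1 hX]] t; apply/mxopnorm_leP => [|v]; first exact: sqrtr_ge0.
  rewrite sqr_sqrtr ?mulr_ge0 ?nsq_ge0 //.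
  set h := (z t).1; set k := (z t).2.
  (* Q(X) is applied to the elementary tensor of v and h, and paired with k. *)
  apply: (@le_trans _ _ (\sum_s nsq (qop Q X (fun s => v s 0 *: h) s) * nsq k)).
    apply: ler_sum => s _; rewrite -!ipq_nsq.
    apply: le_trans (cauchy_schwarz ipP _ _).
    rewrite le_eqVlt; apply/orP; left; apply/eqP; congr nsq.
    rewrite mulmx_suml summxE (ip_suml ipP); apply: eq_bigr => i _.
    rewrite -scalemxAl !mxE (ip_suml ipP) mulr_sumr; apply: eq_bigr => l _.
    rewrite linearZ /= !(ipZl ipP).
    have -> : M t i = ip (Q i h) k by have := hz t => /rowP/(_ i); rewrite !mxE.
    ring.
  rewrite -mulr_suml -/(sqn _) [_ * nsq k]mulrC mulrAC [leRHS]mulrC.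
  rewrite ler_wpM2l ?nsq_ge0 //; apply: le_trans (hX _) _.
  have -> : sqn (fun s => v s 0 *: h) = nsq h * csq v.
    by rewrite /sqn /csq mulr_sumr; apply: eq_bigr => s _; rewrite nsqZ mulrC.
  rewrite ler_piMl ?mulr_ge0 ?nsq_ge0 ?csq_ge0 //.
  by rewrite exprn_ile1 // ltW.
pose B0 j := \sum_t nm (D j t) * Num.sqrt (nsq (z t).1 * nsq (z t).2).
have B00 j : 0 <= B0 j by apply: sumr_ge0 => t _; rewrite mulr_ge0 ?nm_ge0 ?sqrtr_ge0.
exists (\sum_j B0 j) => [|n X hX j]; first exact: sumr_ge0.
apply: (@le_trans _ _ (B0 j)); last first.
  by rewrite (bigD1 j) //= lerDl sumr_ge0.
have -> : X j = \sum_t D j t *: \sum_i M t i *: X i.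
  under eq_bigr do rewrite scaler_sumr.
  rewrite exchange_big /= (bigD1 j) //= [X in _ + X]big1 ?addr0 => [|i ij].
    under eq_bigr do rewrite scalerA.
    rewrite -scaler_suml; have := DM => /matrixP/(_ j j).
    by rewrite !mxE eqxx => ->; rewrite scale1r.
  under eq_bigr do rewrite scalerA.
  rewrite -scaler_suml; have := DM => /matrixP/(_ j i).
  by rewrite !mxE eq_sym (negPf ij) => ->; rewrite scale0r.
rewrite /B0; elim/big_ind2: _ => [|x a y b xa yb|t _]; first by rewrite mxopnorm0.
  by apply: le_trans (mxopnormD _ _) _; exact: lerD.
apply: le_trans (mxopnormZ_le _ _) _; rewrite /nm -lock.
rewrite ler_wpM2l ?bndZ //.
by have := nm_ge0 (D j t); rewrite /nm -lock.
Qed.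

End CoordinateBound.

(** * Fejer means *)

Section ColumnSpaces.
Context (R : realType).
Local Notation C := R[i].

Definition dotc n (u v : 'cV[C]_n) : C := \sum_i u i 0 * Num.conj (v i 0).

Lemma inner_dotc n : inner (@dotc n).
Proof.
split=> [a u v w|u v|u].
- rewrite /dotc mulr_sumr -big_split; apply: eq_bigr => i _ /=.
  by rewrite !mxE mulrDl mulrA.
- rewrite /dotc rmorph_sum; apply: eq_bigr => i _ /=.
  by rewrite rmorphM /= conjCK mulrC.
- by apply: sumr_ge0 => i _; rewrite -nsqC ler0c nsq_ge0.
Qed.

Lemma ipq_dotc n (u : 'cV[C]_n) : ipq (@dotc n) u = csq u.
Proof.
apply: complexI; rewrite (ipqE (@inner_dotc n)) rmorph_sum /=.
by apply: eq_bigr => i _; rewrite nsqC.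
Qed.

Lemma nsq_sum_le n (a b : 'I_n -> C) :
  nsq (\sum_i a i * b i) <= sqn a * sqn b.
Proof.
have := cauchy_schwarz (@inner_dotc n) (\col_i a i) (\col_i Num.conj (b i)).
rewrite !ipq_dotc => h.
have <- : csq (\col_i a i) = sqn a by apply: eq_bigr => i _; rewrite mxE.
have <- : csq (\col_i Num.conj (b i)) = sqn b.
  apply: eq_bigr => i _; rewrite mxE; apply: complexI.
  by rewrite !nsqC conjCK mulrC.
apply: le_trans h; rewrite le_eqVlt; apply/orP; left; apply/eqP; congr nsq.
by apply: eq_bigr => i _; rewrite !mxE conjCK.
Qed.

Lemma sum_tens (V : nmodType) m n (F : 'I_(m * n) -> V) :
  \sum_a F a = \sum_i \sum_s F (mxtens_index (i, s)).
Proof.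
rewrite pair_big; apply: reindex => /=.
exists (@mxtens_unindex m n) => [[i s]|a] _; first exact: mxtens_indexK.
by rewrite -surjective_pairing; exact: mxtens_unindexK.
Qed.

(* [colt n y] is [y (x) 1]. *)
Definition colt p n (y : 'cV[C]_p) : 'M[C]_(p * n, n) :=
  \matrix_(a, t) (y (mxtens_unindex a).1 0 * ((mxtens_unindex a).2 == t)%:R).

Lemma coltE p n (y : 'cV[C]_p) i s t :
  colt n y (mxtens_index (i, s)) t = y i 0 * (s == t)%:R.
Proof. by rewrite mxE mxtens_indexK. Qed.

Lemma coltTE p n (y : 'cV[C]_p) i s t :
  (colt n y)^T t (mxtens_index (i, s)) = y i 0 * (s == t)%:R.
Proof. by rewrite mxE coltE. Qed.

Lemma tens_colt p q n n' (A : 'M[C]_(q, p)) (B : 'M[C]_(n', n)) (y : 'cV[C]_p) :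
  (A *t B) *m colt n y = colt n' (A *m y) *m B.
Proof.
apply/matrixP => a t; case: (mxtens_indexP a) => i s.
rewrite mxE sum_tens [RHS]mxE [RHS](bigD1 s) //= [X in _ = _ + X]big1 ?addr0 => [|s' ss'].
  rewrite coltE eqxx mulr1 mxE mulr_suml; apply: eq_bigr => k _.
  rewrite (bigD1 t) //= big1 ?addr0 => [|t' tt']; last first.
    by rewrite coltE (negPf tt') !mulr0.
  by rewrite tensmxE coltE eqxx mulr1 mulrAC.
by rewrite coltE eq_sym (negPf ss') mulr0 mul0r.
Qed.

Lemma coltZ p n a (y : 'cV[C]_p) : colt n (a *: y) = a *: colt n y.
Proof. by apply/matrixP => i j; rewrite !mxE mulrA. Qed.

Lemma coltD p n (x y : 'cV[C]_p) : colt n (x + y) = colt n x + colt n y.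
Proof. by apply/matrixP => i j; rewrite !mxE mulrDl. Qed.

Lemma coltT_tens p q n n' (A : 'M[C]_(q, p)) (B : 'M[C]_(n', n)) z y :
  (colt n' z)^T *m (A *t B) *m colt n y = (z^T *m A *m y) 0 0 *: B.
Proof.
rewrite -mulmxA tens_colt mulmxA.
have -> : (colt n' z)^T *m colt n' (A *m y) = ((z^T *m A *m y) 0 0)%:M.
  apply/matrixP => s t; rewrite mxE sum_tens -mulmxA [RHS]mxE [in RHS]mxE -mulr_natr.
  rewrite mulr_suml; apply: eq_bigr => i _.
  rewrite (bigD1 s) //= big1 ?addr0 => [|s' ss'].
    by rewrite coltTE coltE eqxx mulr1 mulrA [z^T _ _]mxE.
  by rewrite coltTE (negPf ss') mulr0 mul0r.
by rewrite mul_scalar_mx.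
Qed.

Lemma csq_colt p n (y : 'cV[C]_p) (x : 'cV[C]_n) :
  csq (colt n y *m x) = csq y * csq x.
Proof.
rewrite /csq sum_tens mulr_suml; apply: eq_bigr => i _; rewrite mulr_sumr.
apply: eq_bigr => s _; rewrite mxE (bigD1 s) //= big1 ?addr0 => [|s' ss'].
  by rewrite coltE eqxx mulr1 nsqM.
by rewrite coltE eq_sym (negPf ss') mulr0 mul0r.
Qed.

Lemma csq_coltT p n (y : 'cV[C]_p) (w : 'cV[C]_(p * n)) :
  csq ((colt n y)^T *m w) <= csq y * csq w.
Proof.
rewrite [csq w]/csq sum_tens exchange_big mulr_sumr; apply: ler_sum => s _ /=.
apply: le_trans (nsq_sum_le _ _); rewrite le_eqVlt; apply/orP; left; apply/eqP.
congr nsq; rewrite mxE sum_tens; apply: eq_bigr => i _.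
rewrite (bigD1 s) //= big1 ?addr0 => [|s' ss'].
  by rewrite coltTE eqxx mulr1.
by rewrite coltTE (negPf ss') mulr0 mul0r.
Qed.

Definition ones m : 'cV[C]_m := const_mx 1.

Lemma csq_ones m : csq (ones m) = m%:R.
Proof.
rewrite /csq (eq_bigr (fun=> 1)) => [|i _]; first by rewrite sumr_const card_ord.
by rewrite mxE; have := nsqR (1 : R); rewrite rmorph1 expr1n.
Qed.

Definition nshift m : 'M[C]_m := \matrix_(i, j) (i == j.+1 :> nat)%:R.

Lemma mxpow_nshift m k i j : mxpow (nshift m) k i j = (i == (j + k)%N :> nat)%:R.
Proof.
elim: k i j => [|k IH] i j /=; first by rewrite mxE addn0.
rewrite mxE addnS; case: (posnP i) => [i0|ip].
  rewrite i0 big1 // => l _; by rewrite mxE i0 mul0r.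
have lt : (i.-1 < m)%N by exact: leq_ltn_trans (leq_pred i) (ltn_ord i).
rewrite (bigD1 (Ordinal lt)) //= big1 ?addr0 => [|l ll]; last first.
  rewrite mxE; case: eqP => [e|]; rewrite ?mul0r //.
  by case/eqP: ll; apply: val_inj; rewrite /= e.
by rewrite IH mxE /= prednK // eqxx mul1r -eqSS prednK.
Qed.

Lemma mxpow_nshift_nilp m k : (m <= k)%N -> mxpow (nshift m) k = 0.
Proof.
move=> mk; apply/matrixP => i j; rewrite mxpow_nshift mxE.
by rewrite ltn_eqF // (leq_trans (ltn_ord i)) // (leq_trans mk) // leq_addl.
Qed.

(* The coefficients of the Fejer kernel, with truncated subtraction. *)
Definition fejer m k : C := (m.+1 - k)%N%:R / m.+1%:R.

(** The factors 1/sqrt(m+1) of the two unit vectors are merged into one. *)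
Definition fejmean m n (F : 'M[C]_(m.+1 * n)) : 'M[C]_n :=
  m.+1%:R^-1 *: ((colt n (ones m.+1))^T *m F *m colt n (ones m.+1)).

(** The k-th power of the shift has m+1-k unit entries, all on one diagonal. *)
Lemma ones_nshift m k :
  ((ones m.+1)^T *m mxpow (nshift m.+1) k *m ones m.+1) 0 0 = (m.+1 - k)%N%:R.
Proof.
rewrite mxE (eq_bigr (fun j : 'I_m.+1 => ((j + k)%N < m.+1)%N%:R)) => [|j _].
  rewrite -natr_sum; congr (_%:R).
  rewrite -(big_mkord xpredT (fun j => nat_of_bool (j + k < m.+1)%N)).
  rewrite (eq_bigr (fun j => nat_of_bool (j < m.+1 - k)%N)) => [|j _]; last first.
    by rewrite ltn_subRL addnC.
  rewrite (big_cat_nat (n := (m.+1 - k)%N)) ?leq_subr //=.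
  rewrite [X in (_ + X)%N](_ : _ = 0)%N ?addn0; last first.
    by rewrite big_nat_cond big1 // => j /andP[/andP[mj _] _]; rewrite ltnNge mj.
  rewrite big_nat_cond (eq_bigr (fun=> 1%N)) => [|j /andP[/andP[_ ->]]] //.
  by rewrite -big_nat_cond sum_nat_const_nat subn0 muln1.
rewrite [ones _ _ _]mxE mulr1 mxE; case: ltnP => jk.
  rewrite (bigD1 (Ordinal jk)) //= big1 ?addr0 => [|i ij].
    by rewrite mxpow_nshift eqxx mulr1 !mxE.
  by rewrite mxpow_nshift (_ : (i : nat) == (j + k)%N = false) ?mulr0 //; exact: negPf.
rewrite big1 // => i _; rewrite mxpow_nshift ltn_eqF ?mulr0 //.
exact: leq_trans jk.
Qed.

Lemma fejmean_tens m k n (B : 'M[C]_n) :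
  fejmean (mxpow (nshift m.+1) k *t B) = fejer m k *: B.
Proof. by rewrite /fejmean coltT_tens ones_nshift scalerA mulrC. Qed.

Lemma fejer_bounds m k :
  0 <= fejer m k /\ 1 - fejer m k <= k%:R / m.+1%:R /\ fejer m k <= 1.
Proof.
have m0 : 0 < m.+1%:R :> C by rewrite ltr0n.
split; first by rewrite divr_ge0 ?ler0n.
split; last by rewrite ler_pdivrMr // mul1r ler_nat leq_subr.
rewrite lerBlDr -mulrDl ler_pdivlMr // mul1r -natrD ler_nat.
by rewrite -leq_subLR.
Qed.

End ColumnSpaces.

(** * Intertwining and shifts *)

Section NcSets.
Context (R : realType) (d : nat).
Local Notation C := R[i].
Context (H K : completeNormedModType C) (Q : 'I_d -> {linear H -> K}).
Hypothesis Qcont : forall j, continuous (Q j).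

(** The size [m.+1 * (tag X).+1] is convertible to the successor of the tag given here. *)
Definition tenspt m (T : 'M[C]_m.+1) (X : mxuniv R d) : mxuniv R d :=
  @mkpt R d (tag X + m * (tag X).+1) (tpt T (coord X)).

(** T is an arbitrary matrix because [bshift] is used besides the nilpotent shift; similarities and
    tensor products are followed only as long as they stay in the ball. *)
Definition ncset (E : set (mxuniv R d)) : Prop :=
  [/\ E `<=` opball Q,
      forall X Y, E X -> E Y -> E (dsum X Y),
      forall X (S : 'M_(lvl X)), S \in unitmx -> E X -> opball Q (simpt S) ->
        E (simpt S) &
      forall m (T : 'M_m.+1) X, E X -> opball Q (tenspt T X) -> E (tenspt T X)].

Lemma gfun_eq (E : set (mxuniv R d)) (f : gfun E) n (X Y : 'I_d -> 'M[C]_n.+1)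
    (hX : E (mkpt X)) (hY : E (mkpt Y)) : X = Y -> f _ hX = f _ hY.
Proof. by move=> XY; subst Y; rewrite (Prop_irrelevance hX hY). Qed.

(** The unipotent S built from L commutes with the direct sum of Y and X because L intertwines them.
    So S takes this point to itself, no new membership arises, and the value of f at the direct sum
    must commute with S as well; the off-diagonal block is the claim. *)
Lemma nc_intertwine (E : set (mxuniv R d)) (f : gfun E) : ncset E -> is_ncfun f ->
  forall X Y (hX : E X) (hY : E Y) (L : 'M[C]_(lvl Y, lvl X)),
  (forall j, coord Y j *m L = L *m coord X j) -> f Y hY *m L = L *m f X hX.
Proof.
move=> [sEQ Ed _ _] [fd fs] X Y hX hY L YL.
have hZ := Ed _ _ hY hX.
pose S : 'M[C]_(lvl Y + lvl X) := block_mx 1%:M L 0 1%:M.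
have uS : S \in unitmx by rewrite unitmxE det_ublock !det1 mulr1 unitr1.
have comm A B : A *m L = L *m B -> block_mx A 0 0 B *m S = S *m block_mx A 0 0 B.
  move=> AB; rewrite !mulmx_block !mulmx0 !mul0mx !mulmx1 !mul1mx.
  by rewrite !addr0 !add0r AB.
have e : (fun j => invmx S *m block_mx (coord Y j) 0 0 (coord X j) *m S) =
         (fun j => block_mx (coord Y j) 0 0 (coord X j)).
  by apply: funext => j; rewrite -mulmxA comm // mulKmx.
have hS : E (@simpt R d (dsum Y X) S).
  by move: hZ; rewrite /simpt /dsum /= -[in X in X -> _]e.
have := fs (dsum Y X) S hZ hS uS.
rewrite (gfun_eq f hS hZ) // (fd _ _ hY hX) => fZ.
have : S *m block_mx (f Y hY) 0 0 (f X hX) = block_mx (f Y hY) 0 0 (f X hX) *m S.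
  by rewrite {1}fZ -mulmxA mulKVmx.
rewrite !mulmx_block !mulmx0 !mul0mx !mulmx1 !mul1mx.
by rewrite !addr0 !add0r => /eq_block_mx[_ <- _ _].
Qed.

Lemma inball_dsum m n (X : 'I_d -> 'M[C]_m) (Y : 'I_d -> 'M[C]_n) :
  inball Q X -> inball Q Y -> inball Q (fun j => block_mx (X j) 0 0 (Y j)).
Proof.
move=> [r [r0 r1 hX]] [s [s0 s1 hY]]; exists (Num.max r s); split.
- by rewrite le_max r0.
- by rewrite gt_max r1 s1.
move=> v; rewrite /sqn !big_split_ord /= mulrDr.
have sq (a b : R) : 0 <= a -> 0 <= b -> a ^+ 2 <= Num.max a b ^+ 2.
  move=> a0 b0; have ab : a <= Num.max a b by rewrite le_max lexx.
  by apply: lerXn2r => //; rewrite nnegrE // (le_trans a0).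
apply: lerD.
  rewrite (eq_bigr (fun i => nsq (qop Q X (fun k => v (lshift n k)) i))) => [|i _].
    by apply: le_trans (hX _) _; rewrite ler_wpM2r ?sqn_ge0 ?sq.
  congr nsq; apply: eq_bigr => j _; rewrite big_split_ord /= [X in _ + X]big1 ?addr0.
    by apply: eq_bigr => k _; rewrite block_mxEul.
  by move=> k _; rewrite block_mxEur mxE scale0r.
rewrite (eq_bigr (fun i => nsq (qop Q Y (fun k => v (rshift m k)) i))) => [|i _].
  by apply: le_trans (hY _) _; rewrite ler_wpM2r ?sqn_ge0 // maxC sq.
congr nsq; apply: eq_bigr => j _; rewrite big_split_ord /= [X in X + _]big1 ?add0r.
  by apply: eq_bigr => k _; rewrite block_mxEdr.
by move=> k _; rewrite block_mxEdl mxE scale0r.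
Qed.

Definition kapp p q (A : 'M[C]_(p, q)) (k : 'I_q -> K) : 'I_p -> K :=
  fun i => \sum_l A i l *: k l.

(** Q(A (x) X) is A on the first index composed with Q(X) on the second, so the bounds multiply. *)
Lemma inball_tens p n (A : 'M[C]_p) (X : 'I_d -> 'M[C]_n) (r b : R) :
  (forall k, sqn (kapp A k) <= b ^+ 2 * sqn k) -> 0 <= b -> 0 <= r -> b * r < 1 ->
  (forall v, sqn (qop Q X v) <= r ^+ 2 * sqn v) -> inball Q (tpt A X).
Proof.
move=> hA b0 r0 br hX; exists (b * r); split=> [||v]; rewrite ?mulr_ge0 //.
rewrite exprMn -mulrA.
have qE i s : qop Q (tpt A X) v (mxtens_index (i, s)) =
    kapp A (fun l => qop Q X (fun t => v (mxtens_index (l, t))) s) i.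
  rewrite /qop /kapp; under [RHS]eq_bigr do rewrite scaler_sumr.
  rewrite [RHS]exchange_big /=; apply: eq_bigr => j _; rewrite sum_tens.
  apply: eq_bigr => l _; rewrite scaler_sumr; apply: eq_bigr => t _.
  by rewrite tensmxE scalerA.
apply: (@le_trans _ _ (\sum_s b ^+ 2 *
    sqn (fun l => qop Q X (fun t => v (mxtens_index (l, t))) s))).
  rewrite {1}/sqn sum_tens exchange_big; apply: ler_sum => s _ /=.
  by apply: le_trans (hA _); apply: ler_sum => i _; rewrite qE.
rewrite -mulr_sumr ler_wpM2l ?sqr_ge0 // exchange_big /=.
rewrite {1}/sqn sum_tens mulr_sumr; apply: ler_sum => l _.
exact: (hX (fun t => v (mxtens_index (l, t)))).
Qed.

Lemma kapp_nshift m k : sqn (kapp (nshift R m) k) <= sqn k.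
Proof.
case: m k => [|m] k; first by rewrite /sqn !big_ord0.
rewrite /sqn big_ord_recl big_ord_recr /= addrC lerD //; last first.
  rewrite le_eqVlt; apply/orP; left; apply/eqP; apply: eq_bigr => i _; congr nsq.
  rewrite /kapp (bigD1 (widen_ord (leqnSn m) i)) //= big1 ?addr0 => [|l li].
    by rewrite mxE /= eqxx scale1r.
  rewrite mxE /= (_ : (i.+1 == l.+1) = false) ?scale0r //.
  by apply/negbTE; apply: contraNneq li => -[il]; apply/eqP/val_inj.
rewrite (_ : kapp _ _ _ = 0) ?nsq0 ?nsq_ge0 // /kapp big1 // => l _.
by rewrite mxE scale0r.
Qed.

(* The shift made to act trivially on [c (1, ..., 1)] by coupling it to one
   more coordinate. *)
Definition bshift m (c : R) : 'M[C]_(m.+1 + 1) :=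
  block_mx (nshift R m.+1) (c%:C *: delta_mx 0 0) 0 1%:M.

Lemma bshift_top m c : bshift m c *m col_mx 1%:M 0 = col_mx 1%:M 0 *m nshift R m.+1.
Proof. by rewrite mul_block_col !mulmx1 !mulmx0 !addr0 mul_col_mx mul1mx mul0mx. Qed.

(** The extra coordinate puts back the first entry c that the shift loses. *)
Lemma bshift_fix m c :
  bshift m c *m col_mx (c%:C *: ones R m.+1) 1%:M = col_mx (c%:C *: ones R m.+1) 1%:M.
Proof.
rewrite mul_block_col mul0mx !mulmx1 add0r; congr col_mx.
rewrite -scalemxAr -scalerDr; congr (_ *: _); apply/colP => i; rewrite !mxE.
have [i0|i0] := posnP i.
  rewrite big1 ?add0r => [|l _]; last by rewrite mxE i0 mul0r.
  by rewrite (_ : i == 0) //; apply/eqP/val_inj.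
have lt : (i.-1 < m.+1)%N by exact: leq_ltn_trans (leq_pred i) (ltn_ord i).
rewrite (bigD1 (Ordinal lt)) //= big1 ?addr0 => [|l ll]; last first.
  rewrite mxE; case: eqP => [e|]; rewrite ?mul0r //.
  by case/eqP: ll; apply: val_inj; rewrite /= e.
rewrite !mxE /= prednK // eqxx mulr1 (_ : (i == 0) = false) ?addr0 //.
by apply/negbTE; rewrite -val_eqE /= -lt0n.
Qed.

Lemma nsqD_le (E : normedModType C) (u v : E) (a : R) : 0 < a ->
  nsq (u + v) <= (1 + a) * nsq u + (1 + a^-1) * nsq v.
Proof.
move=> a0; rewrite !nsq_nm.
have h : nm (u + v) <= nm u + nm v by rewrite -lecR rmorphD /= !nmE ler_normD.
apply: (@le_trans _ _ ((nm u + nm v) ^+ 2)).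
  by rewrite ler_pXn2r ?nnegrE ?addr_ge0 ?nm_ge0.
rewrite -subr_ge0.
have -> : (1 + a) * nm u ^+ 2 + (1 + a^-1) * nm v ^+ 2 - (nm u + nm v) ^+ 2 =
   (a * nm u - nm v) ^+ 2 / a by field; rewrite gt_eqF.
by rewrite divr_ge0 ?sqr_ge0 // ltW.
Qed.

Lemma kapp_bshift m c k : 0 < c -> sqn (kapp (bshift m c) k) <= (1 + c) ^+ 2 * sqn k.
Proof.
move=> c0; rewrite /sqn !big_split_ord /= !big_ord1.
have -> : kapp (bshift m c) k (rshift m.+1 ord0) = k (rshift m.+1 ord0).
  rewrite /kapp big_split_ord /= big_ord1 big1 ?add0r => [|l _].
    by rewrite block_mxEdr mxE eqxx scale1r.
  by rewrite block_mxEdl mxE scale0r.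
set z := k (rshift _ _); pose k' l := k (lshift 1 l).
have top i : kapp (bshift m c) k (lshift 1 i) =
    kapp (nshift R m.+1) k' i + (c * (i == 0)%:R)%:C *: z.
  rewrite /kapp big_split_ord /= big_ord1; congr (_ + _).
    by apply: eq_bigr => l _; rewrite block_mxEul.
  rewrite block_mxEur !mxE /= andbT rmorphM /=; congr ((_ * _) *: _).
  by case: (i == 0).
(* With weight c in [nsqD_le] the coupling costs (1 + 1/c) c^2 = c + c^2, which together with the
   last coordinate stays below (1 + c)^2. *)
apply: (@le_trans _ _ ((1 + c) * sqn k' + (1 + c^-1) * (c ^+ 2 * nsq z) + nsq z)).
  rewrite lerD2r; under eq_bigr do rewrite top.
  apply: le_trans (ler_sum _ (fun i _ => nsqD_le _ _ c0)) _.
  rewrite big_split /= -!mulr_sumr lerD //.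
    by rewrite ler_wpM2l ?kapp_nshift // addr_ge0 // ltW.
  rewrite ler_wpM2l ?addr_ge0 ?invr_ge0 ?ler01 ?(ltW c0) //.
  rewrite (bigD1 ord0) //= big1 ?addr0 => [|i i0].
    by rewrite nsqZ nsqR mulr1.
  by rewrite (negPf i0) mulr0 nsqZ nsqR expr0n mul0r.
have -> : (1 + c^-1) * (c ^+ 2 * nsq z) = (c ^+ 2 + c) * nsq z.
  by field; rewrite gt_eqF.
rewrite -/(sqn k'); have := nsq_ge0 z; have := sqn_ge0 k' => k0 z0.
have := mulr_ge0 (ltW c0) k0; have := mulr_ge0 (ltW c0) z0.
have := mulr_ge0 (sqr_ge0 c) k0; nra.
Qed.

End NcSets.

(** * Contractivity and convergence of Fejer means *)

Section Cesaro.
Context (R : realType) (d : nat).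
Local Notation C := R[i].

(** A norm bound for the block matrix F, stated on tuples of columns to keep the dependent indices
    of [\mxblock] out of the computations. *)
Definition blockbd k n (F : 'I_k -> 'I_k -> 'M[C]_n) (M : R) : Prop :=
  forall v : 'I_k -> 'cV[C]_n,
    \sum_i csq (\sum_j F i j *m v j) <= M ^+ 2 * \sum_j csq (v j).

Lemma csq_mxcol k n (v : 'I_k -> 'cV[C]_n) : csq (\mxcol_i v i) = \sum_i csq (v i).
Proof.
rewrite /csq sig_big_dep /= (reindex _ tagnat.sig_bij_on) /=.
by apply: eq_bigr => i _; rewrite mxE.
Qed.

Lemma mxblock_blockbd k n (F : 'I_k -> 'I_k -> 'M[C]_n) (M : R) : 0 <= M ->
  mxopnorm (\mxblock_(i < k, j < k) F i j) <= M <-> blockbd F M.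
Proof.
move=> M0; rewrite mxopnorm_leP //; split=> h v.
  by have := h (\mxcol_j v j); rewrite mul_mxblock_mxrow !csq_mxcol.
have := h (submxcol v); rewrite -[v in X in _ -> X]submxcolK mul_mxblock_mxrow.
by rewrite !csq_mxcol.
Qed.

Lemma blockbd1 n (F : 'I_1 -> 'I_1 -> 'M[C]_n) M : 0 <= M ->
  blockbd F M <-> mxopnorm (F 0 0) <= M.
Proof.
move=> M0; rewrite mxopnorm_leP //; split=> h v.
  by have := h (fun=> v); rewrite !big_ord1.
by rewrite !big_ord1.
Qed.

(** All entries are compressed by the same W, so the block matrix as a whole is; W and its transpose
    each contribute a factor m+1 to squared norms, against 1/(m+1)^2 from the normalization. *)
Lemma blockbd_fejmean k m n (F : 'I_k -> 'I_k -> 'M[C]_(m.+1 * n)) M :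
  blockbd F M -> blockbd (fun i j => fejmean (F i j)) M.
Proof.
move=> hF v; set W := colt n (ones R m.+1).
have m0 : 0 < m.+1%:R :> R by rewrite ltr0n.
have nm1 : nsq (m.+1%:R^-1 : C) = m.+1%:R ^- 2.
  by have := nsqR (m.+1%:R^-1 : R); rewrite rmorphV ?unitfE ?gt_eqF //= rmorph_nat exprVn.
apply: (@le_trans _ _ (\sum_i m.+1%:R^-1 * csq (\sum_j F i j *m (W *m v j)))).
  apply: ler_sum => i _.
  have -> : \sum_j fejmean (F i j) *m v j =
      m.+1%:R^-1 *: (W^T *m \sum_j F i j *m (W *m v j)).
    rewrite mulmx_sumr scaler_sumr; apply: eq_bigr => j _.
    by rewrite -scalemxAl !mulmxA.
  rewrite csqZ nm1; apply: (@le_trans _ _ (m.+1%:R ^- 2 *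
     (m.+1%:R * csq (\sum_j F i j *m (W *m v j))))).
    rewrite ler_wpM2l ?invr_ge0 ?exprn_ge0 ?ler0n //.
    by rewrite -[X in X * csq _]csq_ones csq_coltT.
  by rewrite expr2 invfM -!mulrA [_^-1 * (_ * csq _)]mulrA mulVf ?mul1r // gt_eqF.
rewrite -mulr_sumr ler_pdivrMl //; apply: le_trans (hF _) _.
rewrite (eq_bigr (fun j => m.+1%:R * csq (v j))) => [|j _].
  by rewrite -mulr_sumr mulrCA.
by rewrite csq_colt csq_ones.
Qed.

Lemma mxopnorm_fejmean m n (F : 'M[C]_(m.+1 * n)) : mxopnorm (fejmean F) <= mxopnorm F.
Proof.
have F0 := mxopnorm_ge0 F.
have := @blockbd_fejmean 1 m n (fun _ _ => F) (mxopnorm F).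
by rewrite !blockbd1 //; apply.
Qed.

Lemma fejmeanD m n (F G : 'M[C]_(m.+1 * n)) : fejmean (F + G) = fejmean F + fejmean G.
Proof. by rewrite /fejmean mulmxDr mulmxDl scalerDr. Qed.

Lemma fejmeanZ m n a (F : 'M[C]_(m.+1 * n)) : fejmean (a *: F) = a *: fejmean F.
Proof. by rewrite /fejmean -scalemxAr -scalemxAl !scalerA mulrC. Qed.

Lemma fejmeanB m n (F G : 'M[C]_(m.+1 * n)) : fejmean (F - G) = fejmean F - fejmean G.
Proof. by rewrite -scaleN1r fejmeanD fejmeanZ scaleN1r. Qed.

Lemma fejmean_peval m n (X : 'I_d -> 'M[C]_n) s :
  fejmean (peval (tpt (nshift R m.+1) X) s) = peval X (pmask (fejer R m) s).
Proof.
rewrite /peval big_map; elim: s => [|t s IH].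
  by rewrite !big_nil -(scale0r 0) fejmeanZ !scale0r.
rewrite !big_cons fejmeanD IH fejmeanZ; congr (_ + _) => /=.
by rewrite mon_tens fejmean_tens scalerA mulrC.
Qed.

Lemma tnilp_tpt_nshift m n (X : 'I_d -> 'M[C]_n) : tnilp (tpt (nshift R m) X) m.
Proof. by move=> w mw; rewrite mon_tens mxpow_nshift_nilp // tens0mx. Qed.

Context (H K : completeNormedModType C) (Q : 'I_d -> {linear H -> K}).
Hypothesis Qcont : forall j, continuous (Q j).

Lemma opball_nshift m X : opball Q X -> opball Q (tenspt (nshift R m.+1) X).
Proof.
move=> /(opballP Qcont)[r [r0 r1 hX]]; apply/(opballP Qcont).
apply: (@inball_tens _ _ _ _ _ m.+1 (lvl X) _ (coord X) r 1) => // [k|]; last by rewrite mul1r.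
by rewrite expr1n mul1r; exact: kapp_nshift.
Qed.

(** The weight c depends on X alone and serves for all m, whence a rate of convergence. *)
Lemma opball_bshift X : opball Q X -> exists2 c : R, 0 < c &
  forall m, opball Q (@tenspt R d (m + 1) (bshift m c) X).
Proof.
move=> /(opballP Qcont)[r [r0 r1 hX]]; exists ((1 - r) / 2) => [|m].
  by rewrite divr_gt0 // subr_gt0.
have c0 : 0 < (1 - r) / 2 by rewrite divr_gt0 // subr_gt0.
apply/(opballP Qcont).
apply: (@inball_tens _ _ _ _ _ (m.+1 + 1) (lvl X) _ (coord X) r (1 + (1 - r) / 2)) => // [k||].
- exact: kapp_bshift.
- by rewrite addr_ge0 // ltW.
(* Expanded, this is 2 - 3r + r^2 > 0, that is (1 + (1 - r)/2) r < 1. *)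
- have : 0 < (1 - r) * (2 - r) by rewrite mulr_gt0 // subr_gt0 // (lt_trans r1) // ltrDl.
  lra.
Qed.

(** The fixed vector y is c times the vector L u of the invariant block, plus l. Subtracting what A
    does to L u from what it does to y leaves an off-diagonal compression of A, between z of squared
    norm m+1 and the unit vector l. *)
Lemma sub_fejmean m n (c : R) (A : 'M[C]_((m.+1 + 1) * n)) (F : 'M[C]_n)
    (B : 'M[C]_(m.+1 * n)) :
  let u := ones R m.+1 in
  let z : 'cV[C]_(m.+1 + 1) := col_mx u 0 in
  let l : 'cV[C]_(m.+1 + 1) := col_mx 0 1%:M in
  let y : 'cV[C]_(m.+1 + 1) := col_mx (c%:C *: u) 1%:M in
  let L : 'M[C]_(m.+1 + 1, m.+1) := col_mx 1%:M 0 in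
  A *m colt n y = colt n y *m F ->
  A *m (L *t (1%:M : 'M_n)) = (L *t (1%:M : 'M_n)) *m B ->
  c%:C *: (F - fejmean B) = m.+1%:R^-1 *: ((colt n z)^T *m A *m colt n l).
Proof.
move=> u z l y L Ay AL.
have yE : y = L *m (c%:C *: u) + l.
  by rewrite mul_col_mx mul1mx mul0mx add_col_mx add0r addr0.
have -> : colt n l = colt n y - c%:C *: colt n (L *m u).
  by rewrite yE coltD -scalemxAr coltZ addrAC subrr add0r.
have -> : colt n (L *m u) = (L *t (1%:M : 'M_n)) *m colt n u.
  by rewrite tens_colt mulmx1.
have zL : (colt n z)^T *m (L *t (1%:M : 'M_n)) = (colt n u)^T.
  apply: trmx_inj; rewrite trmx_mul !trmxK trmx_tens tens_colt trmx1 mulmx1.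
  by rewrite tr_col_mx mul_row_col trmx1 trmx0 mul1mx mul0mx addr0.
have e2 : A *m (L *t (1%:M : 'M_n) *m colt n u) =
    L *t (1%:M : 'M_n) *m (B *m colt n u) by rewrite mulmxA AL -mulmxA.
rewrite -mulmxA mulmxBr Ay -scalemxAr e2 mulmxBr.
rewrite -scalemxAr [(colt n z)^T *m (L *t _ *m _)]mulmxA zL.
have zy : (colt n z)^T *m (colt n y *m F) = (c%:C * m.+1%:R) *: F.
  rewrite mulmxA; have -> : (colt n z)^T *m colt n y = (z^T *m y) 0 0 *: 1%:M.
    have := coltT_tens (1%:M) (1%:M : 'M[C]_n) z y.
    by rewrite tens11 !mulmx1.
  rewrite tr_col_mx trmx0 mul_row_col mul0mx addr0 -scalemxAr mxE.
  have -> : (u^T *m u) 0 0 = m.+1%:R.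
    by have := ones_nshift R m 0; rewrite /= mulmx1 subn0.
  by rewrite -scalemxAl mul1mx.
have fB : fejmean B = m.+1%:R^-1 *: ((colt n u)^T *m (B *m colt n u)).
  by rewrite /fejmean mulmxA.
have aux (F0 : fieldType) (W : lmodType F0) (a b : F0) (x w : W) : b != 0 ->
    a *: (x - b^-1 *: w) = b^-1 *: ((a * b) *: x - a *: w).
  by move=> b0; rewrite !scalerBr !scalerA mulrCA mulVf // mulr1 [b^-1 * a]mulrC.
by rewrite zy fB; apply: aux; rewrite pnatr_eq0.
Qed.

Section Approx.
Context (E : set (mxuniv R d)) (ncE : ncset Q E).

Lemma ncset_nshift m X : E X -> E (tenspt (nshift R m.+1) X).
Proof. by case: ncE => sE _ _ tE EX; apply: tE => //; exact/opball_nshift/sE. Qed.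

Lemma fejmean_cvg (f : gfun E) (M : R) : is_ncfun f ->
  (forall X hX, mxopnorm (f X hX) <= M) -> forall X (hX : E X),
  exists2 B : R, 0 <= B & forall m (hT : E (tenspt (nshift R m.+1) X)),
    mxopnorm (f X hX - @fejmean R m (lvl X) (f _ hT)) <= B / Num.sqrt m.+1%:R.
Proof.
move=> ncf fM X hX; case: (ncE) => sE _ _ tE.
have [c c0 hc] := opball_bshift (sE _ hX).
have M0 : 0 <= M by apply: le_trans (fM _ hX); exact: mxopnorm_ge0.
exists (M / c) => [|m hT]; first by rewrite divr_ge0 // ltW.
have hB := tE _ _ _ hX (hc m).
have m0 : 0 < m.+1%:R :> R by rewrite ltr0n.
set A := f _ hB; set n := lvl X; set u := ones R m.+1.
pose z : 'cV[C]_(m.+1 + 1) := col_mx u 0.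
pose l : 'cV[C]_(m.+1 + 1) := col_mx 0 1%:M.
pose y : 'cV[C]_(m.+1 + 1) := col_mx (c%:C *: u) 1%:M.
pose L : 'M[C]_(m.+1 + 1, m.+1) := col_mx 1%:M 0.
have Ay : A *m colt n y = colt n y *m f X hX.
  apply: (nc_intertwine ncE ncf) => j.
  by have := tens_colt (bshift m c) (coord X j) y; rewrite bshift_fix.
have AL : A *m (L *t (1%:M : 'M_n)) = (L *t (1%:M : 'M_n)) *m f _ hT.
  apply: (@nc_intertwine _ _ _ _ _ _ f ncE ncf _ _ hT hB (L *t (1%:M : 'M_n))) => j.
  have := tensmxM (bshift m c) (coord X j) L 1%:M.
  by rewrite bshift_top mulmx1 -{2}[coord X j]mul1mx -tensmxM.
have key := @sub_fejmean m n c A (f X hX) (f _ hT) Ay AL.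
have csqz : csq z = m.+1%:R.
  rewrite -csq_ones /csq big_split_ord /= big_ord1 col_mxEd mxE nsq0 addr0.
  by apply: eq_bigr => i _; rewrite col_mxEu.
have csql : csq l = 1.
  rewrite /csq big_split_ord /= big_ord1 col_mxEd big1 ?add0r => [|i _].
    by have := nsqR (1 : R); rewrite rmorph1 expr1n mxE eqxx.
  by rewrite col_mxEu mxE nsq0.
have m1 : nsq (m.+1%:R^-1 : C) = m.+1%:R ^- 2.
  by have := nsqR (m.+1%:R^-1 : R); rewrite rmorphV ?unitfE ?gt_eqF //= rmorph_nat exprVn.
apply/mxopnorm_leP => [|v]; first by rewrite !divr_ge0 ?sqrtr_ge0 // ltW.
rewrite -(ler_pM2l (exprn_gt0 2 c0)) -[c ^+ 2 in leLHS]nsqR -[leLHS]csqZ scalemxAl key.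
rewrite -scalemxAl csqZ m1 -!mulmxA.
apply: (@le_trans _ _ (m.+1%:R ^- 2 * (m.+1%:R * (M ^+ 2 * csq v)))).
  rewrite ler_wpM2l ?invr_ge0 ?exprn_ge0 ?ler0n //.
  apply: le_trans (csq_coltT _ _) _; rewrite csqz ler_wpM2l ?ler0n //.
  apply: le_trans ((mxopnorm_leP A M0).1 (fM _ hB) _) _.
  by rewrite -[csq v]mul1r -csql -csq_colt.
have s2 : Num.sqrt m.+1%:R ^+ 2 = m.+1%:R :> R by rewrite sqr_sqrtr // ltW.
rewrite !expr_div_n s2 le_eqVlt; apply/orP; left; apply/eqP; field.
by rewrite -natr1 addrC in m0; rewrite !gt_eqF.
Qed.

End Approx.

End Cesaro.

(** * Homogeneous ideals and their zero sets *)

Section HomogeneousIdeals.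
Context (R : realType) (d : nat).
Local Notation C := R[i].
Context (H K : completeNormedModType C) (Q : 'I_d -> {linear H -> K}).
Hypothesis Qcont : forall j, continuous (Q j).
Local Notation D := (opball Q).
Local Notation word := (seq 'I_d).
Local Notation poly := (seq (C * word)).

Lemma cvg0_eventually_cst (u : nat -> R) (a : R) m :
  u @ \oo --> (0 : R) -> (forall n, (m <= n)%N -> u n = a) -> a = 0.
Proof.
move=> /cvgrPdist_lt u0 ua; apply: contrapT => /eqP a0.
have : 0 < `|a| by rewrite normr_gt0.
move=> /u0[N _ hN]; have := hN (maxn N m) (leq_maxl _ _).
by rewrite /= ua ?leq_maxr // sub0r normrN ltxx.
Qed.

Lemma mxopnorm_eq0 m n (A : 'M[C]_(m, n)) : mxopnorm A = 0 -> A = 0.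
Proof.
move=> A0; apply/matrixP => i j; rewrite [RHS]mxE.
have := (mxopnorm_leP A (lexx 0)).1 _ (delta_mx j 0).
rewrite A0 lexx expr0n mul0r => /(_ isT) h.
have /colP/(_ i) : A *m delta_mx j (0 : 'I_1) = 0.
  by apply: csq_eq0; apply/le_anti; rewrite h csq_ge0.
rewrite mxE (bigD1 j) //= big1 ?addr0 => [|k kj]; last first.
  by rewrite mxE (negPf kj) mulr0.
by rewrite !mxE !eqxx mulr1.
Qed.

Definition hompoly (c : word -> C) n : poly := [seq (c (val w), val w) | w : n.-tuple 'I_d].

Lemma hompolyE c n (X : mxuniv R d) : hompart c n X = peval (coord X) (hompoly c n).
Proof.
rewrite /peval /hompoly big_map big_enum /=; apply: eq_bigr => w _.
by rewrite ncmonE.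
Qed.

Lemma size_hompoly c n t : t \in hompoly c n -> size t.2 = n.
Proof. by move=> /mapP[w _ ->] /=; rewrite size_tuple. Qed.

(** At a nilpotent point the partial sums are eventually constant, so the limit is attained. *)
Lemma power_series_nilp (E : set (mxuniv R d)) c (f : gfun E) X (hX : E X) m :
  power_series c f -> tnilp (coord X) m -> f X hX = \sum_(n < m) hompart c n X.
Proof.
move=> /(_ X hX) cf nX; apply/eqP; rewrite -subr_eq0; apply/eqP/mxopnorm_eq0.
apply: (@cvg0_eventually_cst _ _ m cf) => N mN; congr mxopnorm; congr (_ - _).
rewrite -!(big_mkord xpredT (fun n => hompart c n X)) (big_cat_nat (n := m)) //=.
rewrite [X in _ + X]big_nat_cond [X in _ + X]big1 ?addr0 // => n /andP[/andP[mn _] _].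
rewrite hompolyE /peval big_seq big1 // => t /size_hompoly tn.
by rewrite nX ?scaler0 // tn.
Qed.

Lemma power_series_vanish (E : set (mxuniv R d)) c (f : gfun E) X (hX : E X) :
  power_series c f -> (forall n, hompart c n X = 0) -> f X hX = 0.
Proof.
move=> /(_ X hX) cf c0; apply/mxopnorm_eq0.
apply: (@cvg0_eventually_cst _ _ 0 cf) => N _; congr mxopnorm.
by rewrite big1 ?subr0.
Qed.

Definition pfun (E : set (mxuniv R d)) (s : poly) : gfun E :=
  fun X _ => peval (coord X) s.

Definition coordfun (E : set (mxuniv R d)) j : gfun E := fun X _ => coord X j.

Definition homideal (J : set (gfun D)) : Prop :=
  [/\ J 0, forall a f g, J f -> J g -> J (a *: f + g),
      forall j f, J f -> J (@coordfun D j * f),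
      forall j f, J f -> J (f * @coordfun D j) &
      forall f, J f -> exists2 c, power_series c f & forall n, J (pfun (hompoly c n))].

Lemma homideal0 : homideal [set 0].
Proof.
split=> //= [a f g -> ->|j f ->|j f ->|f ->].
- by rewrite scaler0 addr0.
- by rewrite mulr0.
- by rewrite mul0r.
exists (fun=> 0) => [X hX|n].
  rewrite (_ : (fun m => _) = (fun=> 0)); first exact: cvg_cst.
  apply: funext => m; rewrite big1 => [|n _]; first by rewrite subr0 mxopnorm0.
  by rewrite /hompart big1 // => w _; rewrite scale0r.
by apply: gfunP => X hX; rewrite /pfun -hompolyE /hompart big1 // => w _; rewrite scale0r.
Qed.

Section Ideal.
Context (J : set (gfun D)) (JP : homideal J).

(** The block of the tensor factor in the last row and first column; among the powers of the shift
    only the m-th has it nonzero. *)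
Definition extract m n (F : 'M[C]_(m.+1 * n)) : 'M[C]_n :=
  (colt n (delta_mx ord_max 0))^T *m F *m colt n (delta_mx ord0 0).

Lemma extract_tens m k n (B : 'M[C]_n) :
  extract (mxpow (nshift R m.+1) k *t B) = (m == k)%:R *: B.
Proof.
rewrite /extract coltT_tens; congr (_ *: _).
rewrite trmx_delta -rowE -colE !mxE mxpow_nshift add0n //.
Qed.

Lemma peval_tpt_extract m n (X : 'I_d -> 'M[C]_n) s :
  extract (peval (tpt (nshift R m.+1) X) s) = peval X (pmask (fun k => (m == k)%:R) s).
Proof.
rewrite /extract /peval mulmx_sumr mulmx_suml big_map; apply: eq_bigr => t _ /=.
rewrite -scalemxAr -scalemxAl mon_tens -/(extract _) extract_tens scalerA.
by rewrite mulrC.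
Qed.

Lemma pmask_hompoly n X phi c k :
  peval (n := n) X (pmask phi (hompoly c k)) = phi k *: peval X (hompoly c k).
Proof.
rewrite /peval big_map scaler_sumr big_seq [RHS]big_seq; apply: eq_bigr => t tk.
by rewrite (size_hompoly tk) scalerA.
Qed.

(** Homogeneity of J provides some power series, not the coefficients of s. The two are compared at
    a nilpotent point built from X, where both are finite sums, and [extract] isolates the degree
    n. *)
Lemma power_series_pfun c s : power_series c (@pfun D s) ->
  forall n (X : mxuniv R d), D X ->
  peval (coord X) (hompoly c n) = peval (coord X) (pmask (fun k => (n == k)%:R) s).
Proof.
move=> cs n X DX; have hT := opball_nshift Qcont n DX.
have := power_series_nilp hT cs (@tnilp_tpt_nshift R d n.+1 (lvl X) (coord X)).
rewrite /pfun => /(congr1 (@extract n (lvl X))).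
rewrite (peval_tpt_extract n (coord X) s) => ->.
rewrite /extract mulmx_sumr mulmx_suml (bigD1 ord_max) //= big1 ?addr0 => [|k kn].
  by rewrite hompolyE -/(extract _) peval_tpt_extract pmask_hompoly eqxx scale1r.
rewrite hompolyE -/(extract _) peval_tpt_extract pmask_hompoly.
by rewrite (_ : (n == k) = false) ?scale0r //; apply/negbTE; rewrite eq_sym; exact: kn.
Qed.

Lemma homideal_sum I (r : seq I) (F : I -> gfun D) :
  (forall i, J (F i)) -> J (\sum_(i <- r) F i).
Proof.
case: JP => J0 JD _ _ _ JF; elim: r => [|i r IH]; first by rewrite big_nil.
by rewrite big_cons -[F i]scale1r; exact: JD.
Qed.

Lemma homidealZ a f : J f -> J (a *: f).
Proof. by case: JP => J0 JD _ _ _ Jf; rewrite -[_ *: _]addr0; exact: JD. Qed.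

(** There are finitely many degrees in s, so the multiplier is a finite combination of homogeneous
    parts, and these lie in J. *)
Lemma homideal_mask phi s : J (pfun s) -> J (pfun (pmask phi s)).
Proof.
case: JP => J0 JD _ _ Jh /Jh[c cs cJ].
have bnd : exists N, forall t, t \in s -> (size t.2 < N)%N.
  exists (\max_(t <- s) size t.2).+1 => t ts; rewrite ltnS.
  exact: (@leq_bigmax_seq _ s xpredT (fun t => size t.2)).
have [N hN] := bnd.
suff -> : pfun (pmask phi s) = \sum_(n < N) phi n *: @pfun D (hompoly c n).
  by apply: homideal_sum => n; exact: homidealZ.
apply: gfunP => X hX.
have -> : (\sum_(n < N) phi n *: @pfun D (hompoly c n)) X hX =
    \sum_(n < N) phi n *: peval (coord X) (hompoly c n).
  by elim/big_ind2: _ => // f A g B <- <-.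
rewrite (eq_bigr (fun n : 'I_N => \sum_(t <- s)
    (phi n * (n == size t.2 :> nat)%:R * t.1) *: mon (coord X) t.2)).
  rewrite exchange_big /pfun /peval big_map big_seq [RHS]big_seq /=.
  apply: eq_bigr => t /hN tN; rewrite (bigD1 (Ordinal tN)) //= eqxx mulr1.
  rewrite big1 ?addr0 // => n nt.
  rewrite (_ : (_ == _) = false) ?mulr0 ?mul0r ?scale0r //.
  by apply/negbTE; exact: nt.
move=> n _; rewrite (power_series_pfun cs) // /peval big_map scaler_sumr.
by apply: eq_bigr => t _ /=; rewrite scalerA mulrA.
Qed.

Lemma homideal_lmul j s : J (pfun s) -> J (pfun (plmul j s)).
Proof.
case: JP => _ _ Jl _ _ Js.
suff -> : @pfun D (plmul j s) = @coordfun D j * pfun s by exact: Jl.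
by apply: gfunP => X hX; rewrite /pfun peval_lmul.
Qed.

Lemma homideal_rmul w s : J (pfun s) -> J (pfun (prmul w s)).
Proof.
case: JP => _ _ _ Jr _ Js; elim/last_ind: w => [|w j IH].
  suff -> : @pfun D (prmul [::] s) = pfun s by [].
  by apply: gfunP => X hX; rewrite /pfun peval_rmul mulmx1.
suff -> : @pfun D (prmul (rcons w j) s) = pfun (prmul w s) * @coordfun D j by exact: Jr.
apply: gfunP => X hX; rewrite /pfun peval_rmul -cats1 mon_cat mulmxA -peval_rmul /=.
by rewrite mulmx1.
Qed.

Section ZeroSet.
Context (E : set (mxuniv R d)).
Hypothesis hE : forall X, E X <-> D X /\ forall f, J f -> forall hX, f X hX = 0.

(** The homogeneous parts of an element of J are polynomials in J, and a power series vanishes where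
    all its parts do. *)
Lemma zerosetP X : E X <-> D X /\ forall s, J (pfun s) -> peval (coord X) s = 0.
Proof.
rewrite hE; split=> -[DX h]; split=> //; first by move=> s /h /(_ DX).
move=> f Jf hX.
case: JP => _ _ _ _ /(_ f Jf)[c cf cJ].
by apply: (power_series_vanish hX cf) => n; rewrite hompolyE; exact: h.
Qed.

Lemma peval_dsum m n (X : 'I_d -> 'M[C]_m) (Y : 'I_d -> 'M[C]_n) s :
  peval (fun j => block_mx (X j) 0 0 (Y j)) s = block_mx (peval X s) 0 0 (peval Y s).
Proof.
have mE w : mon (fun j => block_mx (X j) 0 0 (Y j)) w = block_mx (mon X w) 0 0 (mon Y w).
  elim: w => [|j w IH] /=; first by rewrite -scalar_mx_block.
  by rewrite IH mulmx_block !mulmx0 !mul0mx !addr0 !add0r.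
rewrite /peval; elim: s => [|t s IH]; first by rewrite !big_nil block_mx0.
by rewrite !big_cons IH mE scale_block_mx !scaler0 add_block_mx !addr0.
Qed.

Lemma zeroset_ncset : ncset Q E.
Proof.
split.
- by move=> X /zerosetP[].
- move=> X Y /zerosetP[DX hX] /zerosetP[DY hY]; apply/zerosetP; split.
    apply/(opballP Qcont).
    by apply: (@inball_dsum _ _ _ _ _ (lvl X) (lvl Y)); apply/(opballP Qcont).
  move=> s Js; have := peval_dsum (coord X) (coord Y) s.
  by rewrite hX // hY // block_mx0.
- move=> X S uS /zerosetP[DX hX] DS; apply/zerosetP; split=> // s Js.
  have := @peval_intertwine R d _ _ (coord X) (coord (simpt S)) S _ s.
  rewrite hX // mul0mx => h.
  have : S *m peval (coord (simpt S)) s = 0.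
    rewrite -h // => j; apply: esym.
    have : S *m (invmx S *m coord X j *m S) = coord X j *m S by rewrite -mulmxA mulKVmx.
    exact.
  by move=> /(congr1 (mulmx (invmx S))); rewrite mulKmx // mulmx0.
move=> m T X /zerosetP[DX hX] DT; apply/zerosetP; split=> // s Js.
have bnd : exists N, forall t, t \in s -> (size t.2 < N)%N.
  exists (\max_(t <- s) size t.2).+1 => t ts; rewrite ltnS.
  exact: (@leq_bigmax_seq _ s xpredT (fun t => size t.2)).
have [N hN] := bnd.
(* A polynomial at T (x) X is the sum over n of T^n tensored with its part of degree n at X, and
   each part lies in J. *)
transitivity (\sum_(n < N) mxpow T n *t
    peval (coord X) (pmask (fun k => (n == k :> nat)%:R) s)); last first.
  by rewrite big1 // => n _; rewrite hX ?tensmx0 //; exact: homideal_mask.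
rewrite (eq_bigr (fun n : 'I_N => \sum_(t <- s) ((n == size t.2 :> nat)%:R * t.1) *:
    (mxpow T n *t mon (coord X) t.2))).
  rewrite exchange_big /peval big_seq [RHS]big_seq /=.
  apply: eq_bigr => t /hN tN; rewrite (bigD1 (Ordinal tN)) //= eqxx mul1r.
  rewrite big1 ?addr0 => [|n nt]; first by rewrite (mon_tens T (coord X)).
  rewrite (_ : (_ == _) = false) ?mul0r ?scale0r //.
  by apply/negbTE; exact: nt.
move=> n _; rewrite /peval big_map; elim: s {Js hN bnd} => [|t s IH].
  by rewrite !big_nil tensmx0.
rewrite !big_cons -IH; apply/matrixP => i j.
by rewrite !mxE /= mulrDr mulrCA.
Qed.

End ZeroSet.

End Ideal.

End HomogeneousIdeals.

(** * The universal nilpotent point *)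

Section Model.
Context (R : realType) (d : nat).
Local Notation C := R[i].
Context (H K : completeNormedModType C) (Q : 'I_d -> {linear H -> K}).
Hypothesis Qcont : forall j, continuous (Q j).
Local Notation D := (opball Q).
Local Notation word := (seq 'I_d).
Local Notation poly := (seq (C * word)).
Context (m k : nat).

Local Notation idx := ({bseq m of 'I_d} * 'I_k)%type.
Local Notation N := #|{: idx}|.

Let wd (a : 'I_N) : word := val (enum_val a).1.
Let cp (a : 'I_N) : 'I_k := (enum_val a).2.

(** Rows of length N stand for k-tuples of polynomials of degree at most m; [dl w i] is the monomial
    w in component i. It is 0 for a longer w, which makes truncation automatic. *)
Let dl (w : word) (i : 'I_k) : 'rV[C]_N := \row_a ((wd a == w) && (cp a == i))%:R.

Let rowpoly (c : 'rV[C]_N) (i : 'I_k) : poly :=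
  [seq (c 0 a * (cp a == i)%:R, wd a) | a <- enum 'I_N].

Let dl_big w i : (m < size w)%N -> dl w i = 0.
Proof.
move=> mw; apply/rowP => a; rewrite !mxE.
rewrite (_ : wd a == w = false) //; apply/negbTE/eqP => aw.
by have := size_bseq (enum_val a).1; rewrite -/(wd a) aw leqNgt mw.
Qed.

Let dl_sum (V : lmodType C) (F : word -> 'I_k -> V) w i : (size w <= m)%N ->
  \sum_a dl w i 0 a *: F (wd a) (cp a) = F w i.
Proof.
move=> wm; pose x : idx := (Bseq wm, i).
have wx : wd (enum_rank x) = w by rewrite /wd enum_rankK.
have cx : cp (enum_rank x) = i by rewrite /cp enum_rankK.
rewrite (bigD1 (enum_rank x)) //= big1 ?addr0 => [|a ax].
  by rewrite mxE wx cx !eqxx scale1r.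
rewrite mxE (_ : (_ && _) = false) ?scale0r //; apply/negbTE.
apply: contra ax => /andP[/eqP aw /eqP ai]; apply/eqP/(can_inj enum_valK).
rewrite enum_rankK /x; move: aw ai; rewrite /wd /cp.
by case: (enum_val a) => u j /= uw ->; congr (_, _); apply: val_inj.
Qed.

Let row_dl (c : 'rV[C]_N) : c = \sum_a c 0 a *: dl (wd a) (cp a).
Proof.
rewrite {1}[c]row_sum_delta; apply: eq_bigr => a _; congr (_ *: _).
apply/rowP => b; rewrite !mxE eqxx /=; congr (nat_of_bool _)%:R.
apply/eqP/andP => [->|[/eqP ab /eqP ib]]; first by rewrite !eqxx.
apply/(can_inj enum_valK); move: ab ib; rewrite /wd /cp.
by case: (enum_val b) => ? ?; case: (enum_val a) => ? ? /= /val_inj -> ->.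
Qed.

Let rowpolyE n (X : 'I_d -> 'M[C]_n) c i :
  peval X (rowpoly c i) = \sum_a c 0 a *: ((cp a == i)%:R *: mon X (wd a)).
Proof.
rewrite /peval big_map big_enum /=; apply: eq_bigr => a _.
by rewrite scalerA.
Qed.

Let rowpolyP n (X : 'I_d -> 'M[C]_n) b c c' i :
  peval X (rowpoly (b *: c + c') i) = b *: peval X (rowpoly c i) + peval X (rowpoly c' i).
Proof.
rewrite !rowpolyE scaler_sumr -big_split; apply: eq_bigr => a _ /=.
by rewrite !mxE scalerDl !scalerA.
Qed.

Let rowpoly0 n (X : 'I_d -> 'M[C]_n) i : peval X (rowpoly 0 i) = 0.
Proof. by rewrite rowpolyE big1 // => a _; rewrite mxE scale0r. Qed.

Let rowpoly_dl n (X : 'I_d -> 'M[C]_n) w i i' :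
  peval X (rowpoly (dl w i) i') = ((size w <= m)%N%:R * (i == i')%:R) *: mon X w.
Proof.
rewrite rowpolyE; case: leqP => wm; last first.
  by rewrite mul0r scale0r dl_big // big1 // => a _; rewrite mxE scale0r.
by rewrite (dl_sum (fun w i => (i == i')%:R *: mon X w)) // mul1r.
Qed.

Let rowpoly_comb n (X : 'I_d -> 'M[C]_n) T (l : seq T) (b : T -> C) w i i' :
  peval X (rowpoly (\sum_(x <- l) b x *: dl (w x) (i x)) i') =
  \sum_(x <- l) (b x * ((size (w x) <= m)%N%:R * (i x == i')%:R)) *: mon X (w x).
Proof.
elim: l => [|x l IH]; first by rewrite !big_nil rowpoly0.
by rewrite !big_cons rowpolyP IH rowpoly_dl scalerA.
Qed.

Context (J : set (gfun D)) (JP : homideal J).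

Let P : set 'rV[C]_N := [set c | forall i, J (pfun (rowpoly c i))].

Let P0 : P 0.
Proof.
move=> i; suff -> : @pfun R d D (rowpoly 0 i) = 0 by case: JP.
by apply: gfunP => X hX; rewrite /pfun rowpoly0.
Qed.

Let PD b c c' : P c -> P c' -> P (b *: c + c').
Proof.
move=> Pc Pc' i; suff -> : @pfun R d D (rowpoly (b *: c + c') i) =
  b *: @pfun R d D (rowpoly c i) + pfun (rowpoly c' i) by case: JP => _ JD _ _ _; apply: JD.
by apply: gfunP => X hX; rewrite /pfun rowpolyP.
Qed.

(** Left multiplication by the j-th coordinate on rows, truncated above degree m. *)
Let sh j : 'M[C]_N := \matrix_a dl (j :: wd a) (cp a).

Let dl_sh w i j : dl w i *m sh j = dl (j :: w) i.
Proof.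
case: (leqP (size w) m) => wm; last by rewrite !dl_big ?mul0mx //= ltnW.
rewrite mulmx_sum_row -[RHS](dl_sum (fun w i => dl (j :: w) i)) //.
by apply: eq_bigr => a _; rewrite rowK.
Qed.

Let P_sh c j : P c -> P (c *m sh j).
Proof.
move=> Pc i; rewrite mulmx_sum_row.
suff -> : @pfun R d D (rowpoly (\sum_a c 0 a *: row a (sh j)) i) =
    pfun (pmask (fun n => (n <= m)%N%:R) (plmul j (rowpoly c i))).
  by apply: (homideal_mask Qcont JP); exact: homideal_lmul.
apply: gfunP => X hX; rewrite /pfun.
rewrite (eq_bigr (fun a => c 0 a *: dl (j :: wd a) (cp a))) => [|a _]; last by rewrite rowK.
rewrite rowpoly_comb /peval 3!big_map big_enum /=; apply: eq_bigr => a _.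
by rewrite mulrCA.
Qed.

Context (E : set (mxuniv R d)).
Hypothesis hE : forall X, E X <-> D X /\ forall f, J f -> forall hX, f X hX = 0.

(* [C^(r+1)] is the space of k-tuples of polynomials of degree at most [m]
   modulo the tuples with entries in [J], [Y] is left multiplication by the
   coordinates, and [e i] is the class of the i-th unit vector. *)
Lemma universal_model : (exists X, E X) -> (0 < k)%N ->
  exists r (Y : 'I_d -> 'M[C]_r.+1) (e : 'I_k -> 'cV[C]_r.+1),
  [/\ tnilp Y m.+1,
      forall v, exists p : 'I_k -> poly, v = \sum_i peval Y (p i) *m e i,
      forall s, J (pfun s) -> peval Y s = 0,
      forall p : 'I_k -> poly, (forall i t, t \in p i -> (size t.2 <= m)%N) ->
        \sum_i peval Y (p i) *m e i = 0 -> forall i, J (pfun (p i)) &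
      forall q (Z : 'I_d -> 'M[C]_q) (v : 'I_k -> 'cV[C]_q), tnilp Z m.+1 ->
        (forall s, J (pfun s) -> peval Z s = 0) ->
        exists L : 'M[C]_(q, r.+1),
          (forall j, Z j *m L = L *m Y j) /\ forall i, L *m e i = v i].
Proof.
move=> [X0 EX0] k0.
have [p [M [PM sM]]] := spanning_matrix P0.
have PMP c : (c <= M)%MS -> P c.
  move=> /submxP[B ->]; rewrite mulmx_sum_row.
  elim: (index_enum _) => [|i l IH]; first by rewrite big_nil.
  by rewrite big_cons; apply: PD.
(* In coordinates, [pi0] is the quotient map modulo P: its kernel is P, and being surjective it has
   a section [si0]. *)
pose pi0 := col_base (cokermx M).
have cE c : c *m cokermx M = c *m pi0 *m row_base (cokermx M).
  by rewrite -mulmxA mulmx_base.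
have pi0P c : c *m pi0 = 0 <-> P c.
  split=> [c0|/sM]; first by apply: PMP; rewrite submxE cE c0 mul0mx.
  rewrite submxE cE => /eqP h.
  by apply: (row_free_inj (row_base_free (cokermx M))); rewrite /= h mul0mx.
have /row_fullP[si0 siP0] : row_full pi0 by exact: col_base_full.
clear cE; move: (\rank _) pi0 pi0P si0 siP0 => [|r] pi piP si siP.
  (* If the quotient were zero, the constant 1 would belong to J, which the point X0 of E
     forbids. *)
  have [DX0 h] := (zerosetP JP hE X0).1 EX0.
  have Pd : P (dl [::] (Ordinal k0)) by apply/piP; apply/matrixP => ? [].
  have := h _ (Pd (Ordinal k0)); rewrite rowpoly_dl /= ?eqxx !mulr1 scale1r.
  by move=> /matrixP/(_ ord0 ord0)/eqP; rewrite !mxE eqxx oner_eq0.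
pose Phi (c : 'rV[C]_N) : 'cV[C]_r.+1 := (c *m pi)^T.
pose Y j : 'M[C]_r.+1 := (si *m sh j *m pi)^T.
pose e i := Phi (dl [::] i).
have PhiP b c c' : Phi (b *: c + c') = b *: Phi c + Phi c'.
  by rewrite /Phi mulmxDl -scalemxAl linearD linearZ.
have Phi0 : Phi 0 = 0 by rewrite /Phi mul0mx trmx0.
have Phi_comb T (l : seq T) (b : T -> C) (c : T -> 'rV_N) :
    Phi (\sum_(x <- l) b x *: c x) = \sum_(x <- l) b x *: Phi (c x).
  by elim: l => [|x l IH]; rewrite ?big_nil // !big_cons PhiP IH.
have PhiK c : Phi c = 0 <-> P c.
  rewrite -piP /Phi; split=> [/(congr1 trmx)|->]; last by rewrite trmx0.
  by rewrite trmxK trmx0.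
have Phi_surj v : v = Phi (v^T *m si) by rewrite /Phi -mulmxA siP mulmx1 trmxK.
have sec c : P (c - c *m pi *m si).
  by apply/piP; rewrite mulmxBl -[_ *m si *m pi]mulmxA siP mulmx1 subrr.
have YPhi j c : Y j *m Phi c = Phi (c *m sh j).
  apply: trmx_inj; rewrite trmx_mul !trmxK.
  have /piP/eqP := P_sh j (sec c); rewrite mulmxBl mulmxBl subr_eq0 => /eqP ->.
  by rewrite !mulmxA.
have monPhi w w' i : mon Y w *m Phi (dl w' i) = Phi (dl (w ++ w') i).
  by elim: w => [|j w IH] /=; rewrite ?mul1mx // -mulmxA IH YPhi dl_sh.
have pevalPhi s w i : peval Y s *m Phi (dl w i) =
    Phi (\sum_(t <- s) t.1 *: dl (t.2 ++ w) i).
  rewrite Phi_comb mulmx_suml; apply: eq_bigr => t _.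
  by rewrite -scalemxAl monPhi.
have zero_dl q (A : 'M[C]_(q, r.+1)) : (forall w i, A *m Phi (dl w i) = 0) -> A = 0.
  move=> h; apply/matrixP => a b.
  have -> : A a b = (A *m delta_mx b (0 : 'I_1)) a 0 by rewrite -colE mxE.
  rewrite [delta_mx b _]Phi_surj [_ *m si]row_dl Phi_comb mulmx_sumr big1 ?mxE // => x _.
  by rewrite -scalemxAr h scaler0.
exists r, Y, e; split.
- move=> w mw; apply: zero_dl => w' i.
  by rewrite monPhi dl_big // size_cat (leq_trans mw) // leq_addr.
- move=> v; exists (rowpoly (v^T *m si)).
  rewrite {1}[v]Phi_surj {1}[_ *m si]row_dl Phi_comb.
  under [RHS]eq_bigr do rewrite rowpolyE mulmx_suml.
  rewrite exchange_big /=; apply: eq_bigr => a _.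
  rewrite (bigD1 (cp a)) //= eqxx scale1r -scalemxAl monPhi cats0.
  rewrite big1 ?addr0 // => i ia; rewrite eq_sym (negPf ia) scale0r.
  by rewrite scaler0 mul0mx.
- move=> s Js; apply: zero_dl => w i; rewrite pevalPhi; apply/PhiK => i'.
  suff -> : @pfun R d D (rowpoly (\sum_(t <- s) t.1 *: dl (t.2 ++ w) i) i') =
      (i == i')%:R *: @pfun R d D (pmask (fun n => (n <= m)%N%:R) (prmul w s)).
    apply: (homidealZ JP); apply: (homideal_mask Qcont JP).
    exact: homideal_rmul.
  apply: gfunP => X hX; rewrite /pfun rowpoly_comb.
  transitivity ((i == i')%:R *: peval (coord X) (pmask (fun n => (n <= m)%N%:R) (prmul w s)));
    last by [].
  rewrite /peval !big_map scaler_sumr.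
  by apply: eq_bigr => t _ /=; rewrite scalerA; congr (_ *: _); ring.
- move=> q hq; rewrite (eq_bigr (fun i => Phi (\sum_(t <- q i) t.1 *: dl t.2 i))); last first.
    move=> i _; rewrite pevalPhi; congr Phi; apply: eq_bigr => t _.
    by rewrite cats0.
  pose b i := \sum_(t <- q i) t.1 *: dl t.2 i.
  have <- : Phi (\sum_i 1 *: b i) = \sum_i Phi (b i).
    by rewrite Phi_comb; apply: eq_bigr => i _; rewrite scale1r.
  move=> /PhiK h i; have := h i.
  suff -> : @pfun R d D (rowpoly (\sum_i 1 *: b i) i) = pfun (q i) by [].
  apply: gfunP => X hX; rewrite /pfun.
  have -> : peval (coord X) (rowpoly (\sum_i 1 *: b i) i) =
      \sum_i' peval (coord X) (rowpoly (b i') i).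
    elim: (index_enum _) => [|x l IH]; first by rewrite !big_nil rowpoly0.
    by rewrite !big_cons rowpolyP IH scale1r.
  rewrite (bigD1 i) //= big1 ?addr0 => [|i' ii'].
    rewrite rowpoly_comb /peval big_seq [RHS]big_seq; apply: eq_bigr => t /hq tm.
    by rewrite tm eqxx !mulr1.
  rewrite rowpoly_comb big1 // => t _.
  by rewrite (negPf ii') !mulr0 scale0r.
move=> q Z v nZ JZ.
(* [Lr] sends a tuple of polynomials p_i to the sum of the p_i(Z) v_i; it kills P and therefore
   descends along the section to L. *)
pose Lr : 'M[C]_(N, q) := \matrix_a (mon Z (wd a) *m v (cp a))^T.
have LrP c : P c -> c *m Lr = 0.
  move=> Pc; apply: trmx_inj; rewrite trmx0 mulmx_sum_row raddf_sum /=.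
  transitivity (\sum_i peval Z (rowpoly c i) *m v i); last first.
    by rewrite big1 // => i _; rewrite JZ ?mul0mx //; exact: Pc.
  under [RHS]eq_bigr do rewrite rowpolyE mulmx_suml.
  rewrite exchange_big /=; apply: eq_bigr => a _.
  rewrite rowK linearZ /= trmxK (bigD1 (cp a)) //= eqxx scale1r -scalemxAl.
  rewrite big1 ?addr0 // => i ia; rewrite eq_sym (negPf ia) scale0r.
  by rewrite scaler0 mul0mx.
pose L := (si *m Lr)^T.
have LPhi c : L *m Phi c = (c *m Lr)^T.
  apply: trmx_inj; rewrite trmx_mul !trmxK.
  have /eqP := LrP _ (sec c); rewrite mulmxBl subr_eq0 => /eqP ->.
  by rewrite !mulmxA.
have Ldl w i : L *m Phi (dl w i) = mon Z w *m v i.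
  rewrite LPhi; case: (leqP (size w) m) => wm; last by rewrite dl_big // nZ // !mul0mx trmx0.
  rewrite mulmx_sum_row -[RHS]trmxK; congr (_^T).
  rewrite -[RHS](dl_sum (fun w i => (mon Z w *m v i)^T)) //.
  by apply: eq_bigr => a _; rewrite rowK.
exists L; split=> [j|i]; last by rewrite Ldl mul1mx.
apply/eqP; rewrite -subr_eq0; apply/eqP/zero_dl => w i.
by rewrite mulmxBl -!mulmxA YPhi dl_sh !Ldl mulmxA subrr.
Qed.

End Model.

(** * Positive definite forms and similarity into the ball *)

Section Forms.
Context (R : realType).
Local Notation C := R[i].
Local Open Scope sesquilinear_scope.

Lemma ReD (x y : C) : complex.Re (x + y) = complex.Re x + complex.Re y.
Proof. by case: x y => [? ?] [? ?]. Qed.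

Lemma ReZ (a : R) (x : C) : complex.Re (a%:C * x) = a * complex.Re x.
Proof. by case: x => [? ?] /=; rewrite mul0r subr0. Qed.

Lemma Re_sum I (r : seq I) (F : I -> C) :
  complex.Re (\sum_(i <- r) F i) = \sum_(i <- r) complex.Re (F i).
Proof. by elim: r => [|i r IH]; rewrite ?big_nil // !big_cons ReD IH. Qed.

Lemma conjC_real (a : R) : Num.conj a%:C = a%:C :> C.
Proof. by apply/CrealP/complex_realP; exists a. Qed.

Definition hf n (G : 'M[C]_n) (v : 'cV[C]_n) : R := complex.Re ((v ^t* *m G *m v) 0 0).

Lemma hfS m n (S : 'M[C]_(m, n)) v : hf (S ^t* *m S) v = csq (S *m v).
Proof.
rewrite /hf !mulmxA -mulmxA.
have -> : v ^t* *m S ^t* = (S *m v) ^t* by rewrite trmx_mul map_mxM.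
rewrite mxE Re_sum; apply: eq_bigr => i _.
have -> : ((S *m v) ^t*) 0 i = Num.conj ((S *m v) i 0) by rewrite mxE [X in Num.conj X]mxE.
by rewrite mulrC -nsqC.
Qed.

Lemma hf1 n (v : 'cV[C]_n) : hf 1%:M v = csq v.
Proof. by have := hfS (1%:M : 'M[C]_n) v; rewrite trmx1 map_mx1 !mul1mx. Qed.

Lemma psd_sqrt n (G : 'M[C]_n) : G ^t* = G -> (forall v, v != 0 -> 0 < hf G v) ->
  exists2 S : 'M[C]_n, S \in unitmx & G = S ^t* *m S.
Proof.
move=> Gh Gp.
have Gs : G \is hermsymmx.
  by apply/is_hermitianmxP; rewrite expr0 scale1r Gh.
have /orthomx_spectralP := hermitian_normalmx Gs.
set P := spectralmx G; set s := spectral_diag G => GE.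
have uP : P \is unitarymx := spectral_unitarymx G.
have Pu : P \in unitmx := unitarymx_unit uP.
have iP : invmx P = P ^t* := invmx_unitary uP.
have sr := hermitian_spectral_diag_real Gs.
have sp i : 0 < s 0 i.
  have [v Pv] : exists v : 'cV[C]_n, P *m v = delta_mx i 0.
    by exists (invmx P *m delta_mx i 0); rewrite mulKVmx.
  have v0 : v != 0.
    apply/eqP => v0; move: Pv; rewrite v0 mulmx0 => /colP/(_ i)/eqP.
    by rewrite !mxE !eqxx eq_sym oner_eq0.
  have := Gp v v0; rewrite /hf GE iP.
  have -> : v ^t* *m (P ^t* *m diag_mx s *m P) *m v =
      (P *m v) ^t* *m diag_mx s *m (P *m v).
    by rewrite (trmx_mul P v) map_mxM !mulmxA.
  rewrite Pv trmx_delta map_delta_mx -rowE -colE !mxE eqxx mulr1n => s0.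
  have /mxOverP/(_ 0 i)/complex_realP[x sx] := sr.
  by move: s0; rewrite -/s sx ltcE /= eqxx.
exists (diag_mx (\row_i sqrtC (s 0 i)) *m P).
  rewrite unitmx_mul Pu andbT unitmxE det_diag unitfE prodf_seq_neq0.
  by apply/allP => i _ /=; rewrite mxE sqrtC_eq0 gt_eqF.
rewrite {1}GE iP trmx_mul map_mxM -!mulmxA; congr (_ *m _).
rewrite !mulmxA; congr (_ *m _); rewrite tr_diag_mx map_diag_mx mulmx_diag.
congr diag_mx; apply/rowP => i; rewrite !mxE /=.
have : 0 <= sqrtC (s 0 i) by rewrite sqrtC_ge0 ltW.
by move=> /ger0_real/CrealP /= ->; rewrite -expr2 sqrtCK.
Qed.

Section Gf.
Context (E : completeNormedModType C) (ip : E -> E -> C).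
Hypothesis ipP : inner ip.
Hypothesis ipE : forall u, ipq ip u = nsq u.

(** The conjugate makes up for [ip] being linear on the left, so that [S ^t* *m S] yields the
    squared norm of S x. *)
Definition gf n (G : 'M[C]_n) (x : 'I_n -> E) : R :=
  complex.Re (\sum_a \sum_b Num.conj (G a b) * ip (x a) (x b)).

Lemma gfD n (F G : 'M[C]_n) x : gf (F + G) x = gf F x + gf G x.
Proof.
rewrite /gf -ReD -big_split; congr complex.Re; apply: eq_bigr => a _ /=.
by rewrite -big_split; apply: eq_bigr => b _ /=; rewrite mxE rmorphD mulrDl.
Qed.

Lemma gfZ n (a : R) (G : 'M[C]_n) x : gf (a%:C *: G) x = a * gf G x.
Proof.
rewrite /gf -ReZ mulr_sumr; congr complex.Re; apply: eq_bigr => b _ /=.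
rewrite mulr_sumr; apply: eq_bigr => c _.
by rewrite mxE rmorphM /= conjC_real mulrA.
Qed.

Lemma gf_sum n I (r : seq I) (G : I -> 'M[C]_n) x :
  gf (\sum_(i <- r) G i) x = \sum_(i <- r) gf (G i) x.
Proof.
elim: r => [|i r IH]; last by rewrite !big_cons gfD IH.
by rewrite !big_nil -(scale0r 0) -[0 in LHS]/(0%:C) gfZ mul0r.
Qed.

Lemma gfJ m n (A : 'M[C]_(m, n)) (G : 'M[C]_m) x :
  gf (A ^t* *m G *m A) x = gf G (kapp A x).
Proof.
rewrite /gf; congr complex.Re.
transitivity (\sum_c \sum_e \sum_a \sum_b
    Num.conj (G c e) * (A c a * Num.conj (A e b) * ip (x a) (x b))); last first.
  apply: eq_bigr => c _; apply: eq_bigr => e _.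
  rewrite /kapp (ip_suml ipP) mulr_sumr; apply: eq_bigr => a _.
  rewrite (ip_sumr ipP) mulr_sumr; apply: eq_bigr => b _.
  by rewrite (ipZl ipP) (ipZr ipP) !mulrA.
rewrite [RHS](eq_bigr (fun c => \sum_a \sum_b \sum_e
    Num.conj (G c e) * (A c a * Num.conj (A e b) * ip (x a) (x b)))); last first.
  by move=> c _; rewrite exchange_big; apply: eq_bigr => a _; exact: exchange_big.
rewrite [RHS]exchange_big; apply: eq_bigr => a _; rewrite [RHS]exchange_big.
apply: eq_bigr => b _; rewrite [RHS]exchange_big /= mxE rmorph_sum mulr_suml.
apply: eq_bigr => e _; rewrite mxE rmorphM rmorph_sum !mulr_suml.
apply: eq_bigr => c _ /=.
by rewrite rmorphM /= !mxE /= conjCK; ring.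
Qed.

Lemma gf1 n (x : 'I_n -> E) : gf 1%:M x = sqn x.
Proof.
rewrite /gf Re_sum; apply: eq_bigr => a _.
rewrite (bigD1 a) //= big1 ?addr0 => [|b ba].
  by rewrite mxE eqxx rmorph1 mul1r -ipE.
by rewrite mxE eq_sym (negPf ba) rmorph0 mul0r.
Qed.

Lemma gfS m n (S : 'M[C]_(m, n)) x : gf (S ^t* *m S) x = sqn (kapp S x).
Proof. by rewrite -gf1 -gfJ mulmx1. Qed.

Lemma gf_le n (G : 'M[C]_n) : exists2 M : R, 0 <= M & forall x, gf G x <= M * sqn x.
Proof.
pose c a b := nm (G a b).
have c0 a b : 0 <= c a b by exact: nm_ge0.
exists (\sum_a \sum_b c a b) => [|x]; first by do 2!apply: sumr_ge0 => ? _.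
rewrite /gf Re_sum mulr_suml; apply: ler_sum => a _.
rewrite Re_sum mulr_suml; apply: ler_sum => b _.
set z := _ * _.
have zr : complex.Re z <= nm z.
  rewrite -lecR nmE; apply: le_trans (normc_ge_Re z).
  by rewrite lecR ler_norm.
apply: le_trans zr _; rewrite -[z]/(_ *: (_ : C^o)) nmZ.
have -> : nm (Num.conj (G a b)) = c a b.
  by apply: complexI; rewrite !nmE norm_conjC.
rewrite ler_wpM2l // -(@ler_pXn2r _ 2) ?nnegrE ?nm_ge0 ?sqn_ge0 // -nsq_nm.
apply: le_trans (cauchy_schwarz ipP _ _) _; rewrite !ipE expr2.
have le1 d : nsq (x d) <= sqn x.
  by rewrite /sqn (bigD1 d) //= lerDl sumr_ge0 // => ? _; exact: nsq_ge0.
by rewrite ler_pM ?nsq_ge0.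
Qed.

End Gf.

Lemma kapp_mul (E : completeNormedModType C) p q n (A : 'M[C]_(p, q)) (B : 'M[C]_(q, n))
  (x : 'I_n -> E) : kapp A (kapp B x) = kapp (A *m B) x.
Proof.
apply: funext => i; rewrite /kapp.
under eq_bigr do rewrite scaler_sumr.
rewrite exchange_big; apply: eq_bigr => l _ /=.
by rewrite mxE scaler_suml; apply: eq_bigr => c _; rewrite scalerA.
Qed.

Lemma kapp1 (E : completeNormedModType C) n (x : 'I_n -> E) : kapp 1%:M x = x.
Proof.
apply: funext => i; rewrite /kapp (bigD1 i) //= mxE eqxx scale1r big1 ?addr0 // => j ji.
by rewrite mxE eq_sym (negPf ji) scale0r.
Qed.

End Forms.

(** * Similarity of nilpotent tuples to points of the ball *)

Section Scaling.
Context (R : realType) (d : nat).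
Local Notation C := R[i].
Context (H K : completeNormedModType C) (Q : 'I_d -> {linear H -> K}).
Hypothesis Qcont : forall j, continuous (Q j).
Local Open Scope sesquilinear_scope.
Context (ipH : H -> H -> C) (ipK : K -> K -> C).
Hypothesis ipHP : inner ipH.
Hypothesis ipKP : inner ipK.
Hypothesis ipHE : forall u, ipq ipH u = nsq u.
Hypothesis ipKE : forall u, ipq ipK u = nsq u.

Lemma qop_conj n (Y : 'I_d -> 'M[C]_n) (S T : 'M[C]_n) x :
  qop Q (fun j => S *m Y j *m T) x = kapp S (qop Q Y (kapp T x)).
Proof.
have qE (Z : 'I_d -> 'M[C]_n) y i : qop Q Z y i = \sum_j Q j (kapp (Z j) y i).
  apply: eq_bigr => j _; rewrite linear_sum; apply: eq_bigr => k _.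
  by rewrite linearZ.
have kE A (z : 'I_n -> H) j i : Q j (kapp A z i) = kapp A (fun a => Q j (z a)) i.
  by rewrite /kapp linear_sum; apply: eq_bigr => k _; rewrite linearZ.
apply: funext => i; rewrite qE.
under eq_bigr do rewrite -!kapp_mul kE.
rewrite /kapp exchange_big; apply: eq_bigr => a _ /=.
by rewrite -scaler_sumr qE.
Qed.

(** For the inner product of C^n defined by G the tuple Y is already in the ball; a square root S of
    G carries it to the standard inner product. *)
Lemma form_point n (Y : 'I_d -> 'M[C]_n) (G : 'M[C]_n) (r : R) :
  G ^t* = G -> (forall v, v != 0 -> 0 < hf G v) -> 0 <= r -> r < 1 ->
  (forall x, gf ipK G (qop Q Y x) <= r ^+ 2 * gf ipH G x) ->
  exists S : 'M[C]_n, [/\ S \in unitmx, G = S ^t* *m S &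
    inball Q (fun j => S *m Y j *m invmx S)].
Proof.
move=> Gh Gp r0 r1 hG; have [S uS GS] := psd_sqrt Gh Gp.
exists S; split=> //; exists r; split=> // v.
rewrite qop_conj -(gfS ipKP ipKE) -GS; apply: le_trans (hG _) _.
by rewrite GS (gfS ipHP ipHE) kapp_mul mulmxV // kapp1.
Qed.

(** The sum over the words w of length l of [(mon Y w) ^t* *m mon Y w]. *)
Fixpoint gramw n (Y : 'I_d -> 'M[C]_n) l : 'M[C]_n :=
  if l is l'.+1 then \sum_j (Y j) ^t* *m gramw Y l' *m Y j else 1%:M.

Lemma gramw_herm n (Y : 'I_d -> 'M[C]_n) l : (gramw Y l) ^t* = gramw Y l.
Proof.
elim: l => [|l IH] /=; first by rewrite trmx1 map_mx1.
rewrite raddf_sum map_mx_sum; apply: eq_bigr => j _ /=.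
by rewrite !trmx_mul !map_mxM IH mulmxA trmxCK.
Qed.

Lemma gramw_ge0 n (Y : 'I_d -> 'M[C]_n) l v : 0 <= hf (gramw Y l) v.
Proof.
elim: l v => [|l IH] v /=.
  by rewrite hf1 csq_ge0.
rewrite /hf mulmx_sumr mulmx_suml summxE Re_sum; apply: sumr_ge0 => j _.
have := IH (Y j *m v); rewrite /hf.
by rewrite trmx_mul map_mxM !mulmxA.
Qed.

Lemma gramw_gf_ge0 (E : completeNormedModType C) ip (ipP : inner ip)
    (ipE : forall u : E, ipq ip u = nsq u) n (Y : 'I_d -> 'M[C]_n) l x :
  0 <= gf ip (gramw Y l) x.
Proof.
elim: l x => [|l IH] x /=; first by rewrite gf1 // sqn_ge0.
by rewrite gf_sum; apply: sumr_ge0 => j _; rewrite gfJ.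
Qed.

Lemma gramw_nilp (E : completeNormedModType C) ip (ipP : inner ip)
    (ipE : forall u : E, ipq ip u = nsq u) n (Y : 'I_d -> 'M[C]_n) l x :
  (forall w, size w = l -> kapp (mon Y w) x = fun=> 0) -> gf ip (gramw Y l) x = 0.
Proof.
elim: l x => [|l IH] x h /=.
  rewrite gf1 //; have := h [::] erefl; rewrite kapp1 => ->.
  by rewrite /sqn big1 // => i _; rewrite nsq0.
rewrite gf_sum big1 // => j _; rewrite gfJ // IH // => w wl.
have := h (rcons w j); rewrite size_rcons wl => /(_ erefl).
by rewrite -cats1 mon_cat /= mulmx1 kapp_mul.
Qed.

(** The row operator with entries Q_j is the first component of [qop] at matrix units, whence its
    boundedness. *)
Lemma Q_sum_bounded : exists2 B : R, 0 <= B &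
  forall y : 'I_d -> H, nsq (\sum_j Q j (y j)) <= B * \sum_j nsq (y j).
Proof.
case: (posnP d) => [d0|dp].
  exists 0 => // y; rewrite mul0r big1 ?nsq0 // => j _.
  by have := ltn_ord j; rewrite [X in (_ < X)%N]d0.
pose i0 := Ordinal dp; pose X (j : 'I_d) : 'M[C]_d := delta_mx i0 j.
have [B B0 hB] := qop_bounded Qcont X; exists B => // y.
apply: le_trans (hB y); rewrite [leRHS]/sqn [leRHS](bigD1 i0) //=.
have -> : qop Q X y i0 = \sum_j Q j (y j).
  apply: eq_bigr => j _; rewrite (bigD1 j) //= big1 ?addr0 => [|k kj].
    by rewrite mxE !eqxx scale1r.
  by rewrite mxE (negPf kj) andbF scale0r.
by rewrite lerDl sumr_ge0 // => ? _; exact: nsq_ge0.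
Qed.

(** Applying Q(Y) uses one letter: the Gram form of length l becomes that of length l+1, at a cost B
    independent of Y and l. *)
Lemma gramw_qop : exists2 B : R, 0 <= B &
  forall n (Y : 'I_d -> 'M[C]_n) l x,
  gf ipK (gramw Y l) (qop Q Y x) <= B * gf ipH (gramw Y l.+1) x.
Proof.
have [B B0 hB] := Q_sum_bounded; exists B => // n Y l x.
(* The induction needs unrelated z_j; afterwards z_j is Y_j x. *)
have h (z : 'I_d -> 'I_n -> H) : gf ipK (gramw Y l) (fun i => \sum_j Q j (z j i)) <=
    B * \sum_j gf ipH (gramw Y l) (z j).
  elim: l z => [|l IH] z /=.
    rewrite gf1 // (eq_bigr (fun j => sqn (z j))) => [|j _]; last by rewrite gf1.
    rewrite /sqn exchange_big mulr_sumr; apply: ler_sum => i _; exact: hB.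
  rewrite gf_sum.
  have -> : \sum_j gf ipH (gramw Y l.+1) (z j) =
      \sum_k \sum_j gf ipH (gramw Y l) (kapp (Y k) (z j)).
    rewrite exchange_big; apply: eq_bigr => j _ /=; rewrite gf_sum.
    by apply: eq_bigr => k _; rewrite gfJ.
  rewrite mulr_sumr; apply: ler_sum => k _; rewrite gfJ //.
  apply: le_trans (IH (fun j => kapp (Y k) (z j))).
  rewrite le_eqVlt; apply/orP; left; apply/eqP; congr gf; apply: funext => i.
  rewrite /kapp; under eq_bigr do rewrite scaler_sumr.
  rewrite exchange_big; apply: eq_bigr => j _ /=.
  by rewrite linear_sum; apply: eq_bigr => a _; rewrite linearZ.
have := h (fun j => kapp (Y j) x).
rewrite /= gf_sum (eq_bigr (fun j => gf ipH ((Y j) ^t* *m gramw Y l *m Y j) x)) //.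
  apply: le_trans; rewrite le_eqVlt; apply/orP; left; apply/eqP; congr gf.
  apply: funext => i; apply: eq_bigr => j _; rewrite /kapp linear_sum.
  by apply: eq_bigr => a _; rewrite linearZ.
by move=> j _; rewrite gfJ.
Qed.

(** The Gram forms are summed with weights s^l. Q(Y) shifts l by one and so costs B/s, at most 1/4
    by the choice of s; nilpotence removes the term of length m+1 that would fall outside the sum,
    and the term of length 0 gives the lower bounds. *)
Lemma nilpotent_form n (Y : 'I_d -> 'M[C]_n) m : tnilp Y m.+1 ->
  exists G : 'M[C]_n, [/\ G ^t* = G, forall v, csq v <= hf G v,
    forall x, sqn x <= gf ipH G x &
    forall x, gf ipK G (qop Q Y x) <= 2^-1 ^+ 2 * gf ipH G x].
Proof.
move=> nY; have [B B0 hB] := gramw_qop.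
pose s : R := 4 * B + 1.
have s0 : 0 < s by rewrite ltr_wpDl ?mulr_ge0.
pose G : 'M[C]_n := \sum_(l < m.+1) (s ^+ l)%:C *: gramw Y l.
have GH E ip x : @gf R E ip n G x = \sum_(l < m.+1) s ^+ l * gf ip (gramw Y l) x.
  by rewrite gf_sum; apply: eq_bigr => l _; rewrite gfZ.
exists G; split=> [|v|x|x].
- rewrite raddf_sum map_mx_sum; apply: eq_bigr => l _ /=.
  by rewrite linearZ /= map_mxZ /= conjC_real gramw_herm.
- have -> : hf G v = \sum_(l < m.+1) s ^+ l * hf (gramw Y l) v.
    rewrite /hf mulmx_sumr mulmx_suml summxE Re_sum; apply: eq_bigr => l _.
    by rewrite -scalemxAr -scalemxAl mxE ReZ.
  rewrite big_ord_recl expr0 mul1r -[gramw Y (@ord0 m)]/(1%:M) hf1 lerDl sumr_ge0 // => l _.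
  by rewrite mulr_ge0 ?exprn_ge0 ?(ltW s0) ?gramw_ge0.
- rewrite GH big_ord_recl expr0 mul1r -[gramw Y (@ord0 m)]/(1%:M) gf1 // lerDl sumr_ge0 // => l _.
  by rewrite mulr_ge0 ?exprn_ge0 ?(ltW s0) ?gramw_gf_ge0.
rewrite !GH.
apply: (@le_trans _ _ (\sum_(l < m.+1) s ^+ l * (B * gf ipH (gramw Y l.+1) x))).
  by apply: ler_sum => l _; rewrite ler_wpM2l ?exprn_ge0 ?(ltW s0).
rewrite (eq_bigr (fun l : 'I_m.+1 => B / s * (s ^+ l.+1 * gf ipH (gramw Y l.+1) x))); last first.
  by move=> l _; rewrite exprS; field; rewrite gt_eqF.
rewrite -mulr_sumr.
have le1 : \sum_(l < m.+1) s ^+ l.+1 * gf ipH (gramw Y l.+1) x <=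
    \sum_(l < m.+1) s ^+ l * gf ipH (gramw Y l) x.
  rewrite [leLHS]big_ord_recr [leRHS]big_ord_recl [leRHS]addrC lerD //.
  apply: (@le_trans _ _ 0); last by rewrite mul1r gramw_gf_ge0.
  rewrite (@gramw_nilp _ ipH) ?mulr0 // => w wm; rewrite nY ?wm //.
  by apply: funext => i; rewrite /kapp big1 // => a _; rewrite mxE scale0r.
have g0 : 0 <= \sum_(l < m.+1) s ^+ l.+1 * gf ipH (gramw Y l.+1) x.
  by apply: sumr_ge0 => l _; rewrite mulr_ge0 ?exprn_ge0 ?(ltW s0) ?gramw_gf_ge0.
apply: ler_pM => //; first by rewrite divr_ge0 // ltW.
rewrite ler_pdivrMr // /s; lra.
Qed.

Lemma nilpotent_similar n (Y : 'I_d -> 'M[C]_n) m : tnilp Y m.+1 ->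
  exists S : 'M[C]_n, S \in unitmx /\ inball Q (fun j => S *m Y j *m invmx S).
Proof.
move=> /nilpotent_form[G [Gh Gp _ GQ]].
have [|||S [uS _ bS]] := @form_point n Y G 2^-1 Gh _ _ _ GQ.
- move=> v v0; apply: lt_le_trans (Gp v); rewrite lt_def csq_ge0 andbT.
  by apply: contra_neq v0; exact: csq_eq0.
- by rewrite invr_ge0.
- by rewrite invf_lt1 // ltr1n.
by exists S.
Qed.

End Scaling.

(** * A positivity certificate *)

Section Separation.
Context (R : realType) (d : nat).
Local Notation C := R[i].
Context (H K : completeNormedModType C) (Q : 'I_d -> {linear H -> K}).
Hypothesis Qcont : forall j, continuous (Q j).
Local Open Scope sesquilinear_scope.
Context (ipH : H -> H -> C) (ipK : K -> K -> C).
Hypothesis ipHP : inner ipH.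
Hypothesis ipKP : inner ipK.
Hypothesis ipHE : forall u, ipq ipH u = nsq u.
Hypothesis ipKE : forall u, ipq ipK u = nsq u.

Section HilbertSchmidt.
Context (n : nat).
Implicit Types A B G : 'M[C]_n.

Definition hsip A B : C := \sum_a \sum_b A a b * Num.conj (B a b).

Lemma inner_hsip : inner hsip.
Proof.
split=> [a A B G|A B|A].
- rewrite /hsip mulr_sumr -big_split; apply: eq_bigr => i _ /=.
  rewrite mulr_sumr -big_split; apply: eq_bigr => j _ /=.
  by rewrite !mxE mulrDl mulrA.
- rewrite /hsip rmorph_sum; apply: eq_bigr => i _ /=.
  rewrite rmorph_sum; apply: eq_bigr => j _ /=.
  by rewrite rmorphM /= conjCK mulrC.
- by do 2!apply: sumr_ge0 => ? _; rewrite -nsqC ler0c nsq_ge0.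
Qed.

Definition hsr A B : R := complex.Re (hsip A B).

Lemma hsrD A B G : hsr (A + B) G = hsr A G + hsr B G.
Proof. by rewrite /hsr (ipDl inner_hsip) ReD. Qed.

Lemma hsrZ a A G : hsr (a%:C *: A) G = a * hsr A G.
Proof. by rewrite /hsr (ipZl inner_hsip) ReZ. Qed.

Lemma hsrN A G : hsr (- A) G = - hsr A G.
Proof.
by have := hsrZ (-1) A G; rewrite rmorphN rmorph1 scaleN1r mulN1r.
Qed.

Lemma hsrC A B : hsr A B = hsr B A.
Proof.
rewrite /hsr (ipC inner_hsip B A).
by case: (hsip B A) => x y; rewrite -[Num.conj _]/(x -i* y)%C.
Qed.

Lemma hsr_sum I (r : seq I) (F : I -> 'M[C]_n) G :
  hsr (\sum_(i <- r) F i) G = \sum_(i <- r) hsr (F i) G.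
Proof.
elim: r => [|i r IH]; last by rewrite !big_cons hsrD IH.
by rewrite !big_nil /hsr (ip0l inner_hsip).
Qed.

Definition hsn A : R := hsr A A.

Lemma hsn_ge0 A : 0 <= hsn A.
Proof. exact: (ipq_ge0 inner_hsip). Qed.

Lemma hsnN A : hsn (- A) = hsn A.
Proof. by rewrite /hsn hsrN hsrC hsrN opprK. Qed.

Lemma hsnD A B : hsn (A + B) = hsn A + 2 * hsr A B + hsn B.
Proof.
rewrite /hsn hsrD !(hsrC _ (A + B)) !hsrD (hsrC B A); ring.
Qed.

Lemma hsnZ a A : hsn (a%:C *: A) = a ^+ 2 * hsn A.
Proof. by rewrite /hsn hsrZ hsrC hsrZ mulrA. Qed.

Lemma hsr_CS A B c e : 0 <= c -> 0 <= e -> hsn A <= c ^+ 2 -> hsn B <= e ^+ 2 ->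
  `|hsr A B| <= c * e.
Proof.
move=> c0 e0 Ac Be.
have h : `|hsr A B| <= nm (hsip A B) by rewrite -lecR nmE; exact: normc_ge_Re.
apply: (le_trans h).
rewrite -(@ler_pXn2r _ 2) ?nnegrE ?nm_ge0 ?mulr_ge0 // -nsq_nm.
apply: le_trans (cauchy_schwarz inner_hsip _ _) _; rewrite exprMn.
by apply: ler_pM => //; exact: hsn_ge0.
Qed.

Lemma hsn_double A B : hsn (A - B) <= 2 * hsn A + 2 * hsn B.
Proof.
have := hsn_ge0 (A + B); rewrite !hsnD hsnN [hsr A (- B)]hsrC hsrN (hsrC B A); lra.
Qed.

Definition rank1 (v : 'cV[C]_n) : 'M[C]_n := v *m v ^t*.

Lemma hsr_rank1 v G : hsr (rank1 v) G = hf G v.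
Proof.
rewrite hsrC /hsr /hf /hsip; congr complex.Re.
rewrite mxE exchange_big; apply: eq_bigr => b _ /=.
rewrite mxE mulr_suml; apply: eq_bigr => a _.
by rewrite !mxE big_ord1 !mxE rmorphM /= conjCK; ring.
Qed.

Lemma rank1_herm v : (rank1 v) ^t* = rank1 v.
Proof. by rewrite /rank1 trmx_mul map_mxM trmxCK. Qed.

Lemma hsn_rank1 v : hsn (rank1 v) = csq v ^+ 2.
Proof.
rewrite /hsn hsr_rank1 /hf /rank1.
have e : (v ^t* *m v) 0 0 = (csq v)%:C.
  rewrite mxE rmorph_sum; apply: eq_bigr => i _.
  by rewrite !mxE /= nsqC mulrC.
rewrite !mulmxA -mulmxA mxE big_ord1 e.
by rewrite -rmorphM /= expr2.
Qed.

Lemma hfD A B v : hf (A + B) v = hf A v + hf B v.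
Proof. by rewrite -!hsr_rank1 hsrC hsrD !(hsrC _ (rank1 v)). Qed.

Lemma hfZ a A v : hf (a%:C *: A) v = a * hf A v.
Proof. by rewrite -!hsr_rank1 hsrC hsrZ (hsrC _ (rank1 v)). Qed.

Lemma hfN A v : hf (- A) v = - hf A v.
Proof. by rewrite -!hsr_rank1 hsrC hsrN (hsrC _ (rank1 v)). Qed.

Lemma hf_sum I (r : seq I) (F : I -> 'M[C]_n) v :
  hf (\sum_(i <- r) F i) v = \sum_(i <- r) hf (F i) v.
Proof.
rewrite -hsr_rank1 hsrC hsr_sum; apply: eq_bigr => i _.
by rewrite hsrC hsr_rank1.
Qed.

Definition psd A : Prop := A ^t* = A /\ forall v, 0 <= hf A v.

Definition gram (E : completeNormedModType C) (ip : E -> E -> C) (x : 'I_n -> E) : 'M[C]_n :=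
  \matrix_(a, b) ip (x a) (x b).

Lemma gram_herm (E : completeNormedModType C) ip (ipP : inner ip) (x : 'I_n -> E) :
  (gram ip x) ^t* = gram ip x.
Proof. by apply/matrixP => a b; rewrite !mxE -(ipC ipP). Qed.

Lemma hsr_gram (E : completeNormedModType C) (ip : E -> E -> C) (x : 'I_n -> E) G :
  hsr (gram ip x) G = gf ip G x.
Proof.
rewrite /hsr /gf; congr complex.Re; apply: eq_bigr => a _; apply: eq_bigr => b _.
by rewrite mxE mulrC.
Qed.

Lemma hf_gram (E : completeNormedModType C) ip (ipP : inner ip) (x : 'I_n -> E) v :
  hf (gram ip x) v = ipq ip (\sum_a Num.conj (v a 0) *: x a).
Proof.
apply: complexI; rewrite (ipq_comb ipP).
have -> : \sum_a \sum_b Num.conj (v a 0) * Num.conj (Num.conj (v b 0)) * ip (x a) (x b) =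
    (v ^t* *m gram ip x *m v) 0 0.
  rewrite mxE exchange_big; apply: eq_bigr => b _ /=.
  rewrite mxE mulr_suml; apply: eq_bigr => a _.
  by rewrite !mxE conjCK /=; ring.
rewrite /hf; set z := (_ *m _) 0 0.
have : Num.conj z = z.
  have -> : Num.conj z = ((v ^t* *m gram ip x *m v) ^t*) 0 0.
    by rewrite [RHS]mxE [X in _ = Num.conj X]mxE.
  by rewrite !trmx_mul !map_mxM gram_herm // trmxCK mulmxA.
by move/CrealP => zr; rewrite RRe_real.
Qed.

Lemma hsn_gram (E : completeNormedModType C) ip (ipP : inner ip)
    (ipE : forall u : E, ipq ip u = nsq u) (x : 'I_n -> E) :
  hsn (gram ip x) <= sqn x ^+ 2.
Proof.
rewrite /hsn /hsr /hsip Re_sum expr2 {1}/sqn mulr_suml; apply: ler_sum => a _.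
rewrite Re_sum /sqn mulr_sumr; apply: ler_sum => b _.
by rewrite !mxE -nsqC -!ipE; exact: cauchy_schwarz.
Qed.

End HilbertSchmidt.

Section Cone.
Context (n : nat) (Y : 'I_d -> 'M[C]_n).

Definition dgram (x : 'I_n -> H) : 'M[C]_n := gram ipH x - gram ipK (qop Q Y x).

(** A Hermitian G whose pairing [hsr] with the cone is nonnegative is positive and satisfies
    [gf ipK G (qop Q Y x) <= gf ipH G x], which is the condition of [form_point] up to strictness.
    Separation from the cone thus leads to points of the ball similar to Y. *)
Definition cone (M : 'M[C]_n) : Prop :=
  exists (l : seq ('I_n -> H)) (S : 'M[C]_n),
    psd S /\ M = S + \sum_(x <- l) dgram x.

Lemma psd0 : psd (0 : 'M[C]_n).
Proof.
split=> [|v]; first by rewrite trmx0 map_mx0.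
by rewrite /hf mulmx0 mul0mx mxE.
Qed.

Lemma psdD (S T : 'M[C]_n) : psd S -> psd T -> psd (S + T).
Proof.
move=> [Sh S0] [Th T0]; split=> [|v]; first by rewrite linearD map_mxD Sh Th.
by rewrite hfD addr_ge0.
Qed.

Lemma psdZ a (S : 'M[C]_n) : 0 <= a -> psd S -> psd (a%:C *: S).
Proof.
move=> a0 [Sh S0]; split=> [|v]; last by rewrite hfZ mulr_ge0.
by rewrite linearZ /= map_mxZ /= conjC_real Sh.
Qed.

Lemma coneD M N : cone M -> cone N -> cone (M + N).
Proof.
move=> [l [S [pS ->]]] [l' [S' [pS' ->]]]; exists (l ++ l'), (S + S'); split.
  exact: psdD.
by rewrite big_cat /= addrACA.
Qed.

Lemma coneZ a M : 0 <= a -> cone M -> cone (a%:C *: M).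
Proof.
move=> a0 [l [S [pS ->]]]; pose r := Num.sqrt a.
have rr : r%:C * r%:C = a%:C :> C by rewrite -rmorphM /= -expr2 sqr_sqrtr.
exists [seq (fun k => r%:C *: x k) | x <- l], (a%:C *: S); split; first exact: psdZ.
rewrite scalerDr scaler_sumr big_map; congr (_ + _); apply: eq_bigr => x _.
apply/matrixP => b c; rewrite !mxE !qopZ.
by rewrite !(ipZl ipHP) !(ipZr ipHP) !(ipZl ipKP) !(ipZr ipKP) conjC_real !mulrA rr mulrBr.
Qed.

Lemma cone_psd S : psd S -> cone S.
Proof. by move=> pS; exists [::], S; rewrite big_nil addr0. Qed.

Lemma cone_dgram x : cone (dgram x).
Proof. by exists [:: x], 0; rewrite big_seq1 add0r; split=> //; exact: psd0. Qed.

Lemma cone_herm M : cone M -> M ^t* = M.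
Proof.
move=> [l [S [[Sh _] ->]]]; rewrite linearD map_mxD Sh; congr (_ + _).
rewrite raddf_sum map_mx_sum; apply: eq_bigr => x _.
by rewrite /dgram /= linearB map_mxB !gram_herm.
Qed.

Lemma psd_near (G : 'M[C]_n) e : 0 <= e -> G ^t* = G -> hsn G <= e ^+ 2 ->
  psd (e%:C *: 1%:M + G).
Proof.
move=> e0 Gh Ge; split=> [|v].
  by rewrite linearD linearZ /= map_mxD map_mxZ /= conjC_real trmx1 map_mx1 Gh.
rewrite hfD hfZ hf1 -hsr_rank1.
have : `|hsr (rank1 v) G| <= csq v * e.
  by apply: hsr_CS => //; rewrite ?csq_ge0 // hsn_rank1.
rewrite ler_norml => /andP[h _]; lra.
Qed.

(* An almost nearest point of the cone to [X] gives a functional that is almost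
   nonnegative on the cone; as it is corrected below by a strictly positive
   one, no compactness is needed. *)
Lemma almost_separation X a : X ^t* = X -> 0 < a ->
  (forall M, cone M -> a <= hsn (M - X)) ->
  exists b : R, 0 < b /\ forall s, 0 < s -> s <= 1 -> exists G : 'M[C]_n,
    [/\ G ^t* = G, hsr X G <= s * b - a &
      forall M c, cone M -> 0 <= c -> hsn M <= c ^+ 2 -> - (s * c) <= hsr M G].
Proof.
move=> Xh a0 ha.
pose A := [set hsn (M - X) | M in cone].
have hA : has_inf A.
  split; first by exists (hsn (0 - X)), 0 => //; exact: cone_psd psd0.
  by exists a => _ [M cM <-]; exact: ha.
pose i := inf A.
have ai : a <= i.
  apply: lb_le_inf; first by case: hA.
  by move=> _ [M cM <-]; exact: ha.
pose c2 := 2 * (i + 1) + 2 * hsn X.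
have c20 : 0 <= c2.
  have := hsn_ge0 X; rewrite /c2; lra.
exists ((1 + c2) / 2); split=> [|s s0 s1]; first by rewrite divr_gt0 // ltr_wpDr.
have s20 : 0 < s ^+ 2 by rewrite exprn_gt0.
have [_ [M cM <-] Mi] := inf_adherent s20 hA.
(* M is nearest to X up to s^2; testing this against two competitors gives the two estimates. *)
have near N : cone N -> hsn (M - X) < hsn (N - X) + s ^+ 2.
  move=> cN; apply: lt_le_trans Mi _; rewrite lerD2r.
  by apply: ge_inf; [case: hA|exists N].
pose G := M - X; exists G; split.
- by rewrite linearB /= map_mxB Xh cone_herm.
(* The competitor (1 - s) M bounds [hsr M G] by s (1 + c2) / 2. *)
- have cM' : cone ((1 - s)%:C *: M) by apply: coneZ; rewrite ?subr_ge0.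
  have := near _ cM'.
  have -> : (1 - s)%:C *: M - X = G + (- s)%:C *: M.
    by rewrite rmorphB rmorph1 scalerBl scale1r rmorphN scaleNr addrAC.
  rewrite -/G [X in _ < X + _]hsnD hsnZ hsrC hsrZ => h1.
  have h2 : hsn M <= c2.
    have -> : M = G - (- X) by rewrite opprK subrK.
    apply: le_trans (hsn_double _ _) _.
    rewrite hsnN /c2 lerD2r ler_pM2l //; apply: ltW; apply: lt_le_trans Mi _.
    by rewrite lerD2l expr_le1 // ltW.
  have h3 : hsr X G = hsr M G - hsn G.
    by rewrite /hsn {2}/G hsrD hsrN opprB addrC subrK.
  have h4 : a <= hsn G by exact: ha.
  have h5 : s * (2 * hsr M G) <= s * (s * (1 + c2)).
    have : s ^+ 2 * hsn M <= s ^+ 2 * c2 by rewrite ler_pM2l.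
    move: h1; rewrite sqrrN; lra.
  rewrite ler_pM2l // in h5; rewrite h3; lra.
move=> N c cN c0 Nc; have [c00|cn0] := eqVneq c 0.
  have N0 : `|hsr N G| <= 0.
    have := @hsr_CS n N G 0 (Num.sqrt (hsn G)) (lexx 0) (sqrtr_ge0 _).
    by rewrite mul0r sqr_sqrtr ?hsn_ge0 // expr0n; apply; rewrite // -(expr0n R 2) -c00.
  by rewrite c00 mulr0 oppr0; move: N0; rewrite normr_le0 => /eqP ->.
have cp : 0 < c by rewrite lt_def cn0.
(* The weight s / c makes the quadratic term of the competitor M + (s / c) N at most s^2. *)
have := near _ (coneD cM (coneZ (ltW (divr_gt0 s0 cp)) cN)).
rewrite -/G addrAC -/G [X in _ < X + _]hsnD hsnZ hsrC hsrZ => h1.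
have h2 : (s / c) ^+ 2 * hsn N <= s ^+ 2.
  rewrite expr_div_n mulrAC ler_pdivrMr ?exprn_gt0 // ler_pM2l //.
have h3 : 0 < (s / c) * (hsr N G + s * c).
  have -> : s / c * (hsr N G + s * c) = s / c * hsr N G + s ^+ 2 by field; exact: lt0r_neq0.
  lra.
move: h3; rewrite pmulr_rgt0 ?divr_gt0 //; lra.
Qed.

End Cone.

(** Suppose eps + X is not in the cone, X being the difference of the rank one sums. Separation
    gives a Hermitian G, almost nonnegative on the cone and negative at X. A small multiple of the
    form of [nilpotent_form] makes it positive definite and strict in the ball condition, so it
    comes from an S with S Y S^-1 in the ball, where the hypothesis contradicts the sign at X. *)
Lemma pick_certificate n k (Y : 'I_d -> 'M[C]_n) (e w : 'I_k -> 'cV[C]_n) m :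
  tnilp Y m.+1 ->
  (forall S : 'M[C]_n, S \in unitmx -> inball Q (fun j => S *m Y j *m invmx S) ->
    \sum_i csq (S *m w i) <= \sum_i csq (S *m e i)) ->
  forall eps : R, 0 < eps ->
  exists l : seq ('I_n -> H), forall v,
    \sum_i hf (rank1 (w i)) v + \sum_(x <- l) hf (gram ipH x) v <=
    \sum_i hf (rank1 (e i)) v + eps * csq v + \sum_(x <- l) hf (gram ipK (qop Q Y x)) v.
Proof.
move=> nY hS eps eps0.
have [X XE] : exists X, X = \sum_i rank1 (e i) - \sum_i rank1 (w i) by eexists.
have Xh : X ^t* = X.
  rewrite XE linearB /= map_mxB !raddf_sum /=.
  by congr (_ + _); apply: eq_bigr => i _; rewrite rank1_herm.
have aux (a b c p q s : R) : a + (b - c) = s + (p - q) -> 0 <= s -> c + p <= b + a + q.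
  by move=> *; lra.
suff [l [S [[_ S0] XS]]] : cone Y (eps%:C *: 1%:M + X).
  exists l => v; have := S0 v; have := congr1 (fun M => hf M v) XS.
  rewrite XE !hfD hfN hfZ hf1 !hf_sum.
  under [X in _ = _ + X]eq_bigr do rewrite hfD hfN.
  rewrite sumrB; exact: aux.
apply: contrapT => nX.
(* If the cone came within eps of X, adding eps times the identity would absorb the difference. *)
have far M : cone Y M -> eps ^+ 2 <= hsn (M - X).
  move=> cM; rewrite leNgt; apply/negP => /ltW lt; apply: nX.
  have -> : eps%:C *: 1%:M + X = M + (eps%:C *: 1%:M + (X - M)).
    by rewrite addrCA [M + _]addrC subrK.
  apply: coneD => //; apply: cone_psd; apply: psd_near; first exact: ltW.
    by rewrite linearB map_mxB Xh (cone_herm cM).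
  apply: le_trans lt.
  by rewrite -opprB hsnN.
have e20 : 0 < eps ^+ 2 by rewrite exprn_gt0.
have [b [b0 sepP]] := almost_separation Xh e20 far.
have [G0 [G0h G0v G0x G0Q]] := nilpotent_form Qcont ipHP ipKP ipHE ipKE nY.
have [B B0 hB] := qop_bounded Qcont Y.
(* The Hilbert-Schmidt norm of [dgram Y x] is at most c1 [sqn x], so G errs by at most s c1 [sqn x].
   Since [G0] satisfies the ball condition with a factor 1/4, the multiple s c3 of it outweighs this
   error and leaves a gain s [sqn x]. All that must stay below eps^2 is collected in s c5. *)
pose c1 := 2 * (1 + B); have c10 : 0 < c1 by rewrite mulr_gt0 // ltr_wpDr.
pose c3 := 2 + 2 * c1.
have c30 : 0 < c3 by rewrite /c3; lra.
pose c5 := b + c3 * `|hsr X G0| + 1.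
have c50 : 0 < c5.
  have : 0 <= c3 * `|hsr X G0| by rewrite mulr_ge0 // ltW.
  rewrite /c5; lra.
pose s := Num.min 1 (eps ^+ 2 / (2 * c5)).
have s0 : 0 < s by rewrite lt_min ltr01 divr_gt0 // mulr_gt0.
have s1 : s <= 1 by rewrite ge_min lexx.
have sc : s * c5 < eps ^+ 2.
  apply: (@le_lt_trans _ _ (eps ^+ 2 / 2)); last by rewrite ltr_pdivrMr // ltr_pMr // ltr1n.
  have : s <= eps ^+ 2 / (2 * c5) by rewrite ge_min lexx orbT.
  by rewrite invfM mulrA ler_pdivlMr.
have [G [Gh GX Gc]] := sepP s s0 s1.
pose G' := G + (s * c3)%:C *: G0.
have sc0 : 0 < s * c3 by rewrite mulr_gt0.
have G'h : G' ^t* = G'.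
  by rewrite linearD linearZ /= map_mxD map_mxZ /= conjC_real Gh G0h.
have G'v v : v != 0 -> 0 < hf G' v.
  move=> v0; rewrite hfD hfZ.
  have vp : 0 < csq v.
    rewrite lt_def csq_ge0 andbT; apply: contra_neq v0; exact: csq_eq0.
  have pv : cone Y (rank1 v).
    apply: cone_psd; split=> [|u]; first exact: rank1_herm.
    by rewrite /rank1 -{1}[v]trmxCK hfS csq_ge0.
  have := Gc _ (csq v) pv (csq_ge0 v); rewrite hsn_rank1 lexx => /(_ isT).
  rewrite hsr_rank1 => h1.
  have h2 : s * c3 * csq v <= s * c3 * hf G0 v by rewrite ler_pM2l.
  have h3 : 0 < s * (1 + 2 * c1) * csq v by rewrite !mulr_gt0 //; lra.
  rewrite /c3 in h2 *; nra.
have dg x : s * sqn x <= gf ipH G' x - gf ipK G' (qop Q Y x).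
  have := Gc _ (c1 * sqn x) (cone_dgram Y x).
  have -> : hsr (dgram Y x) G = gf ipH G x - gf ipK G (qop Q Y x).
    by rewrite hsrD hsrN !hsr_gram.
  have hd : hsn (dgram Y x) <= (c1 * sqn x) ^+ 2.
    apply: le_trans (hsn_double _ _) _.
    have g1 := hsn_gram ipHP ipHE x; have g2 := hsn_gram ipKP ipKE (qop Q Y x).
    have g3 : sqn (qop Q Y x) ^+ 2 <= (B * sqn x) ^+ 2.
      by rewrite ler_pXn2r ?nnegrE ?mulr_ge0 ?sqn_ge0.
    have g4 : 0 <= B * sqn x ^+ 2 by rewrite mulr_ge0 ?sqr_ge0.
    have g5 := sqr_ge0 (B * sqn x); have g6 := sqr_ge0 (sqn x).
    rewrite /c1; lra.
  move=> /(_ (mulr_ge0 (ltW c10) (sqn_ge0 x)) hd) h1.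
  rewrite !gfD !gfZ; have h2 := G0Q x; have h3 := G0x x.
  have h4 : s * c3 * gf ipK G0 (qop Q Y x) <= s * c3 * (2^-1 ^+ 2 * gf ipH G0 x).
    by rewrite ler_pM2l.
  have h5 : s * c3 * sqn x <= s * c3 * gf ipH G0 x by rewrite ler_pM2l.
  have h6 : 0 <= s * sqn x by rewrite mulr_ge0 ?sqn_ge0 // ltW.
  have h7 : 0 <= s * (c1 * sqn x) by rewrite mulr_ge0 ?(ltW s0) // mulr_ge0 ?(ltW c10) ?sqn_ge0.
  rewrite /c3 in h4 h5 *; lra.
(* The gain s [sqn x] is additive; bounding [gf ipH G' x] by M [sqn x] turns it into the factor M /
   (M + s) < 1. *)
have [M M0 hM] := gf_le ipHP ipHE G'.
have sM : 0 < M + s by rewrite ltr_wpDl.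
have q0 : 0 <= M / (M + s) by rewrite divr_ge0 // ltW.
have q1 : M / (M + s) < 1 by rewrite ltr_pdivrMr // mul1r ltrDl.
have [|||S [uS GS bS]] := @form_point R d H K Q ipH ipK ipHP ipKP ipHE ipKE n Y G'
    (Num.sqrt (M / (M + s))) G'h G'v.
- exact: sqrtr_ge0.
- by rewrite -(sqrtr1 R) ltr_sqrt.
- move=> x; rewrite sqr_sqrtr //.
  have h1 := dg x; have h2 := hM x.
  have h3 : 0 <= gf ipK G' (qop Q Y x).
    by have [S0 _ ->] := psd_sqrt G'h G'v; rewrite (gfS ipKP ipKE) sqn_ge0.
  rewrite mulrAC ler_pdivlMr //.
  have h4 := ler_wpM2l M0 h1; have h5 := ler_wpM2l (ltW s0) h2.
  have h6 := ler_wpM2l (ltW s0) h1.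
  have h7 : 0 <= s * (s * sqn x) by rewrite !mulr_ge0 ?(ltW s0) ?sqn_ge0.
  lra.
have := hS S uS bS.
have cE v : csq (S *m v) = hsr (rank1 v) G' by rewrite hsr_rank1 GS hfS.
under eq_bigr do rewrite cE; under [in leRHS]eq_bigr do rewrite cE.
rewrite -!hsr_sum -subr_ge0 -hsrN -hsrD -XE hsrC hsrD hsrZ !(hsrC _ X).
have : s * c3 * hsr X G0 <= s * c3 * `|hsr X G0|.
  by rewrite ler_pM2l // ler_norm.
rewrite /c5 in sc; lra.
Qed.

End Separation.

(** * Realization and tangential interpolation *)

Section Interpolation.
Context (R : realType) (d : nat).
Local Notation C := R[i].
Local Notation poly := (seq (C * seq 'I_d)).
Context (H K : completeNormedModType C) (Q : 'I_d -> {linear H -> K}).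
Hypothesis hilbH : is_hilbert H.
Hypothesis hilbK : is_hilbert K.
Hypothesis Qcont : forall j, continuous (Q j).
Hypothesis Qindep : lin_indep Q.

Lemma peval_bounded (s : poly) : exists2 M : R, 0 <= M &
  forall n (X : 'I_d -> 'M[C]_n), inball Q X -> mxopnorm (peval X s) <= M.
Proof.
have [B B0 hB] := inball_coord_bounded hilbK Qindep.
have monB n (X : 'I_d -> 'M[C]_n) w : inball Q X -> mxopnorm (mon X w) <= B ^+ size w.
  move=> bX; elim: w => [|j w IH] /=; first by rewrite expr0 mxopnorm1_le.
  apply: le_trans (mxopnormM _ _) _; rewrite exprS.
  by apply: ler_pM; rewrite ?mxopnorm_ge0 ?hB.
exists (\sum_(t <- s) nm t.1 * B ^+ size t.2) => [|n X bX].
  by apply: sumr_ge0 => t _; rewrite mulr_ge0 ?nm_ge0 ?exprn_ge0.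
rewrite /peval; elim: s => [|t s IH]; first by rewrite !big_nil mxopnorm0.
rewrite !big_cons; apply: le_trans (mxopnormD _ _) _; rewrite lerD //.
apply: le_trans (mxopnormZ_le _ _) _; rewrite /nm -lock.
rewrite ler_wpM2l ?monB //.
by have := nm_ge0 t.1; rewrite /nm -lock.
Qed.

Lemma csq_sum k n (u : 'I_k -> 'cV[C]_n) : csq (\sum_j u j) <= k%:R * \sum_j csq (u j).
Proof.
rewrite /csq [leRHS]mulrC exchange_big mulr_suml; apply: ler_sum => i _ /=.
have := nsq_sum_le (fun j => u j i 0) (fun=> 1).
rewrite summxE (eq_bigr (fun j => u j i 0)) => [h|j _]; last by rewrite mulr1.
apply: (le_trans h); rewrite ler_wpM2l ?sqn_ge0 //.
rewrite /sqn (eq_bigr (fun=> 1)) => [|j _]; first by rewrite sumr_const card_ord.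
by have := nsqR (1 : R); rewrite rmorph1 expr1n.
Qed.

Section Realization.
Context (n k L : nat) (Y : 'I_d -> 'M[C]_n) (e w : 'I_k -> 'cV[C]_n).
Context (x : 'I_L -> 'I_n -> H) (eps : R) (eps0 : 0 < eps).
Context (ipK : K -> K -> C) (ipKP : inner ipK) (ipKE : forall u, ipq ipK u = nsq u).

Hypothesis cert : forall c : 'I_n -> C,
  \sum_i nsq (\sum_a c a * w i a 0) + \sum_l nsq (\sum_a c a *: x l a) <=
  \sum_j nsq (\sum_a c a * e j a 0) + eps * sqn c +
    \sum_l nsq (\sum_a c a *: qop Q Y (x l) a).

(** In this space the right side of the certificate is the squared norm of a combination of the
    vectors [u a] below. The middle summand, weighted by eps, makes these vectors independent, as
    [dual_basis] wants. *)
Let E1 : lmodType C := ('cV[C]_k * 'cV[C]_n * {ffun 'I_L -> K})%type.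

Let ip1 (u v : E1) : C :=
  dotc u.1.1 v.1.1 + dotc u.1.2 v.1.2 + \sum_l ipK (u.2 l) (v.2 l).

Let ip1P : inner ip1.
Proof.
split=> [a u v z|u v|u].
- rewrite /ip1 /= (ipDl (@inner_dotc _ _)) (ipZl (@inner_dotc _ _)).
  rewrite (ipDl (@inner_dotc _ _)) (ipZl (@inner_dotc _ _)).
  rewrite (eq_bigr (fun l => a * ipK (u.2 l) (z.2 l) + ipK (v.2 l) (z.2 l))) => [|l _].
    by rewrite big_split /= -mulr_sumr; ring.
  by rewrite !ffunE (ipDl ipKP) (ipZl ipKP).
- rewrite /ip1 !rmorphD /= -!(ipC (@inner_dotc _ _)); congr (_ + _).
  rewrite [RHS]rmorph_sum; by apply: eq_bigr => l _; rewrite (ipC ipKP).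
rewrite /ip1 !addr_ge0 ?(ip_ge0 (@inner_dotc _ _)) //.
by apply: sumr_ge0 => l _; rewrite (ip_ge0 ipKP).
Qed.

Let ip1E u : ipq ip1 u = csq u.1.1 + csq u.1.2 + \sum_l nsq (u.2 l).
Proof.
rewrite /ipq /ip1 !ReD; congr (_ + _ + _); [exact: ipq_dotc|exact: ipq_dotc|].
by rewrite Re_sum; apply: eq_bigr => l _; rewrite -ipKE.
Qed.

Let sumE1 I (r : seq I) (F : I -> E1) : \sum_(i <- r) F i =
  (\sum_(i <- r) (F i).1.1, \sum_(i <- r) (F i).1.2, \sum_(i <- r) (F i).2).
Proof.
elim: r => [|i r IH]; first by rewrite !big_nil.
by rewrite !big_cons IH; case: (F i) => [[? ?] ?].
Qed.

Let rt : C := (Num.sqrt eps)%:C.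

Let nsq_rt : nsq rt = eps.
Proof. by rewrite nsqR sqr_sqrtr // ltW. Qed.

Let xi (al : 'cV[C]_k) (be : 'cV[C]_n) (ka : 'I_L -> K) : E1 :=
  (al, rt *: be, [ffun l => ka l]).

Let u (a : 'I_n) : E1 := xi (\col_j e j a 0) (delta_mx a 0) (fun l => qop Q Y (x l) a).

Let xiE al be ka : ipq ip1 (xi al be ka) = csq al + eps * csq be + \sum_l nsq (ka l).
Proof.
rewrite ip1E /= csqZ nsq_rt; congr (_ + _).
by apply: eq_bigr => l _; rewrite ffunE.
Qed.

Let xi_sum I (r : seq I) (c : I -> C) al be ka :
  \sum_(i <- r) c i *: xi (al i) (be i) (ka i) =
  xi (\sum_(i <- r) c i *: al i) (\sum_(i <- r) c i *: be i)
     (fun l => \sum_(i <- r) c i *: ka i l).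
Proof.
rewrite sumE1 /=; congr (_, _, _).
  by rewrite scaler_sumr; apply: eq_bigr => i _; rewrite !scalerA mulrC.
apply/ffunP => l; rewrite sum_ffunE ffunE; apply: eq_bigr => i _.
by rewrite !ffunE.
Qed.

Let uE (c : 'I_n -> C) : ipq ip1 (\sum_a c a *: u a) =
  \sum_j nsq (\sum_a c a * e j a 0) + eps * sqn c +
    \sum_l nsq (\sum_a c a *: qop Q Y (x l) a).
Proof.
rewrite xi_sum xiE; congr (_ + _ * _ + _).
  by apply: eq_bigr => j _; rewrite summxE; congr nsq; apply: eq_bigr => a _; rewrite !mxE.
apply: eq_bigr => b _; rewrite summxE (bigD1 b) //= big1 ?addr0 => [|a ab].
  by rewrite !mxE !eqxx mulr1.
by rewrite !mxE eq_sym (negPf ab) mulr0.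
Qed.

(** The state equation of the realization at X, with state y and input v; p is a second input, which
    accounts for the eps term. *)
Definition rstep N (A : 'I_d -> 'M[C]_n) (B : 'M[C]_(n, k)) (be : 'M[C]_n)
    (X : 'I_d -> 'M[C]_N) (v : 'I_k -> 'cV[C]_N) (p y : 'I_n -> 'cV[C]_N) a : 'cV[C]_N :=
  \sum_j B a j *: v j + \sum_b be a b *: p b + \sum_i \sum_c A i a c *: (X i *m y c).

(** The certificate bounds the output and the H-part of a combination of the [u a] by its norm in
    [E1]; extending the coefficients to [E1] by [dual_basis] gives A, B and [be]. A solution of the
    state equation inherits the bound, and since Q(X) is contractive the H-parts cancel against
    their images, leaving the estimate of the output. At Y with input e the unit vectors are a
    solution, because [g a (u b)] is a Kronecker symbol. *)
Lemma realization : exists (A : 'I_d -> 'M[C]_n) (B : 'M[C]_(n, k)) (be : 'M[C]_n),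
  (forall N (X : 'I_d -> 'M[C]_N) (v : 'I_k -> 'cV[C]_N) (p y : 'I_n -> 'cV[C]_N),
     (forall z, sqn (qop Q X z) <= sqn z) -> (forall a, y a = rstep A B be X v p y a) ->
     \sum_i csq (\sum_a w i a 0 *: y a) <= \sum_j csq (v j) + eps * \sum_b csq (p b)) /\
  (forall a, delta_mx a 0 = rstep A B be Y e (fun b => delta_mx b 0) (fun b => delta_mx b 0) a).
Proof.
have low (c : 'I_n -> C) : eps * sqn c <= ipq ip1 (\sum_a c a *: u a).
  rewrite uE -addrA addrCA lerDl addr_ge0 //.
    by apply: sumr_ge0 => ? _; exact: nsq_ge0.
  by apply: sumr_ge0 => ? _; exact: nsq_ge0.
have [g [glin gu gle]] := dual_basis ip1P eps0 low.
have g0 a : g a 0 = 0.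
  by have := glin a (-1) 0 0; rewrite scaler0 addr0 mulN1r addNr.
have gsum a I (r : seq I) (c : I -> C) (F : I -> E1) :
    g a (\sum_(i <- r) c i *: F i) = \sum_(i <- r) c i * g a (F i).
  elim: r => [|i r IH]; first by rewrite !big_nil g0.
  by rewrite !big_cons glin IH.
have gD a y z : g a (y + z) = g a y + g a z.
  by rewrite -{1}[y]scale1r glin mul1r.
pose A i : 'M[C]_n := \matrix_(a, c) g a (xi 0 0 (fun l => Q i (x l c))).
pose B : 'M[C]_(n, k) := \matrix_(a, j) g a (xi (delta_mx j 0) 0 (fun=> 0)).
pose be : 'M[C]_n := \matrix_(a, b) g a (xi 0 (delta_mx b 0) (fun=> 0)).
exists A, B, be.
pose XL N (y : 'I_n -> 'cV[C]_N) l s := \sum_c y c s 0 *: x l c.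
pose XI N (X : 'I_d -> 'M[C]_N) (v : 'I_k -> 'cV[C]_N) (p : 'I_n -> 'cV[C]_N) y s :=
  xi (\col_j v j s 0) (\col_b p b s 0) (fun l => qop Q X (XL N y l) s).
have stepE N X v p y a s : rstep A B be X v p y a s 0 = g a (XI N X v p y s).
  rewrite /XI /rstep; have -> : xi (\col_j v j s 0) (\col_b p b s 0)
      (fun l => qop Q X (XL _ y l) s) =
    \sum_j v j s 0 *: xi (delta_mx j 0) 0 (fun=> 0) +
    \sum_b p b s 0 *: xi 0 (delta_mx b 0) (fun=> 0) +
    \sum_i 1 *: \sum_c (X i *m y c) s 0 *: xi 0 0 (fun l => Q i (x l c)).
    rewrite !xi_sum; under [X in _ + _ + X]eq_bigr do rewrite xi_sum.
    rewrite xi_sum /xi; congr (_, _, _) => /=.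
    - rewrite [X in _ + X + _]big1 => [|b _]; last by rewrite scaler0.
      rewrite [X in _ + X]big1 ?addr0 => [|i _]; last first.
        by rewrite big1 ?scaler0 // => c _; rewrite scaler0.
      apply/colP => j; rewrite mxE summxE (bigD1 j) //= big1 ?addr0 => [|i ij].
        by rewrite !mxE !eqxx mulr1.
      by rewrite !mxE eq_sym (negPf ij) mulr0.
    - rewrite -!scalerDr; congr (_ *: _).
      rewrite [X in X + _ + _]big1 ?add0r => [|j _]; last by rewrite scaler0.
      rewrite [X in _ + X]big1 ?addr0 => [|i _]; last first.
        by rewrite big1 ?scaler0 // => c _; rewrite scaler0.
      apply/colP => j; rewrite mxE summxE (bigD1 j) //= big1 ?addr0 => [|i ij].
        by rewrite !mxE !eqxx mulr1.
      by rewrite !mxE eq_sym (negPf ij) mulr0.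
    apply/ffunP => l; rewrite !ffunE.
    rewrite [X in X + _ + _]big1 ?add0r => [|j _]; last by rewrite scaler0.
    rewrite big1 ?add0r => [|j _]; last by rewrite scaler0.
    apply: eq_bigr => i _; rewrite scale1r.
    transitivity (\sum_t \sum_c (X i s t * y c t 0) *: Q i (x l c)).
      apply: eq_bigr => t _; rewrite /XL linear_sum scaler_sumr.
      by apply: eq_bigr => c _; rewrite linearZ scalerA.
    rewrite exchange_big; apply: eq_bigr => c _ /=.
    by rewrite mxE scaler_suml.
  rewrite !gD !gsum !mxE !summxE; congr (_ + _ + _).
  - by apply: eq_bigr => j _; rewrite !mxE mulrC.
  - by apply: eq_bigr => b _; rewrite !mxE mulrC.
  apply: eq_bigr => i _; rewrite mul1r gsum summxE; apply: eq_bigr => c _.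
  by rewrite !mxE mulrC.
split.
  move=> N X v p y hX hy.
  (* The certificate at the s-th row of y. The state equation identifies this row with the
     coefficients of a projection, which only lowers the norm. *)
  have fin s : \sum_i nsq (\sum_a y a s 0 * w i a 0) + \sum_l nsq (XL _ y l s) <=
      \sum_j nsq (v j s 0) + eps * \sum_b nsq (p b s 0) + \sum_l nsq (qop Q X (XL _ y l) s).
    apply: le_trans (cert _) _; rewrite -uE.
    have -> : \sum_a y a s 0 *: u a = \sum_a g a (XI _ X v p y s) *: u a.
      by apply: eq_bigr => a _; rewrite {1}hy stepE.
    apply: le_trans (gle _) _; rewrite xiE le_eqVlt; apply/orP; left; apply/eqP.
    by congr (_ + _ * _ + _); apply: eq_bigr => j _; rewrite mxE.
  have := ler_sum (index_enum _) (fun s (_ : true) => fin s).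
  rewrite !big_split /= -mulr_sumr => h.
  have e1 : \sum_i csq (\sum_a w i a 0 *: y a) =
      \sum_s \sum_i nsq (\sum_a y a s 0 * w i a 0).
    rewrite exchange_big; apply: eq_bigr => i _; apply: eq_bigr => s _ /=.
    by rewrite summxE; congr nsq; apply: eq_bigr => a _; rewrite mxE mulrC.
  have e2 : \sum_j csq (v j) = \sum_s \sum_j nsq (v j s 0) by rewrite exchange_big.
  have e3 : \sum_b csq (p b) = \sum_s \sum_b nsq (p b s 0) by rewrite exchange_big.
  have e4 : \sum_s \sum_l nsq (qop Q X (XL _ y l) s) <= \sum_s \sum_l nsq (XL _ y l s).
    rewrite exchange_big [leRHS]exchange_big; apply: ler_sum => l _; exact: hX.
  rewrite e1 e2 e3; lra.
move=> a; apply/colP => s; rewrite stepE.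
have -> : XI _ Y e (fun b => delta_mx b 0) (fun b => delta_mx b 0) s = u s.
  rewrite /XI /u; congr xi.
  - by apply/colP => b; rewrite !mxE [s == b]eq_sym.
  apply: funext => l; congr (qop Q Y _ s); apply: funext => t.
  rewrite /XL (bigD1 t) //= mxE !eqxx scale1r big1 ?addr0 // => c ct.
  by rewrite mxE eq_sym (negPf ct) scale0r.
by rewrite gu mxE andbT eq_sym.
Qed.

End Realization.

End Interpolation.

(** * Polynomial solutions of the tangential interpolation problem *)

Section PickPolynomials.
Context (R : realType) (d : nat).
Local Notation C := R[i].
Local Notation poly := (seq (C * seq 'I_d)).
Context (H K : completeNormedModType C) (Q : 'I_d -> {linear H -> K}).
Hypothesis hilbH : is_hilbert H.
Hypothesis hilbK : is_hilbert K.
Hypothesis Qcont : forall j, continuous (Q j).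
Hypothesis Qindep : lin_indep Q.
Local Open Scope sesquilinear_scope.

Section NilpotentFixpoint.
Context (n N m : nat) (A : 'I_d -> 'M[C]_n) (X : 'I_d -> 'M[C]_N).
Hypothesis nX : tnilp X m.

Let T (y : 'I_n -> 'cV[C]_N) a : 'cV[C]_N := \sum_i \sum_c A i a c *: (X i *m y c).

(** Each step applies one more X_i, so after m steps only words of length m remain, and these
    vanish. *)
Lemma nilpotent_iter (y : nat -> 'I_n -> 'cV[C]_N) :
  (forall t a, y t.+1 a = T (y t) a) -> forall a, y m a = 0.
Proof.
move=> yS a.
suff h t w : (m <= size w + t)%N -> forall a, mon X w *m y t a = 0.
  by have := h m [::] (leqnn m) a; rewrite mul1mx.
elim: t w => [|t IH] w mw b; first by rewrite nX ?mul0mx // -[size w]addn0.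
rewrite yS /T mulmx_sumr big1 // => i _; rewrite mulmx_sumr big1 // => c _.
rewrite -scalemxAr mulmxA.
have := IH (rcons w i) _ c; rewrite -cats1 mon_cat /= mulmx1 => ->; rewrite ?scaler0 //.
by rewrite size_cat addn1 addSnnS.
Qed.

Lemma nilpotent_fix (y : 'I_n -> 'cV[C]_N) : (forall a, y a = T y a) -> forall a, y a = 0.
Proof. by move=> yT; apply: (nilpotent_iter (y := fun=> y)). Qed.

End NilpotentFixpoint.

(** Iterating the state equation symbolically reaches its solution at every tuple nilpotent of order
    m+1, so the output is given by polynomials. At Y the solution is unique, hence formed by the
    unit vectors, and the output is w. The second input consists of polynomials that produce the
    unit vectors from e at Y. *)
Lemma pick_interpolation n k (Y : 'I_d -> 'M[C]_n) (e w : 'I_k -> 'cV[C]_n) m :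
  tnilp Y m.+1 ->
  (forall v, exists p : 'I_k -> poly, v = \sum_i peval Y (p i) *m e i) ->
  (forall S : 'M[C]_n, S \in unitmx -> inball Q (fun j => S *m Y j *m invmx S) ->
    \sum_i csq (S *m w i) <= \sum_i csq (S *m e i)) ->
  forall eps : R, 0 < eps ->
  exists q : 'I_k -> 'I_k -> poly,
    (forall i, \sum_j peval Y (q i j) *m e j = w i) /\
    forall N (X : 'I_d -> 'M[C]_N), inball Q X -> tnilp X m.+1 ->
      blockbd (fun i j => peval X (q i j)) (1 + eps).
Proof.
move=> nY gen hS eps eps0.
have [ipH [ipHP ipHE]] := hilbert_ip hilbH.
have [ipK [ipKP ipKE]] := hilbert_ip hilbK.
have /choice[p hp] : forall a, exists p : 'I_k -> poly,
    delta_mx a 0 = \sum_i peval Y (p i) *m e i by move=> a; exact: gen.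
have [M M0 hM] : exists2 M : R, 0 <= M & forall N (X : 'I_d -> 'M[C]_N), inball Q X ->
    forall v : 'I_k -> 'cV[C]_N,
    \sum_b csq (\sum_j peval X (p b j) *m v j) <= M * \sum_j csq (v j).
  have /choice[Mp hMp] : forall bj : 'I_n * 'I_k, exists M : R, 0 <= M /\
      forall N (X : 'I_d -> 'M[C]_N), inball Q X -> mxopnorm (peval X (p bj.1 bj.2)) <= M.
    by move=> [b j]; have [M M0 hM] := peval_bounded hilbK Qindep (p b j); exists M.
  exists (\sum_b k%:R * \sum_j Mp (b, j) ^+ 2) => [|N X bX v].
    apply: sumr_ge0 => b _; rewrite mulr_ge0 ?ler0n // sumr_ge0 // => j _.
    exact: sqr_ge0.
  rewrite mulr_suml; apply: ler_sum => b _; apply: le_trans (csq_sum _) _.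
  rewrite -mulrA ler_wpM2l ?ler0n // mulr_suml; apply: ler_sum => j _.
  have [Mp0 /(_ N X bX)] := hMp (b, j).
  move=> /(mxopnorm_leP _ Mp0) /(_ (v j)) h; apply: le_trans h _.
  rewrite ler_wpM2l ?sqr_ge0 // (bigD1 j) //= lerDl sumr_ge0 // => *.
  exact: csq_ge0.
(* The second input has squared norm at most M times that of v, so the error ep M stays below
   eps. *)
pose ep := eps / (M + 1).
have M1 : 0 < M + 1 by rewrite ltr_wpDl.
have ep0 : 0 < ep by rewrite divr_gt0.
have [l hl] := pick_certificate Qcont ipHP ipKP ipHE ipKE nY hS ep0.
pose x (t : 'I_(size l)) := tnth (in_tuple l) t.
have cert (c : 'I_n -> C) :
  \sum_i nsq (\sum_a c a * w i a 0) + \sum_t nsq (\sum_a c a *: x t a) <=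
  \sum_j nsq (\sum_a c a * e j a 0) + ep * sqn c +
    \sum_t nsq (\sum_a c a *: qop Q Y (x t) a).
  have := hl (\col_a Num.conj (c a)).
  have r1 (u : 'cV[C]_n) : hf (rank1 u) (\col_a Num.conj (c a)) = nsq (\sum_a c a * u a 0).
    have -> : rank1 u = (u ^t*) ^t* *m u ^t* by rewrite trmxCK.
    rewrite hfS /csq big_ord1.
    have -> : (u ^t* *m (\col_a Num.conj (c a))) 0 0 = Num.conj (\sum_a c a * u a 0).
      by rewrite mxE rmorph_sum; apply: eq_bigr => a _; rewrite !mxE /= rmorphM mulrC.
    by apply: complexI; rewrite !nsqC conjCK mulrC.
  have gE (E : completeNormedModType C) ip (ipP : inner ip)
      (ipE : forall z : E, ipq ip z = nsq z) (z : 'I_n -> E) :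
      hf (gram ip z) (\col_a Num.conj (c a)) = nsq (\sum_a c a *: z a).
    rewrite (hf_gram ipP) ipE; congr nsq; apply: eq_bigr => a _.
    by rewrite mxE conjCK.
  under eq_bigr do rewrite r1; under [in leRHS]eq_bigr do rewrite r1.
  have -> : csq (\col_a Num.conj (c a)) = sqn c.
    by apply: eq_bigr => a _; apply: complexI; rewrite mxE !nsqC conjCK mulrC.
  rewrite !(big_tnth _ _ l).
  under [X in _ + X <= _]eq_bigr do rewrite (gE _ _ ipHP ipHE).
  by under [X in _ <= _ + X]eq_bigr do rewrite (gE _ _ ipKP ipKE).
have [A [B [be [hbd hY]]]] := realization ep0 ipKP ipKE cert.
pose b0 a j : poly := pconst d (B a j) ++ psum (fun b => pscale (be a b) (p b j)).
pose stp (y : 'I_n -> 'I_k -> poly) a j : poly :=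
  b0 a j ++ psum (fun i => psum (fun c => pscale (A i a c) (plmul i (y c j)))).
pose yl t := iter t stp b0.
pose q i j := psum (fun a => pscale (w i a 0) (yl m.+1 a j)).
pose eta N (X : 'I_d -> 'M[C]_N) (v : 'I_k -> 'cV[C]_N) t a :=
  \sum_j peval X (yl t a j) *m v j.
pose P N (X : 'I_d -> 'M[C]_N) (v : 'I_k -> 'cV[C]_N) b := \sum_j peval X (p b j) *m v j.
have b0E N X v a : \sum_j peval X (b0 a j) *m v j =
    \sum_j B a j *: v j + \sum_b be a b *: P N X v b.
  have -> : \sum_j peval X (b0 a j) *m v j =
      \sum_j (B a j *: v j + \sum_b be a b *: (peval X (p b j) *m v j)).
    apply: eq_bigr => j _; rewrite peval_cat peval_const mulmxDl mul_scalar_mx.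
    rewrite peval_sum mulmx_suml; congr (_ + _); apply: eq_bigr => b _.
    by rewrite peval_scale scalemxAl.
  rewrite big_split /=; congr (_ + _); rewrite exchange_big; apply: eq_bigr => b _ /=.
  by rewrite scaler_sumr.
have etaS N X v t a : eta N X v t.+1 a = rstep A B be X v (P N X v) (eta N X v t) a.
  rewrite /rstep -b0E /eta.
  have -> : \sum_j peval X (yl t.+1 a j) *m v j = \sum_j (peval X (b0 a j) *m v j +
      \sum_i \sum_c A i a c *: (X i *m (peval X (yl t c j) *m v j))).
    apply: eq_bigr => j _; rewrite [yl _]iterS peval_cat mulmxDl; congr (_ + _).
    rewrite peval_sum mulmx_suml; apply: eq_bigr => i _.
    rewrite peval_sum mulmx_suml; apply: eq_bigr => c _.
    by rewrite peval_scale peval_lmul -scalemxAl mulmxA.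
  rewrite big_split /=; congr (_ + _); rewrite exchange_big; apply: eq_bigr => i _ /=.
  rewrite exchange_big; apply: eq_bigr => c _ /=.
  by rewrite mulmx_sumr scaler_sumr.
have rB N X v (y z : 'I_n -> 'cV[C]_N) a :
    rstep A B be X v (P N X v) y a - rstep A B be X v (P N X v) z a =
    \sum_i \sum_c A i a c *: (X i *m (y c - z c)).
  rewrite /rstep opprD addrACA subrr add0r -sumrB; apply: eq_bigr => i _.
  by rewrite -sumrB; apply: eq_bigr => c _; rewrite mulmxBr scalerBr.
have etafix N X v : tnilp X m.+1 -> forall a,
    eta N X v m.+1 a = rstep A B be X v (P N X v) (eta N X v m.+1) a.
  move=> nX a; rewrite -etaS; apply/esym/eqP; rewrite -subr_eq0; apply/eqP.
  (* Differences of consecutive iterates obey the homogeneous recurrence, which dies after m+1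
     steps. *)
  apply: (nilpotent_iter (A := A) nX (y := fun t a => eta N X v t.+1 a - eta N X v t a)).
  by move=> t c; rewrite [in LHS]etaS [X in _ - X]etaS rB.
have qE N X v i : \sum_j peval X (q i j) *m v j = \sum_a w i a 0 *: eta N X v m.+1 a.
  rewrite /eta; under [RHS]eq_bigr do rewrite scaler_sumr.
  rewrite [RHS]exchange_big; apply: eq_bigr => j _ /=.
  rewrite peval_sum mulmx_suml; apply: eq_bigr => a _.
  by rewrite peval_scale scalemxAl.
exists q; split=> [i|N X bX nX v].
  rewrite qE; have PE : P n Y e = (fun b => delta_mx b 0).
    by apply: funext => b; rewrite /P -hp.
  have eE a : eta n Y e m.+1 a = delta_mx a 0.
    apply/eqP; rewrite -subr_eq0; apply/eqP; move: a.
    apply: (nilpotent_fix (A := A) nY) => a.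
    by rewrite {1}etafix // {1}hY -[X in rstep A B be Y e X (fun b => delta_mx b 0) a]PE rB.
  apply/colP => s; rewrite summxE (bigD1 s) //= big1 ?addr0 => [|a as_].
    by rewrite eE !mxE !eqxx mulr1.
  by rewrite eE !mxE eq_sym (negPf as_) mulr0.
have bX1 z : sqn (qop Q X z) <= sqn z.
  have [r [r0 r1 hr]] := bX; apply: le_trans (hr z) _.
  by rewrite ler_piMl ?sqn_ge0 // exprn_ile1 // ltW.
under eq_bigr do rewrite qE.
apply: le_trans (hbd _ _ _ _ _ bX1 (etafix _ _ v nX)) _.
have h1 := hM _ _ bX v; have h2 : 0 <= \sum_j csq (v j) by apply: sumr_ge0 => *; exact: csq_ge0.
have h3 : ep * (M * \sum_j csq (v j)) <= eps * \sum_j csq (v j).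
  rewrite /ep mulrA ler_wpM2r // mulrAC ler_pdivrMr // ler_pM2l // lerDl //.
have h4 : ep * \sum_b csq (P N X v b) <= ep * (M * \sum_j csq (v j)) by rewrite ler_pM2l.
have h5 : 0 <= (eps + eps ^+ 2) * \sum_j csq (v j).
  by rewrite mulr_ge0 // addr_ge0 ?sqr_ge0 // ltW.
lra.
Qed.

End PickPolynomials.

(** * Extension of polynomials from the zero set *)

Section PolynomialExtension.
Context (R : realType) (d : nat).
Local Notation C := R[i].
Local Notation poly := (seq (C * seq 'I_d)).
Context (H K : completeNormedModType C) (Q : 'I_d -> {linear H -> K}).
Hypothesis hilbH : is_hilbert H.
Hypothesis hilbK : is_hilbert K.
Hypothesis Qcont : forall j, continuous (Q j).
Hypothesis Qindep : lin_indep Q.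
Local Notation D := (opball Q).

Lemma blockbdZ k n (F : 'I_k -> 'I_k -> 'M[C]_n) (a M : R) : 0 <= a -> blockbd F M ->
  blockbd (fun i j => a%:C *: F i j) (a * M).
Proof.
move=> a0 hF v; have := hF v => h.
have -> : \sum_i csq (\sum_j (a%:C *: F i j) *m v j) =
    a ^+ 2 * \sum_i csq (\sum_j F i j *m v j).
  rewrite mulr_sumr; apply: eq_bigr => i _; rewrite -(nsqR a) -csqZ scaler_sumr.
  by congr csq; apply: eq_bigr => j _; rewrite scalemxAl.
by rewrite exprMn -[leRHS]mulrA ler_wpM2l ?sqr_ge0.
Qed.

Lemma blockbd_le k n (F : 'I_k -> 'I_k -> 'M[C]_n) (M M' : R) : 0 <= M -> M <= M' ->
  blockbd F M -> blockbd F M'.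
Proof.
move=> M0 MM hF v; apply: le_trans (hF v) _.
apply: ler_wpM2r; first by apply: sumr_ge0 => i _; exact: csq_ge0.
by rewrite ler_pXn2r ?nnegrE ?(le_trans M0).
Qed.

Lemma peval_conj n (Y : 'I_d -> 'M[C]_n) (S : 'M[C]_n) s : S \in unitmx ->
  peval (fun j => S *m Y j *m invmx S) s = S *m peval Y s *m invmx S.
Proof.
move=> uS; have := @peval_intertwine R d _ _ (fun j => S *m Y j *m invmx S) Y S _ s.
by move=> <- => [|j]; [rewrite mulmxK|rewrite mulmxKV].
Qed.

Lemma opball_pt n (X : 'I_d -> 'M[C]_n.+1) : D (@mkpt R d n X) <-> inball Q X.
Proof. exact: (opballP Qcont (@mkpt R d n X)). Qed.

Section ZeroSetModel.
Context (J : set (gfun D)) (JP : homideal J) (E : set (mxuniv R d)).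
Hypothesis hE : forall X, E X <-> D X /\ forall f, J f -> forall hX, f X hX = 0.

Let ncE : ncset Q E := zeroset_ncset Qcont JP hE.

Lemma model_point n (Y : 'I_d -> 'M[C]_n.+1) (S : 'M[C]_n.+1) :
  (forall s, J (pfun s) -> peval Y s = 0) -> S \in unitmx ->
  inball Q (fun j => S *m Y j *m invmx S) -> E (mkpt (fun j => S *m Y j *m invmx S)).
Proof.
move=> YJ uS bS; apply/(zerosetP JP hE); split; first exact/opball_pt.
by move=> s Js; have := peval_conj Y s uS; rewrite YJ // mulmx0 mul0mx; apply.
Qed.

Lemma model_similar n (Y : 'I_d -> 'M[C]_n) m : tnilp Y m.+1 ->
  exists S : 'M[C]_n, S \in unitmx /\ inball Q (fun j => S *m Y j *m invmx S).
Proof.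
have [ipH [ipHP ipHE]] := hilbert_ip hilbH.
have [ipK [ipKP ipKE]] := hilbert_ip hilbK.
exact: (nilpotent_similar Qcont ipHP ipKP ipHE ipKE).
Qed.

Lemma poly_extension k (f : 'I_k -> 'I_k -> gfun E) (M : R) : (exists X, E X) -> (0 < k)%N ->
  0 <= M -> (forall i j, is_ncfun (f i j)) ->
  (forall X (hX : E X), blockbd (fun i j => f i j X hX) M) ->
  forall (eps : R) m, 0 < eps -> exists P : 'I_k -> 'I_k -> poly,
    (forall X, D X -> blockbd (fun i j => peval (coord X) (P i j)) (M + eps)) /\
    forall i j X (hT : E (tenspt (nshift R m.+1) X)),
      peval (coord X) (P i j) = @fejmean R m (lvl X) (f i j _ hT).
Proof.
move=> exE k0 M0 ncf fM eps m eps0.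
have [r [Y [e [nY gen YJ _ univ]]]] := universal_model Qcont m JP hE exE k0.
have [S0 [uS0 bS0]] := model_similar nY.
have hZ0 := model_point YJ uS0 bS0.
set Z0 := mkpt _ in hZ0.
(* Half of eps makes the divisor positive even for M = 0; the other half goes into [ep], chosen so
   that M' (1 + ep) = M + eps. *)
pose M' := M + eps / 2.
have M'0 : 0 < M' by rewrite ltr_wpDl // divr_gt0.
have M'1 : M'%:C != 0 by rewrite -[0]/(0%:C) (inj_eq (@complexI R)) gt_eqF.
(* Y itself need not lie in the ball, so the value of f there is defined through the similar point
   [Z0]; [fint] shows that it intertwines like a genuine value. *)
pose g i j : 'M[C]_r.+1 := invmx S0 *m f i j Z0 hZ0 *m S0.
pose w i : 'cV[C]_r.+1 := (M'^-1)%:C *: \sum_j g i j *m e j.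
have fint i j Z (hZ : E Z) (L : 'M[C]_(lvl Z, r.+1)) :
    (forall l, coord Z l *m L = L *m Y l) -> f i j Z hZ *m L = L *m g i j.
  move=> ZL.
  have h : f i j Z hZ *m (L *m invmx S0 : 'M_(lvl Z, lvl Z0)) = L *m invmx S0 *m f i j Z0 hZ0.
    apply: (nc_intertwine ncE) => // l.
    rewrite mulmxA ZL [coord Z0 l]/(S0 *m Y l *m invmx S0) !mulmxA.
    by rewrite mulmxKV.
  rewrite /g !mulmxA -h -!mulmxA; congr (_ *m _).
  by rewrite mulVmx // mulmx1.
have hS (S : 'M[C]_r.+1) : S \in unitmx -> inball Q (fun j => S *m Y j *m invmx S) ->
    \sum_i csq (S *m w i) <= \sum_i csq (S *m e i).
  move=> uS bS; have hZ := model_point YJ uS bS.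
  have Sw i : S *m w i = (M'^-1)%:C *: \sum_j f i j _ hZ *m (S *m e j).
    rewrite /w -scalemxAr mulmx_sumr; congr (_ *: _); apply: eq_bigr => j _.
    rewrite [RHS]mulmxA (fint i j _ hZ S) ?mulmxA // => l.
    by rewrite [coord _ l]/(S *m Y l *m invmx S) mulmxKV.
  under eq_bigr do rewrite Sw csqZ nsqR.
  rewrite -mulr_sumr; have := fM _ hZ (fun j => S *m e j) => h.
  rewrite exprVn ler_pdivrMl ?exprn_gt0 //; apply: le_trans h _.
  apply: ler_wpM2r; first by apply: sumr_ge0 => i _; exact: csq_ge0.
  by rewrite ler_pXn2r ?nnegrE ?(ltW M'0) // lerDl divr_ge0 // ltW.
pose ep := eps / (2 * M').
have ep0 : 0 < ep by rewrite divr_gt0 // mulr_gt0.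
have [q [qY qb]] := pick_interpolation hilbH hilbK Qcont Qindep nY gen hS ep0.
have qE i j Z (hZ : E Z) : tnilp (coord Z) m.+1 ->
    f i j Z hZ = M'%:C *: peval (coord Z) (q i j).
  move=> nZ; have [_ ZJ] := (zerosetP JP hE Z).1 hZ.
  apply/matrixP => a b.
  (* The intertwiner that sends [e j] to the b-th unit vector and the other generators to 0 isolates
     column b of the entry (i, j). *)
  have [L [ZL Le]] := univ _ (coord Z)
    (fun j' => if j' == j then delta_mx b 0 else 0) nZ ZJ.
  have colE (A : 'M[C]_(lvl Z)) : A a b = (A *m delta_mx b (0 : 'I_1)) a 0.
    by rewrite -colE mxE.
  rewrite !colE; congr (fun_of_matrix _ a 0).
  have h1 : L *m w i = (M'^-1)%:C *: (f i j Z hZ *m delta_mx b 0).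
    rewrite /w -scalemxAr mulmx_sumr (bigD1 j) //= big1 ?addr0 => [|j' jj'].
      by rewrite mulmxA -(fint i j Z hZ) // -mulmxA Le eqxx.
    by rewrite mulmxA -(fint i j' Z hZ) // -mulmxA Le (negPf jj') mulmx0.
  have h2 : L *m w i = peval (coord Z) (q i j) *m delta_mx b 0.
    rewrite -qY mulmx_sumr (bigD1 j) //= big1 ?addr0 => [|j' jj'].
      by rewrite mulmxA -(peval_intertwine ZL) -mulmxA Le eqxx.
    by rewrite mulmxA -(peval_intertwine ZL) -mulmxA Le (negPf jj') mulmx0.
  rewrite -scalemxAl -h2 h1 scalerA -rmorphM /= divff ?rmorph1 ?scale1r //.
  by rewrite gt_eqF.
exists (fun i j => pscale M'%:C (pmask (fejer R m) (q i j))); split=> [X DX|i j X hT].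
  have e1 i j : peval (coord X) (pscale M'%:C (pmask (fejer R m) (q i j))) =
      M'%:C *: fejmean (peval (tpt (nshift R m.+1) (coord X)) (q i j)).
    by rewrite peval_scale fejmean_peval.
  have -> : M + eps = M' * (1 + ep) by rewrite /ep /M'; field; rewrite gt_eqF //; lra.
  have := blockbdZ (ltW M'0) (blockbd_fejmean (qb _ _ _
    (@tnilp_tpt_nshift R d m.+1 (lvl X) (coord X)))).
  have bT : inball Q (tpt (nshift R m.+1) (coord X)).
    exact/opball_pt/(opball_nshift Qcont).
  by move=> /(_ bT) h v; have := h v; under eq_bigr do under eq_bigr do rewrite -e1.
rewrite qE; last exact: (@tnilp_tpt_nshift R d m.+1 (lvl X) (coord X)).
by rewrite fejmeanZ peval_scale -fejmean_peval.
Qed.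

End ZeroSetModel.

Definition zeropt : mxuniv R d := @mkpt R d 0 (fun=> 0).

Lemma opball_zeropt : D zeropt.
Proof.
apply/opball_pt; exists 0; split=> // v; rewrite expr0n mul0r /sqn big1 // => i _.
rewrite /qop big1 ?nsq0 // => j _; rewrite big1 // => k _.
by rewrite mxE scale0r.
Qed.

(** The ball is the zero set of the zero ideal, so results on zero sets apply to it. *)
Lemma opball_zeroset0 X : D X <-> D X /\ forall f, [set 0 : gfun D] f -> forall hX, f X hX = 0.
Proof. by split=> [DX|[]//]; split=> // f ->. Qed.

(** The model of the zero ideal with one generator is a free nilpotent tuple; p is read off from the
    value of F there, applied to the generator. *)
Lemma nilpotent_poly (F : gfun D) m : is_ncfun F -> exists p : poly,
  (forall t, t \in p -> (size t.2 <= m)%N) /\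
  forall X (hX : D X), tnilp (coord X) m.+1 -> F X hX = peval (coord X) p.
Proof.
move=> ncF.
have J0 := homideal0 Q; have ncD := zeroset_ncset Qcont J0 opball_zeroset0.
have [r [Y [e [nY gen YJ _ univ]]]] :=
  universal_model Qcont m J0 opball_zeroset0 (ex_intro _ _ opball_zeropt) (ltn0Sn 0).
have [S0 [uS0 bS0]] := model_similar nY.
have hZ0 := model_point J0 opball_zeroset0 YJ uS0 bS0.
set Z0 := mkpt _ in hZ0.
have [p hp] := gen (invmx S0 *m F Z0 hZ0 *m S0 *m e 0).
(* Terms above degree m are dropped because the kernel clause of [universal_model] asks for degree
   at most m. *)
exists [seq t <- p 0 | (size t.2 <= m)%N]; split=> [t|X hX nX].
  by rewrite mem_filter => /andP[].
have -> : peval (coord X) [seq t <- p 0 | (size t.2 <= m)%N] = peval (coord X) (p 0).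
  rewrite /peval big_filter big_mkcond; apply: eq_bigr => t _.
  by case: ifPn => //; rewrite -ltnNge => mt; rewrite nX ?scaler0.
apply/matrixP => a b.
have colE (A : 'M[C]_(lvl X)) : A a b = (A *m delta_mx b (0 : 'I_1)) a 0.
  by rewrite -colE mxE.
rewrite !colE; congr (fun_of_matrix _ a 0).
have [|L [XL Le]] := univ _ (coord X) (fun=> delta_mx b 0) nX.
  by move=> s; rewrite /set1 /= => /(congr1 (fun f : gfun D => f X hX)).
have h : F X hX *m (L *m invmx S0 : 'M_(lvl X, lvl Z0)) = L *m invmx S0 *m F Z0 hZ0.
  apply: (nc_intertwine ncD) => // l.
  rewrite mulmxA XL [coord Z0 l]/(S0 *m Y l *m invmx S0) !mulmxA.
  by rewrite mulmxKV.
rewrite -(Le 0) !mulmxA (peval_intertwine XL) -[RHS]mulmxA.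
have -> : peval Y (p 0) *m e 0 = invmx S0 *m F Z0 hZ0 *m S0 *m e 0.
  by rewrite hp big_ord1.
rewrite !mulmxA -h -!mulmxA; congr (_ *m (_ *m _)).
by rewrite mulmxA mulVmx // mul1mx.
Qed.

(** * Functions that vanish on the zero set *)

Section Vanishing.
Context (J : set (gfun D)) (JP : homideal J) (E : set (mxuniv R d)).
Hypothesis hE : forall X, E X <-> D X /\ forall f, J f -> forall hX, f X hX = 0.

(** The zero tuple is not in E, so some polynomial of J has a nonzero constant term, which lies in J
    by homogeneity; hence J contains 1. *)
Lemma empty_zeroset : ~ (exists X, E X) -> forall s, J (pfun s).
Proof.
move=> nE.
have J1 : J (pfun (pconst d 1)).
  have : ~ forall s, J (pfun s) -> peval (coord zeropt) s = 0.
    move=> h; apply: nE; exists zeropt; apply/(zerosetP JP hE); split=> //.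
    exact: opball_zeropt.
  move=> /existsNP[s /not_implyP[Js s0]].
  pose c : C := \sum_(t <- s | t.2 == [::]) t.1.
  have cE n (X : 'I_d -> 'M[C]_n) : peval X (pmask (fun k => (k == 0%N)%:R) s) = c%:M.
    rewrite /peval big_map -scalemx1 scaler_suml [RHS]big_mkcond; apply: eq_bigr => t _ /=.
    by case: t.2 => [|j w] /=; rewrite ?mul1r // mul0r scale0r.
  have c0 : c != 0.
    apply/eqP => c0; apply: s0; have := cE _ (coord zeropt); rewrite c0 => h.
    rewrite (_ : peval _ s = peval (coord zeropt) (pmask (fun k => (k == 0%N)%:R) s)).
      by rewrite h; apply/matrixP => i j; rewrite !mxE mul0rn.
    rewrite /peval big_map; apply: eq_bigr => t _ /=.
    by case: t.2 => [|j w] /=; rewrite ?mul1r // mul0mx scaler0 mul0r scale0r.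
  have := homidealZ JP c^-1 (homideal_mask Qcont JP (fun k => (k == 0%N)%:R) Js).
  suff -> : c^-1 *: @pfun R d D (pmask (fun k => (k == 0%N)%:R) s) = pfun (pconst d 1) by [].
  apply: gfunP => X hX; rewrite [LHS]/(c^-1 *: peval _ _) cE /pfun peval_const.
  by apply/matrixP => i j; rewrite mxE [in LHS]mxE [RHS]mxE mulrnAr mulVf.
have Jw w : J (pfun [:: (1 : C, w)]).
  elim: w => [|j w IH]; first exact: J1.
  exact: (homideal_lmul JP j IH).
move=> s; suff -> : @pfun R d D s = \sum_(t <- s) t.1 *: pfun [:: (1 : C, t.2)].
  by apply: (homideal_sum JP) => t; apply: (homidealZ JP).
apply: gfunP => X hX; rewrite /pfun /peval; elim: s => [|t s IH].
  by rewrite !big_nil.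
rewrite !big_cons [RHS]/(t.1 *: peval (coord X) _ + _) -IH; congr (_ + _).
by rewrite /peval big_seq1 scale1r.
Qed.

(** F agrees at nilpotent points with a polynomial p, and the model Y is similar to a point of E. So
    p(Y) = 0, and the kernel clause of [universal_model] puts p in J; the mean of F is a degree
    multiplier of p. *)
Lemma vanishing_fejmean (F : gfun D) : is_ncfun F ->
  (forall X (hX : D X), E X -> F X hX = 0) -> forall m, exists s,
  J (pfun s) /\ forall X (hT : D (tenspt (nshift R m.+1) X)),
    peval (coord X) s = @fejmean R m (lvl X) (F _ hT).
Proof.
move=> ncF FE m; have [p [pm pF]] := nilpotent_poly m ncF.
exists (pmask (fejer R m) p); split; last first.
  by move=> X hT; rewrite pF -?fejmean_peval //;
    exact: (@tnilp_tpt_nshift R d m.+1 (lvl X) (coord X)).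
apply: (homideal_mask Qcont JP).
case: (pselect (exists X, E X)) => [exE|nE]; last exact: empty_zeroset.
have [r [Y [e [nY _ YJ Yp _]]]] := universal_model Qcont m JP hE exE (ltn0Sn 0).
have [S0 [uS0 bS0]] := model_similar nY.
have hZ0 := model_point JP hE YJ uS0 bS0.
have DZ0 : D (mkpt (fun j => S0 *m Y j *m invmx S0)) by exact/opball_pt.
have := FE _ DZ0 hZ0; rewrite pF; last first.
  move=> w wm; have := @mon_intertwine R d _ _ (fun j => S0 *m Y j *m invmx S0) Y S0 _ w.
  rewrite nY // mulmx0 => h; have /(congr1 (mulmx^~ (invmx S0))) :
    mon (fun j => S0 *m Y j *m invmx S0) w *m S0 = 0.
    by apply: h => j; rewrite mulmxKV.
  by rewrite mulmxK // mul0mx.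
have := peval_conj Y p uS0 => /[swap] h; rewrite [X in X = _]h => {}h.
have pY : peval Y p = 0.
  by have /(congr1 (fun A => invmx S0 *m (A *m S0))) := h;
    rewrite mulmxKV // mulKmx // mul0mx mulmx0.
apply: (Yp (fun=> p) _ _ 0) => [i t /pm//|].
by rewrite big_ord1 pY mul0mx.
Qed.

End Vanishing.

End PolynomialExtension.

(** * Limits along an ultrafilter *)

Section Ultralimit.
Context (R : realType).
Local Notation C := R[i].

Lemma nm_entry m n (A : 'M[C]_(m, n)) i j : nm (A i j) <= mxopnorm A.
Proof.
rewrite -(@ler_pXn2r _ 2) ?nnegrE ?nm_ge0 ?mxopnorm_ge0 // -nsq_nm.
have := csq_mulmx A (delta_mx j 0).
have -> : csq (delta_mx j 0 : 'cV[C]_n) = 1.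
  rewrite /csq (bigD1 j) //= big1 ?addr0 => [|k kj].
    by have := nsqR (1 : R); rewrite rmorph1 expr1n mxE !eqxx.
  by rewrite mxE (negPf kj) nsq0.
rewrite mulr1 -colE; apply: le_trans.
rewrite /csq (bigD1 i) //= mxE lerDl sumr_ge0 // => *; exact: nsq_ge0.
Qed.

Lemma mxopnorm_entries m n (A : 'M[C]_(m, n)) : mxopnorm A <= \sum_i \sum_j nm (A i j).
Proof.
rewrite {1}[A]matrix_sum_delta.
elim: (index_enum 'I_m) => [|i l IH]; first by rewrite !big_nil mxopnorm0.
rewrite !big_cons; apply: le_trans (mxopnormD _ _) _; rewrite lerD //.
elim: (index_enum 'I_n) => [|j l' IH']; first by rewrite !big_nil mxopnorm0.
rewrite !big_cons; apply: le_trans (mxopnormD _ _) _; rewrite lerD //.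
apply: le_trans (mxopnormZ_le _ _) _; rewrite [complex.Re _]lock -/(nm _).
rewrite ler_piMr ?nm_ge0 //; apply/mxopnorm_leP => // v; rewrite expr1n mul1r.
rewrite /csq (bigD1 i) //= big1 ?addr0 => [|k ki].
  rewrite mxE (bigD1 j) //= big1 ?addr0 => [|k kj].
    by rewrite mxE !eqxx mul1r (bigD1 j) //= lerDl sumr_ge0 // => *; exact: nsq_ge0.
  by rewrite mxE (negPf kj) andbF mul0r.
by rewrite mxE big1 ?nsq0 // => j' _; rewrite mxE (negPf ki) mul0r.
Qed.

Lemma exists_ultrafilter : exists U : set_system nat, UltraFilter U /\ \oo `<=` U.
Proof. by have [U [UU sU]] := @ultraFilterLemma nat \oo _; exists U. Qed.

Context (U : set_system nat) (UU : UltraFilter U) (sU : \oo `<=` U).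

Let FU : ProperFilter U := @ultra_proper _ _ UU.
Local Existing Instance FU.

Let U_tail N : U [set k | (N <= k)%N].
Proof. by apply: sU; exists N. Qed.

(** The limit is the supremum of the levels that u reaches U-almost everywhere. *)
Let ulim_real (u : nat -> R) (M : R) : (forall k, `|u k| <= M) ->
  exists l, forall e, 0 < e -> U [set k | `|u k - l| < e].
Proof.
move=> uM; pose S := [set x | U [set k | x <= u k]].
have supS : has_sup S.
  split; first by exists (- M); apply: filterE => k /=; have := uM k; rewrite ler_norml => /andP[].
  exists M => x /= Ux; have [k /= xk] := filter_ex Ux.
  by apply: le_trans xk _; have := uM k; rewrite ler_norml => /andP[].
exists (sup S) => e e0.
have [x Sx xe] := sup_adherent e0 supS.
have nS : ~ S (sup S + e / 2).
  move=> /(sup_upper_bound supS); rewrite gerDl leNgt divr_gt0 //.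
have [/nS[]|Uc] := in_ultra_setVsetC [set k | sup S + e / 2 <= u k] UU.
apply: filterS2 Sx Uc => k /= xk /negP; rewrite -ltNge => ks.
rewrite ltr_norml; apply/andP; split; lra.
Qed.

Definition ucvg m n (A : nat -> 'M[C]_(m, n)) (B : 'M[C]_(m, n)) : Prop :=
  forall e : R, 0 < e -> U [set k | mxopnorm (A k - B) < e].

Lemma ucvg_exists m n (A : nat -> 'M[C]_(m, n)) (M : R) :
  (forall k, mxopnorm (A k) <= M) -> exists B, ucvg A B.
Proof.
move=> AM.
have Rb (z : C) : `|complex.Re z| <= nm z by rewrite -lecR nmE; exact: normc_ge_Re.
have Ib (z : C) : `|complex.Im z| <= nm z.
  have -> : complex.Im z = - complex.Re (z * 'i%C) by rewrite ReiNIm opprK.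
  rewrite normrN; apply: le_trans (Rb _) _; rewrite -lecR !nmE normrM.
  by rewrite (_ : `|'i%C : C| = 1) ?mulr1 // normc_def /= expr0n add0r expr1n sqrtr1.
have zb k i j : nm (A k i j) <= M by apply: le_trans (nm_entry _ _ _) _.
have /choice[re hre] : forall ij : 'I_m * 'I_n, exists l, forall e, 0 < e ->
    U [set k | `|complex.Re (A k ij.1 ij.2) - l| < e].
  by move=> ij; apply: (@ulim_real _ M) => k; apply: le_trans (Rb _) _.
have /choice[im him] : forall ij : 'I_m * 'I_n, exists l, forall e, 0 < e ->
    U [set k | `|complex.Im (A k ij.1 ij.2) - l| < e].
  by move=> ij; apply: (@ulim_real _ M) => k; apply: le_trans (Ib _) _.
exists (\matrix_(i, j) (re (i, j) +i* im (i, j))%C) => e e0.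
pose c : R := (m * n)%:R + 1; have c0 : 0 < c by rewrite ltr_wpDl ?ler0n.
pose e' := e / c / 2; have e'0 : 0 < e' by rewrite !divr_gt0.
have Uij : U [set k | forall ij : 'I_m * 'I_n,
    `|complex.Re (A k ij.1 ij.2) - re ij| < e' /\ `|complex.Im (A k ij.1 ij.2) - im ij| < e'].
  apply: filter_forall => ij; exact: filterI (hre ij _ e'0) (him ij _ e'0).
apply: filterS Uij => k /= h; apply: le_lt_trans (mxopnorm_entries _) _.
apply: (@le_lt_trans _ _ (\sum_(i < m) \sum_(j < n) (e / c))).
  apply: ler_sum => i _; apply: ler_sum => j _; rewrite !mxE.
  have [h1 h2] := h (i, j); move: h1 h2 => /=.
  case: (A k i j) => a b /= h1 h2.
  have -> : (a +i* b)%C - (re (i, j) +i* im (i, j))%C =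
     (a - re (i, j))%:C + 'i%C * (b - im (i, j))%:C by rewrite [LHS]complexE.
  have nmD (x y : C) : nm (x + y) <= nm x + nm y by rewrite -lecR rmorphD /= !nmE ler_normD.
  have nmr (x : R) : nm (x%:C) = `|x|.
    by apply: complexI; rewrite nmE normc_def /= expr0n addr0 sqrtr_sqr.
  apply: le_trans (nmD _ _) _.
  have -> : nm ('i%C * (b - im (i, j))%:C) = `|b - im (i, j)|.
    rewrite -nmr; apply: complexI; rewrite !nmE normrM.
    by rewrite (_ : `|'i%C : C| = 1) ?mul1r // normc_def /= expr0n add0r expr1n sqrtr1.
  rewrite nmr [leRHS]splitr -/e' ; apply: lerD; exact: ltW.
rewrite !sumr_const !card_ord -mulrnA -mulr_natr -mulrA -[ltRHS]mulr1.
rewrite ltr_pM2l // ltr_pdivrMl // mulr1 /c mulnC ltrDl //.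
Qed.

Lemma ucvg_unique m n (A : nat -> 'M[C]_(m, n)) B B' : ucvg A B -> ucvg A B' -> B = B'.
Proof.
move=> AB AB'; apply/eqP; rewrite -subr_eq0; apply/eqP/mxopnorm_eq0/le_anti.
rewrite mxopnorm_ge0 andbT leNgt; apply/negP => e0.
have e2 : 0 < mxopnorm (B - B') / 2 by rewrite divr_gt0.
have [k [/= h h']] := filter_ex (filterI (AB _ e2) (AB' _ e2)).
have := ltrD h h'; rewrite -splitr ltNge => /negP; apply.
have -> : B - B' = (A k - B') - (A k - B) by rewrite opprB [RHS]addrC subrKA.
by apply: le_trans (mxopnormD _ _) _; rewrite mxopnormN addrC.
Qed.

Lemma cvg_ucvg m n (A : nat -> 'M[C]_(m, n)) B :
  (forall e : R, 0 < e -> exists N, forall k, (N <= k)%N -> mxopnorm (A k - B) < e) ->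
  ucvg A B.
Proof.
move=> h e /h[N hN]; apply: filterS (U_tail N) => k; exact: hN.
Qed.

Lemma ucvg_mul m n p q (L : 'M[C]_(p, m)) (L' : 'M[C]_(n, q))
    (A : nat -> 'M[C]_(m, n)) B :
  ucvg A B -> ucvg (fun k => L *m A k *m L') (L *m B *m L').
Proof.
move=> AB e e0; pose c := mxopnorm L * mxopnorm L' + 1.
have c0 : 0 < c by rewrite ltr_wpDl ?mulr_ge0 ?mxopnorm_ge0.
apply: filterS (AB _ (divr_gt0 e0 c0)) => k /= h.
have -> : L *m A k *m L' - L *m B *m L' = L *m (A k - B) *m L'.
  by rewrite mulmxBr mulmxBl.
apply: le_lt_trans (mxopnormM _ _) _.
apply: (@le_lt_trans _ _ (mxopnorm L * mxopnorm (A k - B) * mxopnorm L')).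
  by rewrite ler_wpM2r ?mxopnorm_ge0 ?mxopnormM.
rewrite mulrAC; apply: (@le_lt_trans _ _ (mxopnorm L * mxopnorm L' * (e / c))).
  by rewrite ler_wpM2l ?mulr_ge0 ?mxopnorm_ge0 // ltW.
rewrite mulrA ltr_pdivrMr // [ltRHS]mulrC ltr_pM2r // /c ltrDl //.
Qed.

Lemma mxopnorm_block_diag m n (A : 'M[C]_m) (B : 'M[C]_n) :
  mxopnorm (block_mx A 0 0 B) <= mxopnorm A + mxopnorm B.
Proof.
apply/mxopnorm_leP => [|v]; first by rewrite addr_ge0 ?mxopnorm_ge0.
rewrite -[v]vsubmxK mul_block_col !mul0mx addr0 add0r.
have csq_col_mx p q (x : 'cV[C]_p) (y : 'cV[C]_q) : csq (col_mx x y) = csq x + csq y.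
  rewrite /csq big_split_ord /=.
  by congr (_ + _); apply: eq_bigr => i _; rewrite ?col_mxEu ?col_mxEd.
rewrite !csq_col_mx mulrDr; apply: lerD.
  apply: le_trans (csq_mulmx _ _) _; rewrite ler_wpM2r ?csq_ge0 //.
  by rewrite ler_pXn2r ?nnegrE ?addr_ge0 ?mxopnorm_ge0 // lerDl mxopnorm_ge0.
apply: le_trans (csq_mulmx _ _) _; rewrite ler_wpM2r ?csq_ge0 //.
by rewrite ler_pXn2r ?nnegrE ?addr_ge0 ?mxopnorm_ge0 // lerDr mxopnorm_ge0.
Qed.

Lemma ucvg_block_diag m n (A : nat -> 'M[C]_m) (A' : nat -> 'M[C]_n) B B' :
  ucvg A B -> ucvg A' B' ->
  ucvg (fun k => block_mx (A k) 0 0 (A' k)) (block_mx B 0 0 B').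
Proof.
move=> AB AB' e e0; have e2 : 0 < e / 2 by rewrite divr_gt0.
apply: filterS2 (AB _ e2) (AB' _ e2) => k /= h h'.
rewrite opp_block_mx add_block_mx !oppr0 !addr0.
by apply: le_lt_trans (mxopnorm_block_diag _ _) _; rewrite [ltRHS]splitr ltrD.
Qed.

(** It serves for finiteness and for error terms only, so a crude constant does no harm. *)
Lemma blockbd_sum k n (F : 'I_k -> 'I_k -> 'M[C]_n) :
  blockbd F (k%:R * \sum_i \sum_j mxopnorm (F i j)).
Proof.
move=> v; set s := \sum_i _.
have sij i j : mxopnorm (F i j) <= \sum_j mxopnorm (F i j).
  by rewrite (bigD1 j) //= lerDl sumr_ge0 // => *; exact: mxopnorm_ge0.
have si i : \sum_j mxopnorm (F i j) <= s.
  rewrite /s [leRHS](bigD1 i) //= lerDl; do 2!apply: sumr_ge0 => *; exact: mxopnorm_ge0.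
have sq i j : mxopnorm (F i j) ^+ 2 <= mxopnorm (F i j) * s.
  by rewrite expr2 ler_wpM2l ?mxopnorm_ge0 // (le_trans (sij i j)).
have V0 : 0 <= \sum_j csq (v j) by apply: sumr_ge0 => *; exact: csq_ge0.
have s0 : 0 <= s by do 2!apply: sumr_ge0 => ? _; exact: mxopnorm_ge0.
apply: (@le_trans _ _ (\sum_i k%:R * \sum_j (mxopnorm (F i j) * s * \sum_j csq (v j)))).
  apply: ler_sum => i _; apply: le_trans (csq_sum _) _; rewrite ler_wpM2l ?ler0n //.
  apply: ler_sum => j _; apply: le_trans (csq_mulmx _ _) _.
  apply: ler_pM; rewrite ?sqr_ge0 ?csq_ge0 //.
  by rewrite (bigD1 j) //= lerDl sumr_ge0 // => *; exact: csq_ge0.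
rewrite -mulr_sumr.
have -> : \sum_i \sum_j (mxopnorm (F i j) * s * \sum_j csq (v j)) = s * s * \sum_j csq (v j).
  rewrite {2}/s !mulr_suml; apply: eq_bigr => i _; rewrite !mulr_suml.
  by apply: eq_bigr => j _.
rewrite exprMn mulrA ler_wpM2r // -expr2 ler_wpM2r ?sqr_ge0 //.
by rewrite -natrX ler_nat; case: k {F v s sij si sq V0 s0} => // k; rewrite expnS leq_pmulr.
Qed.

Lemma ucvg_blockbd k n (A : nat -> 'I_k -> 'I_k -> 'M[C]_n) B (M : R) :
  0 <= M -> (forall i j, ucvg (fun l => A l i j) (B i j)) ->
  (forall e : R, 0 < e -> U [set l | blockbd (A l) (M + e)]) -> blockbd B M.
Proof.
move=> M0 AB AM; apply/(mxblock_blockbd _ M0).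
apply/ler_addgt0Pr => e e0.
(* The factor by which [blockbd_sum] magnifies a bound common to all entries, plus 1 to keep it
   positive. *)
pose c : R := k%:R * (k * k)%:R + 1.
have c0 : 0 < c by rewrite ltr_wpDl // mulr_ge0 ?ler0n.
pose e' := e / c / 2; have e'0 : 0 < e' by rewrite !divr_gt0.
have Uij : U [set l | forall ij : 'I_k * 'I_k, mxopnorm (A l ij.1 ij.2 - B ij.1 ij.2) < e'].
  by apply: filter_forall => ij; exact: AB.
have e20 : 0 < e / 2 by rewrite divr_gt0.
have [l [/= h hM]] := filter_ex (filterI Uij (AM _ e20)).
have -> : \mxblock_(i < k, j < k) B i j =
    \mxblock_(i < k, j < k) A l i j + \mxblock_(i < k, j < k) (B i j - A l i j).
  by rewrite -mxblockD; apply: eq_mxblock => i j; rewrite addrC subrK.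
apply: le_trans (mxopnormD _ _) _; rewrite [e in leRHS]splitr addrA.
apply: lerD; first by apply/mxblock_blockbd; rewrite // addr_ge0 // ltW.
have := @blockbd_sum k n (fun i j => B i j - A l i j).
set s := k%:R * _ => hs.
have s0 : 0 <= s by rewrite mulr_ge0 ?ler0n //; do 2!apply: sumr_ge0 => ? _; exact: mxopnorm_ge0.
move/(mxblock_blockbd _ s0): hs => hs; apply: le_trans hs _.
apply: (@le_trans _ _ (k%:R * \sum_(i < k) \sum_(j < k) e')).
  rewrite ler_wpM2l ?ler0n //; apply: ler_sum => i _; apply: ler_sum => j _.
  by rewrite -mxopnormN opprB; exact: ltW (h (i, j)).
have -> : k%:R * (\sum_(i < k) \sum_(j < k) e') = (k%:R * (k * k)%:R) * e'.
  by rewrite !sumr_const !card_ord -mulrnA -[e' *+ _]mulr_natr; ring.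
rewrite /e' [leLHS]mulrA ler_pM2r ?invr_gt0 //.
rewrite mulrA ler_pdivrMr // mulrC ler_pM2l // /c lerDl //.
Qed.

End Ultralimit.

(** * Extension from the zero set to the ball *)

Section Extension.
Context (R : realType) (d : nat).
Local Notation C := R[i].
Local Notation poly := (seq (C * seq 'I_d)).
Context (H K : completeNormedModType C) (Q : 'I_d -> {linear H -> K}).
Hypothesis hilbH : is_hilbert H.
Hypothesis hilbK : is_hilbert K.
Hypothesis Qcont : forall j, continuous (Q j).
Hypothesis Qindep : lin_indep Q.
Local Notation D := (opball Q).
Context (U : set_system nat) (UU : UltraFilter U) (sU : \oo `<=` U).

Lemma blockbd_entry k n (F : 'I_k -> 'I_k -> 'M[C]_n) (M : R) i j :
  0 <= M -> blockbd F M -> mxopnorm (F i j) <= M.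
Proof.
move=> M0 hF; apply/mxopnorm_leP => // v.
have := hF (fun j' => if j' == j then v else 0).
have c0 : csq (0 : 'cV[C]_n) = 0 by rewrite /csq big1 // => l _; rewrite mxE nsq0.
have -> : \sum_j' csq (if j' == j then v else 0) = csq v.
  rewrite (bigD1 j) //= eqxx big1 ?addr0 // => l lj.
  by rewrite (negPf lj).
apply: le_trans; rewrite (bigD1 i) //= (bigD1 j) //= eqxx [X in csq (_ + X)]big1 ?addr0.
  by rewrite lerDl sumr_ge0 // => *; exact: csq_ge0.
by move=> l lj; rewrite (negPf lj) mulmx0.
Qed.

Lemma peval_simpt (X : mxuniv R d) (S : 'M[C]_(lvl X)) s : S \in unitmx ->
  peval (coord (simpt S)) s = invmx S *m peval (coord X) s *m S.
Proof.
move=> uS; have := @peval_intertwine R d _ _ (coord X) (coord (simpt S)) S _ s.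
move=> h; rewrite -mulmxA h ?mulKmx // => j.
have : S *m (invmx S *m coord X j *m S) = coord X j *m S by rewrite -mulmxA mulKVmx.
by move=> e; apply: esym; exact: e.
Qed.

Lemma ultralimit_poly (S : nat -> poly) :
  (forall X, D X -> exists M : R, forall m, mxopnorm (peval (coord X) (S m)) <= M) ->
  exists F : gfun D, is_ncfun F /\
    forall X (hX : D X), ucvg U (fun m => peval (coord X) (S m)) (F X hX).
Proof.
move=> hS.
have ex X (hX : D X) : exists B, ucvg U (fun m => peval (coord X) (S m)) B.
  by have [M hM] := hS X hX; exact: (ucvg_exists UU hM).
exists (fun X hX => sval (cid (ex X hX))).
have cv X (hX : D X) : ucvg U (fun m => peval (coord X) (S m)) (sval (cid (ex X hX))).
  by case: cid.
split; last exact: cv.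
split=> [X Y hX hY hXY|X T hX hT uT].
  apply: (ucvg_unique UU (cv _ hXY)).
  have := ucvg_block_diag UU (cv _ hX) (cv _ hY).
  under [X in ucvg _ X _]funext do rewrite -peval_dsum.
  exact.
apply: (ucvg_unique UU (cv _ hT)).
have := ucvg_mul UU (invmx T) T (cv _ hX).
under [X in ucvg _ X _]funext do rewrite -peval_simpt //.
exact.
Qed.

Lemma pfun_ncfun (E : set (mxuniv R d)) s : is_ncfun (@pfun R d E s).
Proof.
split=> [X Y hX hY hXY|X T hX hT uT]; last exact: peval_simpt.
exact: (peval_dsum (coord X) (coord Y) s).
Qed.

Lemma archi (x : R) : exists N, forall k, (N <= k)%N -> x < k%:R.
Proof.
exists (Num.bound x) => k Nk; apply: le_lt_trans (ler_norm x) _.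
apply: lt_le_trans (Num.Theory.archi_boundP (normr_ge0 x)) _.
rewrite ler_nat; apply: leq_trans Nk.
by rewrite /Num.bound normr_id.
Qed.

Section OnZeroSet.
Context (J : set (gfun D)) (JP : homideal J) (E : set (mxuniv R d)).
Hypothesis hE : forall X, E X <-> D X /\ forall f, J f -> forall hX, f X hX = 0.

Let ncE : ncset Q E := zeroset_ncset Qcont JP hE.

Let sED X : E X -> D X. Proof. by move=> /hE[]. Qed.

Lemma fejmean_lim (f : gfun E) (M : R) X (hX : E X) (e : R) : is_ncfun f ->
  (forall X hX, mxopnorm (f X hX) <= M) -> 0 < e ->
  exists N, forall m, (N <= m)%N -> forall hT : E (tenspt (nshift R m.+1) X),
    mxopnorm (@fejmean R m (lvl X) (f _ hT) - f X hX) < e.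
Proof.
move=> ncf fM e0; have [B B0 hB] := fejmean_cvg Qcont ncE ncf fM hX.
have [N hN] := archi ((B / e) ^+ 2); exists N => k Nk hT.
rewrite -mxopnormN opprB; apply: le_lt_trans (hB _ _) _.
have k0 : 0 < Num.sqrt k.+1%:R :> R by rewrite sqrtr_gt0 ltr0n.
rewrite ltr_pdivrMr // mulrC -ltr_pdivrMr //.
rewrite -(@ltr_pXn2r _ 2) ?nnegrE ?divr_ge0 ?(ltW e0) ?(ltW k0) //.
rewrite sqr_sqrtr ?ler0n //; apply: hN; exact: leqW.
Qed.

Lemma fejmean_ucvg (f : gfun E) (M : R) (P : nat -> poly) : is_ncfun f ->
  (forall X hX, mxopnorm (f X hX) <= M) ->
  (forall m X (hT : E (tenspt (nshift R m.+1) X)),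
    peval (coord X) (P m) = @fejmean R m (lvl X) (f _ hT)) ->
  forall X (hX : E X), ucvg U (fun m => peval (coord X) (P m)) (f X hX).
Proof.
move=> ncf fM hP X hX; apply: (cvg_ucvg UU sU) => e e0.
have [N hN] := fejmean_lim hX ncf fM e0; exists N => k Nk.
by rewrite (hP k X (ncset_nshift Qcont ncE k hX)); exact: hN.
Qed.

Lemma extension_hinf k (f : 'I_k -> 'I_k -> gfun E) (M : R) : (0 < k)%N -> 0 <= M ->
  (forall i j, is_ncfun (f i j)) ->
  (forall X (hX : E X), blockbd (fun i j => f i j X hX) M) ->
  exists F : 'I_k -> 'I_k -> gfun D,
    [/\ forall i j, is_ncfun (F i j),
        forall X (hX : D X), blockbd (fun i j => F i j X hX) M &
        forall i j X (hX : E X) (hD : D X), F i j X hD = f i j X hX].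
Proof.
move=> k0 M0 ncf fM.
case: (pselect (exists X, E X)) => [exE|nE]; last first.
  exists (fun _ _ => pfun [::]); split=> [i j|X hX v|i j X hX].
  - exact: pfun_ncfun.
  - rewrite big1 => [|i _]; first by rewrite mulr_ge0 ?sqr_ge0 ?sumr_ge0 // => *; exact: csq_ge0.
    rewrite big1 => [|j _]; last by rewrite /pfun /peval big_nil mul0mx.
    by rewrite /csq big1 // => l _; rewrite mxE nsq0.
  - by case: nE; exists X.
(* The slack 1/(m+1) is at most 1, which gives uniform boundedness, and tends to 0, which restores M
   in the limit. *)
have ep m : 0 < m.+1%:R^-1 :> R by rewrite invr_gt0 ltr0n.
have /choice[P hP] : forall m : nat, exists P : 'I_k -> 'I_k -> poly,
    (forall X, D X -> blockbd (fun i j => peval (coord X) (P i j)) (M + m.+1%:R^-1)) /\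
    forall i j X (hT : E (tenspt (nshift R m.+1) X)),
      peval (coord X) (P i j) = @fejmean R m (lvl X) (f i j _ hT).
  move=> m; exact: (poly_extension hilbH hilbK Qcont Qindep JP hE exE k0 M0 ncf fM m (ep m)).
have PM1 m X : D X -> blockbd (fun i j => peval (coord X) (P m i j)) (M + 1).
  move=> DX; have [h _] := hP m; apply: blockbd_le (h X DX).
    by rewrite addr_ge0 // ltW.
  by rewrite lerD2l invf_le1 ?ltr0n // ler1n.
have /choice[F hF] : forall ij : 'I_k * 'I_k, exists F : gfun D, is_ncfun F /\
    forall X (hX : D X), ucvg U (fun m => peval (coord X) (P m ij.1 ij.2)) (F X hX).
  move=> ij; apply: ultralimit_poly => X DX; exists (M + 1) => m.
  by apply: (blockbd_entry ij.1 ij.2 _ (PM1 m X DX)); rewrite addr_ge0.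
exists (fun i j => F (i, j)); split=> [i j|X hX|i j X hX hD].
- by case: (hF (i, j)).
- apply: (ucvg_blockbd UU (A := fun m i j => peval (coord X) (P m i j))) => //.
    by move=> i j; case: (hF (i, j)) => _; apply.
  move=> e e0; have [N hN] := archi e^-1.
  apply: sU; exists N => //= m Nm; have [h _] := hP m.
  apply: blockbd_le (h X hX); first by rewrite addr_ge0 // ltW.
  rewrite lerD2l -[e]invrK lef_pV2 ?posrE ?invr_gt0 ?ltr0n //.
  by apply: ltW; apply: hN; exact: leqW.
have [_ h] := hF (i, j); apply: (ucvg_unique UU (h X hD)) => /=.
apply: (@fejmean_ucvg _ M _ (ncf i j)).
  by move=> Z hZ; exact: (blockbd_entry i j M0 (fM Z hZ)).
by move=> m Z hT; have [_ ->] := hP m.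
Qed.

(** Each of the finitely many terms t loses a fraction of at most [size t.2] over m+1, while
    monomials are uniformly bounded on the ball. *)
Lemma poly_fejer s : exists2 c : R, 0 <= c & forall m X, D X ->
  mxopnorm (peval (coord X) s - peval (coord X) (pmask (fejer R m) s)) <= c / m.+1%:R.
Proof.
elim: s => [|t s [c c0 hc]].
  by exists 0 => // m X DX; rewrite mul0r /peval !big_nil subrr mxopnorm0.
have [B B0 hB] := peval_bounded hilbK Qindep [:: t].
exists ((size t.2)%:R * B + c) => [|m X DX]; first by rewrite addr_ge0 ?mulr_ge0 ?ler0n.
have -> : peval (coord X) (t :: s) - peval (coord X) (pmask (fejer R m) (t :: s)) =
  (1 - fejer R m (size t.2)) *: peval (coord X) [:: t] +
  (peval (coord X) s - peval (coord X) (pmask (fejer R m) s)).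
  rewrite /peval /= !big_cons big_nil addr0 opprD addrACA; congr (_ + _).
  by rewrite /= scalerBl scale1r scalerA.
apply: le_trans (mxopnormD _ _) _; rewrite mulrDl lerD ?hc //.
apply: le_trans (mxopnormZ_le _ _) _; rewrite [complex.Re _]lock -/(nm _).
rewrite mulrAC; apply: ler_pM; rewrite ?nm_ge0 ?mxopnorm_ge0 //; last first.
  by apply: hB; apply/(opballP Qcont).
have [f0 [f1 f2]] := fejer_bounds R m (size t.2).
rewrite -lecR nmE ger0_norm ?subr_ge0 //.
by rewrite rmorphM /= fmorphV !rmorph_nat.
Qed.

Lemma extension_poly k (p : 'I_k -> 'I_k -> poly) (M : R) : (0 < k)%N -> 0 <= M ->
  (forall X, E X -> blockbd (fun i j => peval (coord X) (p i j)) M) ->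
  forall eps : R, 0 < eps -> exists P : 'I_k -> 'I_k -> poly,
    (forall X, D X -> blockbd (fun i j => peval (coord X) (P i j)) (M + eps)) /\
    forall i j X, E X -> peval (coord X) (P i j) = peval (coord X) (p i j).
Proof.
move=> k0 M0 pM eps eps0.
case: (pselect (exists X, E X)) => [exE|nE]; last first.
  exists (fun _ _ => [::]); split=> [X hX v|i j X hX]; last by case: nE; exists X.
  rewrite big1 => [|i _].
    rewrite mulr_ge0 ?sqr_ge0 ?sumr_ge0 // => *; exact: csq_ge0.
  rewrite big1 => [|j _]; last by rewrite /peval big_nil mul0mx.
  by rewrite /csq big1 // => l _; rewrite mxE nsq0.
have /choice[c hc] : forall ij : 'I_k * 'I_k, exists c : R, 0 <= c /\ forall m X, D X ->
    mxopnorm (peval (coord X) (p ij.1 ij.2) -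
      peval (coord X) (pmask (fejer R m) (p ij.1 ij.2))) <= c / m.+1%:R.
  by move=> ij; have [c c0 hc] := poly_fejer (p ij.1 ij.2); exists c.
pose cc : R := k%:R * \sum_i \sum_j c (i, j).
have e20 : 0 < eps / 2 by rewrite divr_gt0.
have [m hm] := archi (cc / (eps / 2)).
have ncp i j := @pfun_ncfun E (p i j).
have [P [PD PE]] := poly_extension hilbH hilbK Qcont Qindep JP hE exE k0 M0 ncp pM m e20.
(* P extends the Fejer mean of p, not p; adding p minus its mean, which is uniformly small on the
   ball for this m, corrects the values on E. *)
pose r i j := p i j ++ pscale (-1) (pmask (fejer R m) (p i j)).
have rE n (X : 'I_d -> 'M[C]_n) i j :
    peval X (r i j) = peval X (p i j) - peval X (pmask (fejer R m) (p i j)).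
  by rewrite peval_cat peval_scale scaleN1r.
exists (fun i j => P i j ++ r i j); split=> [X DX|i j X EX]; last first.
  rewrite peval_cat rE (PE i j X (ncset_nshift Qcont ncE m EX)).
  have -> : @fejmean R m (lvl X) (@pfun R d E (p i j) _ (ncset_nshift Qcont ncE m EX)) =
      peval (coord X) (pmask (fejer R m) (p i j)) by exact: fejmean_peval.
  by rewrite addrC subrK.
have Me : 0 <= M + eps / 2 by rewrite addr_ge0 // ltW.
apply/mxblock_blockbd; first by rewrite addr_ge0 // ltW.
rewrite [X in mxopnorm X](_ : _ = \mxblock_(i < k, j < k) peval (coord X) (P i j) +
    \mxblock_(i < k, j < k) peval (coord X) (r i j)); last first.
  by rewrite -mxblockD; apply: eq_mxblock => i j; rewrite peval_cat.
apply: le_trans (mxopnormD _ _) _; rewrite [eps]splitr addrA; apply: lerD.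
  by apply/mxblock_blockbd => //; exact: PD.
have := @blockbd_sum R k _ (fun i j => peval (coord X) (r i j)).
set s := k%:R * _ => hs.
have s0 : 0 <= s by rewrite mulr_ge0 ?ler0n //; do 2!apply: sumr_ge0 => ? _; exact: mxopnorm_ge0.
move/(mxblock_blockbd _ s0): hs => hs; apply: le_trans hs _.
have m1 : 0 < m.+1%:R :> R by rewrite ltr0n.
apply: (@le_trans _ _ (cc / m.+1%:R)).
  rewrite /cc -mulrA ler_wpM2l ?ler0n // mulr_suml; apply: ler_sum => i _.
  rewrite mulr_suml; apply: ler_sum => j _; rewrite rE.
  by have [_] := hc (i, j); apply.
rewrite ler_pdivrMr // mulrC -ler_pdivrMr //; apply: ltW.
exact: hm (leqnSn m).
Qed.

End OnZeroSet.

End Extension.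

(** * The Nullstellensatz *)

Section Nullstellensatz.
Context (R : realType) (d : nat).
Local Notation C := R[i].
Local Notation poly := (seq (C * seq 'I_d)).
Context (H K : completeNormedModType C) (Q : 'I_d -> {linear H -> K}).
Hypothesis hilbH : is_hilbert H.
Hypothesis hilbK : is_hilbert K.
Hypothesis Qcont : forall j, continuous (Q j).
Hypothesis Qindep : lin_indep Q.
Local Notation D := (opball Q).

Lemma in_ncalg_hinf k (E : set (mxuniv R d)) (f : gfun E) : in_ncalg k f -> in_hinf f.
Proof. by case: k => // -[]. Qed.

Lemma pfun_ncalg k s : in_ncalg k (@pfun R d D s).
Proof.
have hp : in_hinf (@pfun R d D s).
  split; first exact: pfun_ncfun.
  have [M M0 hM] := peval_bounded hilbK Qindep s; exists M => X hX.
  by apply: hM; apply/(opballP Qcont).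
case: k => //=; split=> // e e0; exists (pfun s); split.
  exists s => X hX; rewrite /pfun /peval; apply: eq_bigr => t _.
  by rewrite ncmonE.
by move=> X hX; rewrite subrr mxopnorm0 ltW.
Qed.

Definition pelt k s : ncalg D k := NCAlg (introT (asboolP _) (pfun_ncalg k s)).

Lemma pelt_coord k j : ncval (pelt k (plmul j (pconst d 1))) = coordfun j.
Proof.
by apply: gfunP => X hX; rewrite [LHS]peval_lmul peval_const mulmx1.
Qed.

Lemma ncalg_in k (E : set (mxuniv R d)) (F : ncalg E k) : in_ncalg k (ncval F).
Proof. by case: F => F FP /=; exact/asboolP. Qed.

Lemma ncalg_approx k (E : set (mxuniv R d)) (F : ncalg E k) (e : R) :
  k = NormClosed -> 0 < e -> exists t : poly,
    forall X hX, mxopnorm (ncval F X hX - peval (coord X) t) <= e.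
Proof.
move=> kE e0; have := ncalg_in F; rewrite [in in_ncalg _]kE => -[_ /(_ e e0)[p [[t pt] Fp]]].
exists t => X hX; have pE : p X hX = peval (coord X) t.
  by rewrite pt /peval; apply: eq_bigr => u _; rewrite ncmonE.
by rewrite -pE; exact: Fp.
Qed.

Lemma ncalg_nc k (E : set (mxuniv R d)) (F : ncalg E k) : is_ncfun (ncval F).
Proof. by have [] := in_ncalg_hinf (ncalg_in F). Qed.

Lemma ncalg_bdd k (E : set (mxuniv R d)) (F : ncalg E k) :
  exists2 M : R, 0 <= M & forall X hX, mxopnorm (ncval F X hX) <= M.
Proof.
have [_ [M hM]] := in_ncalg_hinf (ncalg_in F).
exists (Num.max 0 M) => [|X hX]; first by rewrite le_max lexx.
by apply: le_trans (hM _ _) _; rewrite le_max lexx orbT.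
Qed.

Lemma gres_ncalg k (E : set (mxuniv R d)) (sED : E `<=` D) (F : ncalg D k) :
  in_ncalg k (gres sED (ncval F)).
Proof.
have [[ncd ncs] [M hM]] := in_ncalg_hinf (ncalg_in F).
have hr : in_hinf (gres sED (ncval F)).
  split; last by exists M => X hX; exact: hM.
  split=> [X Y hX hY hXY|X S hX hS uS]; first exact: ncd.
  exact: ncs.
case: k F ncd ncs hM hr => // F _ _ _ hr; split=> // e e0.
have [_ /(_ e e0)[p [[s ps] hp]]] := ncalg_in F.
exists (gres sED p); split; first by exists s => X hX; exact: ps.
by move=> X hX; exact: hp.
Qed.

Lemma ncnorm_le k (E : set (mxuniv R d)) (F : ncalg E k) (c : R) : 0 <= c ->
  (forall X hX, mxopnorm (ncval F X hX) <= c) -> ncnorm F <= c.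
Proof.
move=> c0 h; rewrite /ncnorm; set A := [set r | _].
have [[x Ax]|nA] := pselect (exists x, A x).
  by apply: ge_sup; [exists x|move=> _ [X [hX ->]]].
by rewrite (_ : A = set0) ?sup0 // -subset0 => x Ax; apply: nA; exists x.
Qed.

Lemma ncmxnorm_le k N (E : set (mxuniv R d)) (F : 'M[ncalg E k]_N) (c : R) : 0 <= c ->
  (forall X hX, blockbd (fun i j => ncval (F i j) X hX) c) -> ncmxnorm F <= c.
Proof.
move=> c0 h; rewrite /ncmxnorm; set A := [set r | _].
have [[x Ax]|nA] := pselect (exists x, A x).
  by apply: ge_sup; [exists x|move=> _ [X [hX ->]]; apply/mxblock_blockbd].
by rewrite (_ : A = set0) ?sup0 // -subset0 => x Ax; apply: nA; exists x.
Qed.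

Lemma ncmxnorm_blockbd k N (E : set (mxuniv R d)) (F : 'M[ncalg E k]_N) :
  0 <= ncmxnorm F /\ forall X hX, blockbd (fun i j => ncval (F i j) X hX) (ncmxnorm F).
Proof.
have [M M0 hM] : exists2 M : R, 0 <= M &
    forall X hX, mxopnorm (\mxblock_(i < N, j < N) ncval (F i j) X hX) <= M.
  have /choice[B hB] : forall ij : 'I_N * 'I_N, exists M : R, 0 <= M /\
      forall X hX, mxopnorm (ncval (F ij.1 ij.2) X hX) <= M.
    by move=> ij; have [M M0 hM] := ncalg_bdd (F ij.1 ij.2); exists M.
  pose M := N%:R * \sum_i \sum_j B (i, j).
  have M0 : 0 <= M.
    rewrite mulr_ge0 ?ler0n //; apply: sumr_ge0 => i _; apply: sumr_ge0 => j _.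
    by case: (hB (i, j)).
  exists M => // X hX; apply/mxblock_blockbd => //.
  apply: blockbd_le (blockbd_sum _).
    by rewrite mulr_ge0 ?ler0n //; do 2!(apply: sumr_ge0 => ? _); exact: mxopnorm_ge0.
  rewrite ler_wpM2l ?ler0n //; apply: ler_sum => i _; apply: ler_sum => j _.
  by have [_] := hB (i, j); apply.
rewrite /ncmxnorm; set A := [set r | _].
have uA X hX : mxopnorm (\mxblock_(i < N, j < N) ncval (F i j) X hX) <= sup A.
  apply: ub_le_sup; last by exists X, hX.
  by exists M => _ [Z [hZ ->]].
have s0 : 0 <= sup A.
  have [[x Ax]|nA] := pselect (exists x, A x).
    by have [X [hX _]] := Ax; apply: le_trans (uA X hX); exact: mxopnorm_ge0.
  by rewrite (_ : A = set0) ?sup0 // -subset0 => x Ax; apply: nA; exists x.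
by split=> // X hX; apply/mxblock_blockbd.
Qed.

Lemma blockbdD k n (F G : 'I_k -> 'I_k -> 'M[C]_n) (M M' : R) : 0 <= M -> 0 <= M' ->
  blockbd F M -> blockbd G M' -> blockbd (fun i j => F i j + G i j) (M + M').
Proof.
move=> M0 M0' /(mxblock_blockbd _ M0) hF /(mxblock_blockbd _ M0') hG.
apply/mxblock_blockbd; first exact: addr_ge0.
rewrite mxblockD; apply: le_trans (mxopnormD _ _) _; exact: lerD.
Qed.

(** One bounded sequence serves both topologies. For [NormClosed] a term close to F in norm is used;
    for [Bounded], every admissible topology is coarser than [bdd_pointwise_open], for whose open
    sets bounded pointwise convergence suffices. *)
Lemma topo_closed_seq k (tau : set (set (ncalg D k))) (J : ideal (ncalg D k))
    (F : ncalg D k) (G : nat -> ncalg D k) (M : R) :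
  alg_topology tau -> topo_closed tau J ->
  (forall m, G m \in J) -> (forall m, ncnorm (G m) <= M) ->
  (forall X hX (e : R), 0 < e -> exists N, forall m, (N <= m)%N ->
     mxopnorm (ncval (G m) X hX - ncval F X hX) < e) ->
  (k = NormClosed -> forall e : R, 0 < e -> exists m, ncnorm (G m - F) < e) ->
  F \in J.
Proof.
move=> tauP Jclosed GJ GM GF GFn; apply: contrapT => nFJ.
have Uc : (~` [set G : ncalg D k | G \in J]) F by [].
case: k tau J F G tauP Jclosed GJ GM GF GFn nFJ Uc => tau J F G tauP Jclosed GJ GM GF GFn nFJ Uc.
  move: Jclosed; rewrite /topo_closed tauP => /(_ F Uc)[e e0 he].
  by have [m /he] := GFn erefl e e0; rewrite /= GJ.
have oJ := bdd_pointwise_finest tauP Jclosed.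
have dir : directed (fun m n : nat => (m <= n)%N : Prop).
  split=> [|//|i j l|i j]; [by exists 0%N|exact: leq_trans|].
  by exists (maxn i j); rewrite ?leq_maxl ?leq_maxr.
have [i /(_ i (leqnn i))] : exists i, forall j, (i <= j)%N ->
    (~` [set G : ncalg D Bounded | G \in J]) (G j).
  by apply: (oJ _ _ G F dir) => //; exists M.
by rewrite /= GJ.
Qed.

Section WithIdeal.
Context (k : algkind) (J : ideal (ncalg D k)) (Jhom : homogeneous J).
Local Notation V := (vanset J).
Local Notation sVD := (@vanset_sub _ _ _ _ J).

Definition idealset : set (gfun D) := [set f | exists2 F : ncalg D k, F \in J & ncval F = f].

Lemma idealset_homideal : homideal idealset.
Proof.
have lin a (F G : ncalg D k) : F \in J -> G \in J -> a *: F + G \in J.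
  by move=> FJ GJ; apply: rpredD => //; exact: ideal_scale.
split.
- by exists 0; rewrite ?rpred0.
- by move=> a _ _ [F FJ <-] [G GJ <-]; exists (a *: F + G); first exact: lin.
- move=> j _ [F FJ <-]; exists (pelt k (plmul j (pconst d 1)) * F); first exact: Defs.idealMl.
  by rewrite -(pelt_coord k).
- move=> j _ [F FJ <-]; exists (F * pelt k (plmul j (pconst d 1))); first exact: Defs.idealMr.
  by rewrite -(pelt_coord k).
move=> _ [F FJ <-]; have [c cF hc] := Jhom FJ; exists c => // n.
have [G GJ hG] := hc n; exists G => //; apply: gfunP => X hX.
by rewrite hG hompolyE.
Qed.

Lemma vansetP X : V X <-> D X /\ forall f, idealset f -> forall hX, f X hX = 0.
Proof.
split=> -[DX h]; split=> //; first by move=> _ [F FJ <-] hX; exact: h.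
by move=> F FJ hX; apply: h; exists F.
Qed.

Lemma vanishing_in_ideal (tau : set (set (ncalg D k))) (F : ncalg D k) :
  alg_topology tau -> topo_closed tau J ->
  (forall X (hX : V X), ncval F X (sVD hX) = 0) -> F \in J.
Proof.
move=> tauP Jclosed F0; have ncF := ncalg_nc F.
have FE X (hX : D X) : V X -> ncval F X hX = 0.
  by move=> VX; rewrite -(F0 X VX); congr (ncval F X _); exact: Prop_irrelevance.
have /choice[s hs] : forall m : nat, exists s : poly, idealset (pfun s) /\
    forall X (hT : D (tenspt (nshift R m.+1) X)),
      peval (coord X) s = @fejmean R m (lvl X) (ncval F _ hT).
  move=> m; exact: (vanishing_fejmean hilbH hilbK Qcont idealset_homideal vansetP ncF FE m).
have GJ m : pelt k (s m) \in J.
  have [[G GJ Gs] _] := hs m; rewrite (_ : pelt k (s m) = G) //.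
  exact/val_inj/esym.
have [M M0 hM] := ncalg_bdd F.
have ncD := zeroset_ncset Qcont (homideal0 Q) (@opball_zeroset0 _ _ _ _ Q).
have DT m X : D X -> D (tenspt (nshift R m.+1) X) by exact: opball_nshift.
have sF m X (DX : D X) : peval (coord X) (s m) = @fejmean R m (lvl X) (ncval F _ (DT m X DX)).
  exact: (proj2 (hs m)).
have sM m X : D X -> mxopnorm (peval (coord X) (s m)) <= M.
  by move=> DX; rewrite sF; apply: le_trans (mxopnorm_fejmean _) _; exact: (hM _ (DT m X DX)).
apply: (topo_closed_seq (G := fun m => pelt k (s m)) (M := M) tauP Jclosed GJ).
- by move=> m; apply: ncnorm_le => // X hX; exact: sM.
- move=> X hX e e0.
  have [N hN] := fejmean_lim Qcont (homideal0 Q) (@opball_zeroset0 _ _ _ _ Q) hX ncF hM e0.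
  by exists N => m Nm; rewrite [ncval _ _ _](sF m X hX); exact: hN.
(* A polynomial t near F is interposed: the means of F and t are close by contractivity, t is close
   to its mean for large m, and t to F; each costs e / 4. *)
move=> kE e e0; have e4 : 0 < e / 4 by rewrite divr_gt0.
have [t Ft] := ncalg_approx F kE e4.
have [c c0 hc] := poly_fejer hilbK Qcont Qindep t.
have [m hm] := archi (c / (e / 4)); exists m.
apply: (@le_lt_trans _ _ (e / 4 + e / 4 + e / 4)); last by lra.
apply: ncnorm_le => [|X hX]; first by lra.
have -> : ncval (pelt k (s m) - F) X hX =
    (peval (coord X) (s m) - peval (coord X) (pmask (fejer R m) t)) +
    (peval (coord X) (pmask (fejer R m) t) - peval (coord X) t) +
    (peval (coord X) t - ncval F X hX).
  by rewrite !subrKA.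
apply: le_trans (mxopnormD _ _) _; apply: lerD; last first.
  by rewrite -mxopnormN opprB.
apply: le_trans (mxopnormD _ _) _; apply: lerD; last first.
  rewrite -mxopnormN opprB; apply: le_trans (hc m X hX) _.
  by rewrite ler_pdivrMr ?ltr0n // mulrC -ler_pdivrMr //; apply/ltW/hm.
rewrite (sF m X hX) -fejmean_peval -fejmeanB.
apply: le_trans (mxopnorm_fejmean _) _.
exact: (Ft _ (DT m X hX)).
Qed.

End WithIdeal.

End Nullstellensatz.

(** * The restriction map *)

Section Restriction.
Context (R : realType) (d : nat).
Local Notation C := R[i].
Local Notation poly := (seq (C * seq 'I_d)).
Context (H K : completeNormedModType C) (Q : 'I_d -> {linear H -> K}).
Local Notation D := (opball Q).
Context (k : algkind) (J : ideal (ncalg D k)).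
Local Notation V := (vanset J).
Local Notation sVD := (@vanset_sub _ _ _ _ J).

(** A representative is chosen; elements of J vanish on V, so the choice is immaterial, as
    [restr_pi] shows. *)
Definition restr (q : quotalg J) : ncalg V k :=
  NCAlg (introT (asboolP _) (gres_ncalg sVD (repr q))).

Lemma restr_pi F : ncval (restr (\pi_(quotalg J) F)) = gres sVD (ncval F).
Proof.
apply: gfunP => X hX; have : repr (\pi_(quotalg J) F) - F \in J.
  by apply/quotalgP; rewrite reprK.
by move=> /(proj2 hX) /(_ (sVD hX)) /eqP; rewrite subr_eq0 => /eqP.
Qed.

Lemma restr_is_zmod_morphism : zmod_morphism restr.
Proof.
have restrD x y : restr (x + y) = restr x + restr y.
  rewrite -[x]reprK -[y]reprK -pi_qadd; apply/val_inj.
  by rewrite [LHS]restr_pi [RHS]/(ncval (restr (\pi_(quotalg J) _)) +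
    ncval (restr (\pi_(quotalg J) _))) !restr_pi.
by move=> x y; apply/eqP; rewrite eq_sym subr_eq -restrD subrK.
Qed.

Lemma restr_is_monoid_morphism : monoid_morphism restr.
Proof.
split; first by apply/val_inj; rewrite [LHS]restr_pi.
move=> x y; have -> : x * y = \pi_(quotalg J) (repr x * repr y) by rewrite pi_qmul !reprK.
rewrite -[in RHS](reprK x) -[in RHS](reprK y); apply/val_inj.
by rewrite [LHS]restr_pi [RHS]/(ncval (restr (\pi_(quotalg J) _)) *
    ncval (restr (\pi_(quotalg J) _))) !restr_pi.
Qed.

HB.instance Definition _ :=
  GRing.isZmodMorphism.Build (quotalg J) (ncalg V k) restr restr_is_zmod_morphism.
HB.instance Definition _ :=
  GRing.isMonoidMorphism.Build (quotalg J) (ncalg V k) restr restr_is_monoid_morphism.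

Lemma restr_scalable : scalable restr.
Proof.
move=> a x; have -> : a *: x = \pi_(quotalg J) (a *: repr x) by rewrite pi_qscale reprK.
rewrite -[in RHS](reprK x); apply/val_inj.
by rewrite [LHS]restr_pi [RHS]/(a *: ncval (restr (\pi_(quotalg J) _))) !restr_pi.
Qed.

End Restriction.

(** * Surjectivity and quotient norms *)

Section QuotientNorm.
Context (R : realType) (d : nat).
Local Notation C := R[i].
Local Notation poly := (seq (C * seq 'I_d)).
Context (H K : completeNormedModType C) (Q : 'I_d -> {linear H -> K}).
Hypothesis hilbH : is_hilbert H.
Hypothesis hilbK : is_hilbert K.
Hypothesis Qcont : forall j, continuous (Q j).
Hypothesis Qindep : lin_indep Q.
Local Notation D := (opball Q).
Context (k : algkind) (J : ideal (ncalg D k)) (Jhom : homogeneous J).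
Local Notation V := (vanset J).
Local Notation sVD := (@vanset_sub _ _ _ _ J).
Local Notation pelt := (pelt hilbK Qcont Qindep k).

Let JsP : homideal (idealset J) := idealset_homideal hilbK Qcont Qindep Jhom.

Lemma algkindP : k = NormClosed \/ k = Bounded.
Proof. by case: (k); [left|right]. Qed.

Lemma ncalg_elt (f : gfun D) : in_ncalg k f -> exists F : ncalg D k, ncval F = f.
Proof. by move=> hf; exists (NCAlg (introT (asboolP _) hf)). Qed.

(** F already extends its own restriction; it has to be changed off V so that its norm comes down to
    the bound on V, up to eps. *)
Lemma norm_extension N (F : 'M[ncalg D k]_N) (M eps : R) : 0 <= M -> 0 < eps ->
  (forall X (hX : V X), blockbd (fun i j => ncval (F i j) X (sVD hX)) M) ->
  exists G : 'M[ncalg D k]_N, ncmxnorm G <= M + eps /\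
    forall i j X (hX : V X), ncval (G i j) X (sVD hX) = ncval (F i j) X (sVD hX).
Proof.
move=> M0 eps0 FM; have Me : 0 <= M + eps by lra.
(* The model needs at least one generator, so matrices of size 0 are set aside. *)
case: N F FM => [|N] F FM.
  by exists F; split=> [|[]//]; apply: ncmxnorm_le => // X hX v; rewrite !big_ord0 mulr0.
have [U [UU sU]] := exists_ultrafilter.
case: algkindP => kE; last first.
  have ncF i j : is_ncfun (gres sVD (ncval (F i j))).
    by have /in_ncalg_hinf[] := gres_ncalg sVD (F i j).
  have [G [ncG GM GF]] := extension_hinf hilbH hilbK Qcont Qindep UU sU JsP
    (@vansetP _ _ _ _ _ _ J) (ltn0Sn N) M0 ncF FM.
  have /choice[G' hG'] : forall ij : 'I_N.+1 * 'I_N.+1, exists G' : ncalg D k,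
      ncval G' = G ij.1 ij.2.
    move=> ij; apply: ncalg_elt; rewrite kE; split=> //; exists M => X hX.
    exact: (blockbd_entry ij.1 ij.2 M0 (GM X hX)).
  exists (\matrix_(i, j) G' (i, j)); split=> [|i j X hX]; last first.
    by rewrite mxE hG'; exact: GF.
  apply: ncmxnorm_le => // X hX.
  have h : blockbd (fun i j => ncval ((\matrix_(i, j) G' (i, j)) i j) X hX) M.
    by move=> v; under eq_bigr do under eq_bigr do rewrite mxE hG'; exact: GM.
  by apply: blockbd_le h => //; lra.
(* [blockbd_sum] multiplies a common bound on the entries by (N+1)^3, so entries within [del] give a
   block error of eps / 4. *)
pose del : R := eps / 4 / N.+1%:R ^+ 3.
have del0 : 0 < del by rewrite divr_gt0 ?divr_gt0 // exprn_gt0 // ltr0n.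
have /choice[p hp] : forall ij : 'I_N.+1 * 'I_N.+1, exists t : poly,
    forall X hX, mxopnorm (ncval (F ij.1 ij.2) X hX - peval (coord X) t) <= del.
  by move=> ij; exact: ncalg_approx.
have e4 : 0 <= eps / 4 by lra.
have small n (A : 'I_N.+1 -> 'I_N.+1 -> 'M[C]_n) :
    (forall i j, mxopnorm (A i j) <= del) -> blockbd A (eps / 4).
  move=> hA; apply: blockbd_le (blockbd_sum _).
    rewrite mulr_ge0 ?ler0n //; do 2!(apply: sumr_ge0 => ? _); exact: mxopnorm_ge0.
  apply: (@le_trans _ _ (N.+1%:R * \sum_(i < N.+1) \sum_(j < N.+1) del)).
    by rewrite ler_wpM2l ?ler0n //; apply: ler_sum => i _; apply: ler_sum => j _.
  have c0 : N.+1%:R != 0 :> R by rewrite pnatr_eq0.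
  have sc (x : R) : \sum_(j < N.+1) x = N.+1%:R * x.
    by rewrite sumr_const card_ord mulr_natl.
  under eq_bigr do rewrite sc.
  rewrite sc /del le_eqVlt; apply/orP; left; apply/eqP.
  by field; rewrite nat1r.
have Me4 : 0 <= M + eps / 4 by lra.
have pM X : V X -> blockbd (fun i j => peval (coord X) (p (i, j))) (M + eps / 4).
  move=> hX; have h : blockbd (fun i j => peval (coord X) (p (i, j)) -
      ncval (F i j) X (sVD hX)) (eps / 4).
    by apply: small => i j; rewrite -mxopnormN opprB; exact: (hp (i, j)).
  have := blockbdD M0 e4 (FM X hX) h => h' v; have := h' v.
  by under eq_bigr do under eq_bigr do rewrite addrC subrK.
have e2 : 0 < eps / 2 by lra.
have [P [PD PV]] := extension_poly hilbH hilbK Qcont Qindep JsP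
  (@vansetP _ _ _ _ _ _ J) (ltn0Sn N) Me4 pM e2.
(* P extends the polynomials p from V with control of the norm; adding F - p restores the values of
   F on V at a cost of eps / 4. *)
exists (\matrix_(i, j) (pelt (P i j) + (F i j - pelt (p (i, j))))).
split=> [|i j X hX]; last first.
  rewrite mxE [LHS]/(peval _ _ + (ncval _ _ _ - peval _ _)) (PV i j X hX).
  exact: (subrKC (peval (coord X) (p (i, j)))).
apply: ncmxnorm_le => // X hX.
have h : blockbd (fun i j => peval (coord X) (P i j) +
    (ncval (F i j) X hX - peval (coord X) (p (i, j)))) (M + eps / 4 + eps / 2 + eps / 4).
  by apply: blockbdD => //; [lra|exact: PD|apply: small => i j; exact: (hp (i, j))].
have -> : M + eps = M + eps / 4 + eps / 2 + eps / 4 by lra.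
by move=> v; under eq_bigr do under eq_bigr do rewrite mxE; exact: h.
Qed.

Lemma restriction_surj (f : ncalg V k) :
  exists F : ncalg D k, forall X (hX : V X), ncval F X (sVD hX) = ncval f X hX.
Proof.
have [U [UU sU]] := exists_ultrafilter.
case: algkindP => kE; last first.
  have [M M0 fM] := ncalg_bdd f.
  have [G [ncG GM GF]] := extension_hinf hilbH hilbK Qcont Qindep UU sU JsP
    (@vansetP _ _ _ _ _ _ J) (ltn0Sn 0) M0 (fun _ _ => ncalg_nc f)
    (fun X hX => (blockbd1 _ M0).2 (fM X hX)).
  have [F FG] : exists F : ncalg D k, ncval F = G 0 0.
    apply: ncalg_elt; rewrite kE; split=> //; exists M => X hX.
    exact: (blockbd_entry 0 0 M0 (GM X hX)).
  by exists F => X hX; rewrite FG; exact: GF.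
(* On V consecutive approximants differ by at most e n + e n / 2, hence by 2 e n; extending the
   difference with slack e n costs 3 e n on the ball, and 3 e n = 6 (e n - e n.+1) telescopes. *)
pose e n : R := 2^-1 ^+ n.
have e0 n : 0 < e n by rewrite exprn_gt0 // invr_gt0.
have eS n : e n.+1 = e n / 2 by rewrite /e exprS mulrC.
have e_lt (c : R) : 0 < c -> exists N, forall n, (N <= n)%N -> 6 * e n < c.
  move=> c0; have [N hN] := archi (6 / c); exists N => n Nn.
  rewrite /e exprVn ltr_pdivrMr ?exprn_gt0 // mulrC -ltr_pdivrMr //.
  apply: lt_le_trans (hN n Nn) _.
  by rewrite -natrX ler_nat ltnW // ltn_expl.
have /choice[p hp] n : exists t : poly,
    forall X hX, mxopnorm (ncval f X hX - peval (coord X) t) <= e n.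
  exact: ncalg_approx.
have /choice[g hg] n : exists g : poly,
    (forall X, D X -> mxopnorm (peval (coord X) g) <= 3 * e n) /\
    forall X, V X -> peval (coord X) g = peval (coord X) (p n.+1) - peval (coord X) (p n).
  have n0 : 0 <= 2 * e n by rewrite mulr_ge0 // ltW.
  pose q := p n.+1 ++ pscale (-1) (p n).
  have qE X : peval (coord X) q = peval (coord X) (p n.+1) - peval (coord X) (p n).
    by rewrite peval_cat peval_scale scaleN1r.
  have qM X : V X -> blockbd (fun _ _ : 'I_1 => peval (coord X) q) (2 * e n).
    move=> hX; apply/(blockbd1 _ n0); rewrite qE.
    rewrite -(subrKA (ncval f X hX)); apply: le_trans (mxopnormD _ _) _.
    have := hp n X hX; have := hp n.+1 X hX; rewrite -mxopnormN opprB eS => h h'.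
    by apply: le_trans (lerD h h') _; have := e0 n; lra.
  have [P [PD PV]] := extension_poly hilbH hilbK Qcont Qindep JsP
    (@vansetP _ _ _ _ _ _ J) (ltn0Sn 0) n0 qM (e0 n).
  exists (P 0 0); split=> X hX; last by rewrite -qE; exact: PV.
  have -> : 3 * e n = 2 * e n + e n by lra.
  have h : 0 <= 2 * e n + e n by have := e0 n; lra.
  exact: (blockbd_entry 0 0 h (PD X hX)).
pose S := nat_rect (fun _ => poly) (p 0%N) (fun n s => s ++ g n).
have SV n X : V X -> peval (coord X) (S n) = peval (coord X) (p n).
  move=> hX; elim: n => //= n IHn.
  by rewrite peval_cat IHn (proj2 (hg n)) // addrC subrK.
have SD n j X : D X ->
    mxopnorm (peval (coord X) (S (j + n)%N) - peval (coord X) (S n)) <= 6 * (e n - e (j + n)%N).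
  move=> hX; elim: j => [|j IHj]; first by rewrite !subrr mxopnorm0 mulr0.
  rewrite addSn /= peval_cat addrAC; apply: le_trans (mxopnormD _ _) _.
  have [/(_ X hX) h _] := hg (j + n)%N; apply: le_trans (lerD IHj h) _.
  by rewrite eS; lra.
have SD6 n m X : D X -> (n <= m)%N ->
    mxopnorm (peval (coord X) (S m) - peval (coord X) (S n)) <= 6 * e n.
  move=> hX nm; rewrite -(subnK nm); apply: le_trans (SD _ _ _ hX) _.
  by have := e0 (m - n + n)%N; lra.
have [B B0 hB] := peval_bounded hilbK Qindep (S 0%N).
have S0 X : D X -> mxopnorm (peval (coord X) (S 0%N)) <= B.
  by move=> hX; apply: hB; apply/(opballP Qcont).
(* The sums are uniformly Cauchy; the ultrafilter merely supplies their limit together with its nc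
   properties. *)
have [F [ncF FS]] : exists F : gfun D, is_ncfun F /\
    forall X (hX : D X), ucvg U (fun m => peval (coord X) (S m)) (F X hX).
  apply: (ultralimit_poly UU) => X hX; exists (6 * e 0%N + B) => m.
  rewrite -(subrK (peval (coord X) (S 0%N)) (peval _ _)).
  by apply: le_trans (mxopnormD _ _) _; apply: lerD; [exact: SD6|exact: S0].
have FSn n X (hX : D X) : mxopnorm (F X hX - peval (coord X) (S n)) <= 6 * e n.
  apply/ler_addgt0Pr => c c0.
  have Un : U [set m | (n <= m)%N] by apply: sU; exists n.
  have [m [/= h nm]] := filter_ex (filterI (FS X hX c c0) Un).
  rewrite -(subrKA (peval (coord X) (S m))) addrC; apply: le_trans (mxopnormD _ _) _.
  by apply: lerD; [exact: SD6|rewrite -mxopnormN opprB ltW].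
have [G GF] : exists G : ncalg D k, ncval G = F.
  apply: ncalg_elt; rewrite kE; split.
    split=> //; exists (6 * e 0%N + B) => X hX.
    rewrite -(subrK (peval (coord X) (S 0%N)) (F X hX)).
    by apply: le_trans (mxopnormD _ _) _; apply: lerD; [exact: FSn|exact: S0].
  move=> c c0; have [N hN] := e_lt c c0; exists (pfun (S N)); split.
    exists (S N) => X hX; rewrite /pfun /peval; apply: eq_bigr => t _.
    by rewrite ncmonE.
  by move=> X hX; apply: le_trans (FSn N X hX) _; exact/ltW/hN.
exists G => X hX; rewrite GF; apply: (ucvg_unique UU (FS X (sVD hX))).
apply: (cvg_ucvg UU sU) => c c0; have [N hN] := e_lt c c0; exists N => n Nn.
rewrite SV // -mxopnormN opprB; apply: le_lt_trans (hp n X hX) _.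
by apply: le_lt_trans (hN n Nn); have := e0 n; lra.
Qed.

Lemma ncmxnorm_restr N (F : 'M[ncalg D k]_N) :
  ncmxnorm (map_mx (@restr _ _ _ _ _ _ J) (map_mx \pi_(quotalg J) F)) <= ncmxnorm F.
Proof.
have [F0 hF] := ncmxnorm_blockbd F.
apply: ncmxnorm_le => // X hX v; under eq_bigr do under eq_bigr do rewrite !mxE restr_pi.
exact: hF.
Qed.

Context (tau : set (set (ncalg D k))) (tauP : alg_topology tau).
Hypothesis Jclosed : topo_closed tau J.

Lemma eq_pi_vanset (F G : ncalg D k) :
  (forall X (hX : V X), ncval F X (sVD hX) = ncval G X (sVD hX)) ->
  \pi_(quotalg J) F = \pi_(quotalg J) G.
Proof.
move=> FG; apply/quotalgP.
apply: (vanishing_in_ideal hilbH hilbK Qcont Qindep Jhom tauP Jclosed) => X hX.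
rewrite [LHS]/(ncval F _ _ - ncval G _ _) FG; exact: subrr.
Qed.

Lemma restr_bij : bijective (@restr _ _ _ _ _ _ J).
Proof.
have /choice[h hK] f : exists q : quotalg J, restr q = f.
  have [F FE] := restriction_surj f; exists (\pi_(quotalg J) F).
  by apply/val_inj; rewrite [LHS]restr_pi; apply: gfunP => X hX; exact: FE.
exists h => // q; rewrite -[RHS]reprK -[LHS]reprK; apply: eq_pi_vanset => X hX.
by have /(congr1 (fun f => ncval f X hX)) := hK (restr q).
Qed.

(** Every lift of q dominates its restriction in norm. Conversely [norm_extension] produces, within
    eps, a function that agrees on V with a lift; it is itself a lift of q because functions
    vanishing on V belong to J. *)
Lemma restr_isometric : completely_isometric (@restr _ _ _ _ _ _ J).
Proof.
move=> N q; have qE : map_mx \pi_(quotalg J) (map_mx repr q) = q.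
  by apply/matrixP => i j; rewrite !mxE reprK.
have [F0 hF] := ncmxnorm_blockbd (map_mx (@restr _ _ _ _ _ _ J) q).
apply/le_anti/andP; split.
  apply: lb_le_inf; first by exists (ncmxnorm (map_mx repr q)), (map_mx repr q).
  by move=> _ [F /= <- <-]; exact: ncmxnorm_restr.
apply/ler_addgt0Pr => eps eps0.
have [|G [GM GF]] := norm_extension (F := map_mx repr q) F0 eps0.
  move=> X hX; rewrite (_ : (fun _ _ => _) =
      fun i j => ncval (map_mx (@restr _ _ _ _ _ _ J) q i j) X hX); first exact: hF.
  by apply/funext => i; apply/funext => j; rewrite !mxE.
apply: le_trans GM; apply: ge_inf.
  by exists 0 => _ [A _ <-]; have [] := ncmxnorm_blockbd A.
exists G => //=; rewrite -[RHS]qE; apply/matrixP => i j; rewrite !mxE.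
by apply: eq_pi_vanset => X hX; rewrite GF mxE.
Qed.

End QuotientNorm.

Theorem corollary4p10 (R : realType) (d : nat)
    (H K : completeNormedModType R[i])
    (hilbH : is_hilbert H) (hilbK : is_hilbert K)
    (Q : 'I_d -> {linear H -> K})
    (Qcont : forall j, continuous (Q j)) (Qindep : lin_indep Q)
    (k : algkind) (tau : set (set (ncalg (opball Q) k)))
    (tauP : alg_topology tau)
    (J : ideal (ncalg (opball Q) k))
    (Jclosed : topo_closed tau J) (Jhom : homogeneous J) :
  exists Rbar : {rmorphism quotalg J -> ncalg (vanset J) k},
    [/\ forall F : ncalg (opball Q) k,
          ncval (Rbar (\pi_(quotalg J) F)) =
            gres (@vanset_sub _ _ _ _ J) (ncval F),
        scalable Rbar,
        bijective Rbar &
        completely_isometric Rbar].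
Proof.
exists (@restr _ _ _ _ _ _ J); split; first exact: restr_pi.
- exact: restr_scalable.
- exact: (restr_bij hilbH hilbK Qcont Qindep Jhom tauP Jclosed).
- exact: (restr_isometric hilbH hilbK Qcont Qindep Jhom tauP Jclosed).
Qed.
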